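(* Let $K$ be a field of characteristic zero and $A_1=A_1(K)$ the first Weyl algebra. Assume that every involution on $A_1$ is conjugate to $\alpha$. Let $\gamma$ and $\delta$ be involutions on $A_1$ and let $f$ be an endomorphism from the ring with involution $(A_1,\gamma)$ to the ring with involution $(A_1,\delta)$, i.e. a $K$-algebra endomorphism $f$ of $A_1$ with $f\circ\gamma=\delta\circ f$. Then $f$ is an automorphism of $A_1$.
   Context: $A_1=K\langle X,Y\mid YX-XY=1\rangle$. Endomorphisms, automorphisms and anti-automorphisms are $K$-linear and unital. An involution on $A_1$ is a $K$-linear anti-automorphism of order $2$. The exchange involution $\alpha$ is given by $\alpha(X)=Y$, $\alpha(Y)=X$. An involution $\gamma$ on $A_1$ is conjugate to $\alpha$ if $\gamma=g^{-1}\circ\alpha\circ g$ for some automorphism or anti-automorphism $g$ of $A_1$. *)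

(* Defs.v *)
From HB Require Import structures.
From mathcomp Require Import all_boot all_algebra.
From mathcomp Require Import boolp finmap.
From mathcomp.multinomials Require Import monalg.

Set Implicit Arguments.
Unset Strict Implicit.
Unset Printing Implicit Defensive.

Import GRing.Theory.
Local Open Scope ring_scope.
Local Open Scope quotient_scope.

(* K<X, Y>: the monoid algebra of the words in two letters, [false] standing  *)
(* for X and [true] for Y.                                                    *)
Notation freeXY K := {malg K[{fmonom bool}]}.

Definition freeX {K : nzRingType} : freeXY K := << fmu false >>.
Definition freeY {K : nzRingType} : freeXY K := << fmu true >>.

Definition weyl_rel {K : nzRingType} : freeXY K :=
  freeY * freeX - freeX * freeY - 1.

Definition in_two_sided_ideal (R : nzRingType) (r u : R) : Prop :=
  exists s : seq (R * R), u = \sum_(p <- s) p.1 * r * p.2.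

Section TwoSidedIdeal.
Variables (R : nzRingType) (r : R).
Local Notation I := (in_two_sided_ideal r).

Lemma tsideal0 : I 0.
Proof. by exists [::]; rewrite big_nil. Qed.

Lemma tsideal_gen : I r.
Proof. by exists [:: (1, 1)]; rewrite big_seq1 mul1r mulr1. Qed.

Lemma tsidealB u v : I u -> I v -> I (u - v).
Proof.
move=> [s ->] [t ->]; exists (s ++ [seq (- p.1, p.2) | p <- t]).
rewrite big_cat big_map /= -sumrN; congr (_ + _).
by apply: eq_bigr => p _; rewrite !mulNr.
Qed.

Lemma tsidealD u v : I u -> I v -> I (u + v).
Proof.
move=> Iu Iv; rewrite -[v]opprK; apply: tsidealB => //.
by rewrite -sub0r; apply: tsidealB => //; apply: tsideal0.
Qed.

Lemma tsidealMl a u : I u -> I (a * u).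
Proof.
move=> [s ->]; exists [seq (a * p.1, p.2) | p <- s].
by rewrite big_map mulr_sumr; apply: eq_bigr => p _; rewrite /= !mulrA.
Qed.

Lemma tsidealMr a u : I u -> I (u * a).
Proof.
move=> [s ->]; exists [seq (p.1, p.2 * a) | p <- s].
by rewrite big_map mulr_suml; apply: eq_bigr => p _; rewrite /= !mulrA.
Qed.

End TwoSidedIdeal.

Section FreeAlgebra.
Variable K : fieldType.
Local Notation F := (freeXY K).
Implicit Types (u v : F) (p q : {poly K}).

Lemma free_mulmC c u : u * c%:MP = c *: u.
Proof.
rewrite -mul_malgC !malgM_def fgmulgU fgmulUg; apply: eq_bigr => k _.
by rewrite mulm1 mul1m mulrC.
Qed.

Lemma free_scalerAr c u v : c *: (u * v) = u * (c *: v).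
Proof. by rewrite -!free_mulmC mulrA. Qed.

Lemma free_scaleU c (k : {fmonom bool}) : c *: (<< k >> : F) = << c *g k >>.
Proof. by rewrite -mul_malgC malgM_def fgmulUU mulr1 mul1m. Qed.

(* The action of K<X, Y> on K[X] in which X multiplies by X and Y derives;    *)
(* it is used to see that 1 is not in the ideal generated by [weyl_rel].      *)
Definition word_act (w : seq bool) p : {poly K} :=
  foldr (fun b q => if b then q^`() else 'X * q) p w.

Lemma word_act_is_linear w : linear (word_act w).
Proof.
move=> c p q; elim: w => //= b w ->.
by case: b; rewrite ?derivD ?derivZ // mulrDr scalerAr.
Qed.

HB.instance Definition _ w :=
  GRing.isLinear.Build K {poly K} {poly K} *:%R (word_act w)
    (word_act_is_linear w).

Definition free_act p u : {poly K} :=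
  mmap (@polyC K) (fun k : {fmonom bool} => word_act k p) u.

Lemma free_act_is_zmod_morphism p : zmod_morphism (free_act p).
Proof. exact: mmap_is_additive. Qed.

HB.instance Definition _ p :=
  GRing.isZmodMorphism.Build F {poly K} (free_act p)
    (free_act_is_zmod_morphism p).

Lemma free_actU p c (k : {fmonom bool}) :
  free_act p << c *g k >> = c *: word_act k p.
Proof. by rewrite /free_act mmapU mul_polyC. Qed.

Lemma free_actE p u :
  free_act p u = \sum_(k <- msupp u) u@_k *: word_act k p.
Proof. by apply: eq_bigr => k _; rewrite mul_polyC. Qed.

Lemma free_actM p u v : free_act p (u * v) = free_act (free_act p v) u.
Proof.
rewrite [RHS]free_actE malgME raddf_sum; apply: eq_bigr => i _.
rewrite raddf_sum (free_actE p v) linear_sum scaler_sumr; apply: eq_bigr => j _.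
rewrite /= free_actU fmM /word_act foldr_cat -!/(word_act _ _).
by rewrite linearZ /= scalerA.
Qed.

Lemma free_act0 u : free_act 0 u = 0.
Proof. by rewrite free_actE big1 // => k _; rewrite linear0 scaler0. Qed.

Lemma free_act1 p : free_act p 1 = p.
Proof. by rewrite free_actU fm1 scale1r. Qed.

Lemma free_act_rel p : free_act p weyl_rel = 0.
Proof.
rewrite !raddfB /= !free_actM free_act1 !free_actU !fmU !scale1r /=.
by rewrite derivM derivX mul1r addrK subrr.
Qed.

Lemma weyl_ideal_proper : ~ in_two_sided_ideal (weyl_rel : F) 1.
Proof.
move=> [s /(congr1 (free_act 1))]; rewrite free_act1 raddf_sum big1 => [/eqP|].
  by rewrite oner_eq0.
by move=> p _; rewrite /= -mulrA !free_actM free_act_rel free_act0.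
Qed.

Definition weyl_ideal : {pred F} :=
  [pred u | `[< in_two_sided_ideal weyl_rel u >]].

Lemma weyl_idealP u :
  reflect (in_two_sided_ideal weyl_rel u) (u \in weyl_ideal).
Proof. by rewrite inE; apply: asboolP. Qed.

Lemma weyl_ideal_zmod : zmod_closed weyl_ideal.
Proof.
split=> [|u v /weyl_idealP Iu /weyl_idealP Iv]; apply/weyl_idealP.
  exact: tsideal0.
exact: tsidealB.
Qed.

HB.instance Definition _ := GRing.isZmodClosed.Build F weyl_ideal
  weyl_ideal_zmod.

Lemma weyl_idealZ c u : u \in weyl_ideal -> c *: u \in weyl_ideal.
Proof.
by move=> /weyl_idealP Iu; apply/weyl_idealP; rewrite -mul_malgC;
  apply: tsidealMl.
Qed.

End FreeAlgebra.

Arguments weyl_ideal : clear implicits.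

(* The library puts no ring structure on quotients of noncommutative rings:   *)
(* [{ideal_quot _}] only provides the additive group K<X, Y> / I.             *)
Definition weyl (K : fieldType) := {ideal_quot (weyl_ideal K)}.

Section WeylAlgebra.
Variable K : fieldType.
Local Notation F := (freeXY K).
Local Notation A := (weyl K).
Implicit Types (c : K) (u v : F) (a b : A).

HB.instance Definition _ := Choice.on A.
HB.instance Definition _ := EqQuotient.on A.
HB.instance Definition _ := GRing.Zmodule.on A.

Definition weyl_pi : F -> A := \pi_A.

Lemma weyl_piB : {morph weyl_pi : u v / u - v}.
Proof. exact: raddfB. Qed.

Lemma weyl_piP u v : (weyl_pi u = weyl_pi v) <-> (u - v \in weyl_ideal K).
Proof. by rewrite Quotient.idealrBE; split=> /eqP. Qed.

Lemma weyl_reprK a : weyl_pi (repr a) = a.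
Proof. exact: reprK. Qed.

Lemma weyl_repr u : repr (weyl_pi u) - u \in weyl_ideal K.
Proof. by apply/weyl_piP; rewrite weyl_reprK. Qed.

Definition weyl_one : A := weyl_pi 1.
Definition weyl_mul a b : A := weyl_pi (repr a * repr b).
Definition weyl_scale c a : A := weyl_pi (c *: repr a).

Lemma weyl_piM u v : weyl_mul (weyl_pi u) (weyl_pi v) = weyl_pi (u * v).
Proof.
apply/weyl_piP/weyl_idealP.
have [/weyl_idealP Iu /weyl_idealP Iv] := (weyl_repr u, weyl_repr v).
have -> : repr (weyl_pi u) * repr (weyl_pi v) - u * v =
    (repr (weyl_pi u) - u) * repr (weyl_pi v) + u * (repr (weyl_pi v) - v).
  by rewrite mulrBl mulrBr addrA subrK.
by apply: tsidealD; [apply: tsidealMr | apply: tsidealMl].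
Qed.

Lemma weyl_piZ c u : weyl_scale c (weyl_pi u) = weyl_pi (c *: u).
Proof.
by apply/weyl_piP; rewrite -scalerBr; apply/weyl_idealZ/weyl_repr.
Qed.

Lemma weyl_piD u v : weyl_pi (u + v) = weyl_pi u + weyl_pi v.
Proof. exact: raddfD. Qed.

Lemma weyl_ind (P : A -> Prop) : (forall u, P (weyl_pi u)) -> forall a, P a.
Proof. by move=> Ppi a; rewrite -[a]weyl_reprK. Qed.

Lemma weyl_mulA : associative weyl_mul.
Proof.
elim/weyl_ind=> u; elim/weyl_ind=> v; elim/weyl_ind=> w.
by rewrite !weyl_piM mulrA.
Qed.

Lemma weyl_mul1 : left_id weyl_one weyl_mul.
Proof. by elim/weyl_ind=> u; rewrite weyl_piM mul1r. Qed.

Lemma weyl_mulr1 : right_id weyl_one weyl_mul.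
Proof. by elim/weyl_ind=> u; rewrite weyl_piM mulr1. Qed.

Lemma weyl_mulDl : left_distributive weyl_mul +%R.
Proof.
elim/weyl_ind=> u; elim/weyl_ind=> v; elim/weyl_ind=> w.
by rewrite -weyl_piD !weyl_piM mulrDl weyl_piD.
Qed.

Lemma weyl_mulDr : right_distributive weyl_mul +%R.
Proof.
elim/weyl_ind=> u; elim/weyl_ind=> v; elim/weyl_ind=> w.
by rewrite -weyl_piD !weyl_piM mulrDr weyl_piD.
Qed.

Lemma weyl_one_neq0 : weyl_one != 0.
Proof.
apply/eqP; rewrite -[0 : A](subrr weyl_one) -weyl_piB subrr => /weyl_piP.
by rewrite subr0 => /weyl_idealP /weyl_ideal_proper.
Qed.

HB.instance Definition _ := GRing.Zmodule_isNzRing.Build A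
  weyl_mulA weyl_mul1 weyl_mulr1 weyl_mulDl weyl_mulDr weyl_one_neq0.

Lemma weyl_scalerA c d a :
  weyl_scale c (weyl_scale d a) = weyl_scale (c * d) a.
Proof. by elim/weyl_ind: a => u; rewrite !weyl_piZ scalerA. Qed.

Lemma weyl_scale1r : left_id 1 weyl_scale.
Proof. by elim/weyl_ind=> u; rewrite weyl_piZ scale1r. Qed.

Lemma weyl_scalerDr : right_distributive weyl_scale +%R.
Proof.
move=> c; elim/weyl_ind=> u; elim/weyl_ind=> v.
by rewrite -weyl_piD !weyl_piZ scalerDr weyl_piD.
Qed.

Lemma weyl_scalerDl a : {morph weyl_scale^~ a : c d / c + d}.
Proof.
by elim/weyl_ind: a => u c d; rewrite /= !weyl_piZ scalerDl weyl_piD.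
Qed.

HB.instance Definition _ := GRing.Zmodule_isLmodule.Build K A
  weyl_scalerA weyl_scale1r weyl_scalerDr weyl_scalerDl.

Lemma weyl_scalerAl c a b : c *: (a * b) = (c *: a) * b.
Proof.
elim/weyl_ind: a => u; elim/weyl_ind: b => v.
rewrite /GRing.scale /GRing.mul /= !(weyl_piZ, weyl_piM).
by rewrite scalerAl.
Qed.

HB.instance Definition _ := GRing.Lmodule_isLalgebra.Build K A weyl_scalerAl.

Lemma weyl_scalerAr c a b : c *: (a * b) = a * (c *: b).
Proof.
elim/weyl_ind: a => u; elim/weyl_ind: b => v.
rewrite /GRing.scale /GRing.mul /= !(weyl_piZ, weyl_piM).
by rewrite free_scalerAr.
Qed.

HB.instance Definition _ := GRing.Lalgebra_isAlgebra.Build K A weyl_scalerAr.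

Lemma weyl_pi_is_linear : linear weyl_pi.
Proof. by move=> c u v; rewrite weyl_piD -weyl_piZ. Qed.

Lemma weyl_pi_is_monoid_morphism : monoid_morphism weyl_pi.
Proof. by split=> // u v; rewrite -weyl_piM. Qed.

HB.instance Definition _ := GRing.isLinear.Build K F A *:%R weyl_pi
  weyl_pi_is_linear.
HB.instance Definition _ := GRing.isMonoidMorphism.Build F A weyl_pi
  weyl_pi_is_monoid_morphism.

Definition weylX : A := weyl_pi freeX.
Definition weylY : A := weyl_pi freeY.

Lemma weyl_YX : weylY * weylX - weylX * weylY = 1.
Proof.
rewrite -!rmorphM -weyl_piB; apply/weyl_piP/weyl_idealP; exact: tsideal_gen.
Qed.

(* The exchange involution is induced by the anti-automorphism of K<X, Y>     *)
(* that reverses words and swaps the two letters.                             *)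
Definition word_swap (w : {fmonom bool}) : {fmonom bool} :=
  FMonom (rev (map negb w)).

Definition free_swap u : F := \sum_(k <- msupp u) << u@_k *g word_swap k >>.

Definition exchange a : A := weyl_pi (free_swap (repr a)).

Lemma free_swap_mmap :
  free_swap =1 mmap (@malgC {fmonom bool} K) (fun k => << word_swap k >>).
Proof.
move=> u; apply: eq_bigr => k _.
by rewrite malgM_def fgmulUU mulr1 mul1m.
Qed.

Lemma free_swap_is_zmod_morphism : zmod_morphism free_swap.
Proof. by move=> u v; rewrite !free_swap_mmap raddfB. Qed.

HB.instance Definition _ := GRing.isZmodMorphism.Build F F free_swap
  free_swap_is_zmod_morphism.

Lemma free_swapU c k : free_swap << c *g k >> = << c *g word_swap k >>.
Proof.
by rewrite free_swap_mmap mmapU malgM_def fgmulUU mulr1 mul1m.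
Qed.

Lemma word_swapM k l :
  word_swap (mmul k l) = mmul (word_swap l) (word_swap k).
Proof. by apply/val_inj; rewrite /= !fmM /= map_cat rev_cat. Qed.

Lemma word_swapK : involutive word_swap.
Proof.
move=> k; apply/val_inj; rewrite /= map_rev revK -map_comp.
by rewrite (eq_map (g := id)) ?map_id // => b; rewrite /= negbK.
Qed.

Lemma free_swapM u v : free_swap (u * v) = free_swap v * free_swap u.
Proof.
rewrite malgME exchange_big raddf_sum mulr_suml; apply: eq_bigr => j _.
rewrite raddf_sum mulr_sumr; apply: eq_bigr => i _.
by rewrite /= free_swapU word_swapM malgM_def fgmulUU mulrC.
Qed.

Lemma free_swapZ c u : free_swap (c *: u) = c *: free_swap u.
Proof.
rewrite -!mul_malgC free_swapM free_swapU.
have -> : word_swap mone = mone by apply/val_inj; rewrite /= fm1.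
by rewrite free_mulmC mul_malgC.
Qed.

Lemma free_swapK : involutive free_swap.
Proof.
move=> u; rewrite [X in free_swap X]/free_swap raddf_sum [RHS]monalgE.
by apply: eq_bigr => k _; rewrite /= free_swapU word_swapK.
Qed.

Lemma free_swap1 : free_swap 1 = 1.
Proof.
by rewrite free_swapU; congr << _ >>; apply/val_inj; rewrite /= !fm1.
Qed.

Lemma free_swapX : free_swap freeX = freeY.
Proof.
by rewrite free_swapU; congr << _ >>; apply/val_inj; rewrite /= !fmU.
Qed.

Lemma free_swapY : free_swap freeY = freeX.
Proof. by rewrite -free_swapX free_swapK. Qed.

Lemma free_swap_rel : free_swap weyl_rel = weyl_rel.
Proof.
by rewrite !raddfB /= !free_swapM free_swapX free_swapY free_swap1.
Qed.

Lemma free_swap_ideal u :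
  u \in weyl_ideal K -> free_swap u \in weyl_ideal K.
Proof.
move=> /weyl_idealP [s ->]; apply/weyl_idealP.
exists [seq (free_swap p.2, free_swap p.1) | p <- s].
rewrite raddf_sum big_map; apply: eq_bigr => p _.
by rewrite /= !free_swapM free_swap_rel mulrA.
Qed.

Lemma exchange_pi u : exchange (weyl_pi u) = weyl_pi (free_swap u).
Proof.
by apply/weyl_piP; rewrite -raddfB; apply/free_swap_ideal/weyl_repr.
Qed.

Lemma exchangeX : exchange weylX = weylY.
Proof. by rewrite exchange_pi free_swapX. Qed.

Lemma exchangeY : exchange weylY = weylX.
Proof. by rewrite exchange_pi free_swapY. Qed.

End WeylAlgebra.

Arguments exchange {K}.
Arguments weylX {K}.
Arguments weylY {K}.

Section Involutions.
Variables (K : fieldType) (A : algType K).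
Implicit Types (f g : A -> A).

Definition endomorphism f : Prop := linear f /\ monoid_morphism f.

Definition anti_endomorphism f : Prop :=
  [/\ linear f, f 1 = 1 & {morph f : a b / a * b >-> b * a}].

Definition automorphism f : Prop := endomorphism f /\ bijective f.

Definition anti_automorphism f : Prop := anti_endomorphism f /\ bijective f.

(* Order exactly 2: the identity is excluded.                                 *)
Definition involution f : Prop :=
  [/\ anti_automorphism f, f \o f =1 id & ~ (f =1 id)].

Definition conjugate_involution gamma alpha : Prop :=
  exists g g' : A -> A,
    [/\ automorphism g \/ anti_automorphism g, cancel g g', cancel g' g
      & gamma =1 g' \o alpha \o g].

End Involutions.

Lemma exchange_involution (K : fieldType) :
  involution (exchange : weyl K -> weyl K).
Proof.
have K2 : involutive (exchange : weyl K -> weyl K).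
  by elim/weyl_ind=> u; rewrite !exchange_pi free_swapK.
split=> //.
  split; last by exists exchange.
  split.
  - move=> c; elim/weyl_ind=> u; elim/weyl_ind=> v.
    by rewrite -linearP !exchange_pi raddfD /= free_swapZ linearP.
  - by rewrite -(rmorph1 (@weyl_pi K)) exchange_pi free_swap1.
  - elim/weyl_ind=> u; elim/weyl_ind=> v.
    by rewrite -rmorphM !exchange_pi free_swapM rmorphM.
move=> idX; have := weyl_YX K.
rewrite -[weylX]idX exchangeX subrr => /esym/eqP.
by rewrite oner_eq0.
Qed.

(* Main.v *)
Require Import Defs.
From mathcomp Require Import all_boot all_algebra.
From HB Require Import structures.
From mathcomp Require Import all_order generic_quotient ring_quotient.
From mathcomp Require Import boolp classical_sets finmap.
From mathcomp.multinomials Require Import monalg.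
From mathcomp Require Import zify ring lra.

(** The idea of the proof.

    Conjugating f on both sides reduces the statement to an endomorphism f that
    commutes with the exchange involution.  Put u = X + Y and v = (Y - X) / 2;
    then [v, u] = 1, u is symmetric and v is skew.  Hence S = f(u) is symmetric,
    A = f(v) is skew, and [A, S] = 1.  Everything rests on [skew_partner_linear]:
    such an A is a scalar multiple c v.  Granting this, [v, S] = 1 / c shows that
    S - u / c is a polynomial in v, and f is visibly bijective
    ([symmetric_endo_bijective]).

    Consider first the commutative analogue: two polynomials s and a in U and V
    whose Poisson bracket is 1, s even and a odd in V.  Since a vanishes on the
    line V = 0, comparing constant terms shows that U occurs in s and V in a.
    Choose a direction (1, t) and compare the leading monomials of s and a: as
    the bracket is constant, their exponents are parallel or add up to (1, 1).
    Let t decrease from 1 to minus infinity.  If the exponents stayed parallel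
    for ever, then at the end s would lead with a power of U other than 1, and a
    with a monomial divisible by V, which are not parallel.  So at some t the
    second alternative occurs, with leading monomials U and V, and t is positive:
    either t = 1 or the exponents were parallel just before.  As every monomial
    of a is divisible by V, this forces a = c V ([skew_support]).

    The noncommutative statement is reduced to this one modulo a large prime p.
    In characteristic p the elements commuting with S and A are polynomials in
    the central elements u^p and v^p ([centralizer_on_lattice]), so S^p and A^p
    are polynomials s and a in u^p and v^p.  Their parity in v^p comes from the
    involution, and their Poisson bracket from computing modulo p^2: there the
    commutator of two polynomials in u^p and v^p is p! times their Poisson
    bracket ([lie_lattice]), while [A^p, S^p] is p! ([lie_pth_powers]).  Then
    A^p = c v^p gives A = c' v modulo p ([skew_pth_root]).

    Reduction modulo p goes through a valuation ring O of K which contains the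
    coefficients of S and A and the inverses of those of A, and in which p is not
    invertible ([exists_reduction]).  It exists for all large p, because a
    finitely generated subring of K inverts only finitely many primes
    ([few_units_generated]), and a subring that is maximal among those that do
    not contain 1 / p is a valuation ring ([maximal_valuation]).  Valuations are
    needed because S^p must agree with a polynomial in u^p and v^p modulo p
    itself, and not only modulo the maximal ideal of O ([off_lattice_dvd]).
    Finally, the nonzero coefficients of A are units of O, so A has the same
    monomials before and after reduction. *)

Set Implicit Arguments.
Unset Strict Implicit.
Unset Printing Implicit Defensive.

Import Order.TTheory GRing.Theory Num.Theory.
Local Open Scope ring_scope.
Local Open Scope quotient_scope.

(** * The Weyl algebra over a commutative ring, by symbols *)

Section StarProduct.
Variable R : comNzRingType.
Implicit Types (p q r : {poly {poly R}}) (c d : {poly R}).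

Definition duX p := map_poly (@deriv R) p.

Lemma coef_duX p j : (duX p)`_j = (p`_j)^`().
Proof. by rewrite /duX coef_map. Qed.

Lemma duX_is_zmod_morphism : zmod_morphism duX.
Proof. by move=> p q; apply/polyP=> j; rewrite coefB !coef_duX coefB derivB. Qed.

HB.instance Definition _ := GRing.isZmodMorphism.Build {poly {poly R}} {poly {poly R}}
  duX duX_is_zmod_morphism.

Lemma duXZ c p : duX (c *: p) = c^`() *: p + c *: duX p.
Proof.
apply/polyP=> j; rewrite coefD coef_duX !coefZ coef_duX derivM; ring.
Qed.

Lemma duX_Xn n : duX 'X^n = 0.
Proof. by apply/polyP=> j; rewrite coef_duX coefXn coef0; case: eqP => _; rewrite derivC. Qed.

Definition vop p := p * 'X + duX p.

Lemma vop_is_zmod_morphism : zmod_morphism vop.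
Proof. by move=> p q; rewrite /vop mulrBl raddfB /=; ring. Qed.

HB.instance Definition _ := GRing.isZmodMorphism.Build {poly {poly R}} {poly {poly R}}
  vop vop_is_zmod_morphism.

Lemma vopZ c p : vop (c *: p) = c^`() *: p + c *: vop p.
Proof. by rewrite /vop duXZ scalerDr scalerAl addrCA. Qed.

(** Normal ordering: the monomial u^i v^j, with all the u on the left, has the
    symbol X^i Y^j, where Y is the outer variable.  Left multiplication by v acts
    on symbols as [vop], that is, as Y plus the derivation in X. *)
Definition star p q := \sum_(j < size p) p`_j *: iter j vop q.

Lemma starE n p q : (size p <= n)%N -> star p q = \sum_(j < n) p`_j *: iter j vop q.
Proof.
move=> le_pn; rewrite /star (big_ord_widen n (fun j => p`_j *: iter j vop q) le_pn).
rewrite big_mkcond; apply: eq_bigr => j _.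
by case: ltnP => // le_pj; rewrite nth_default // scale0r.
Qed.

Lemma iter_vop_is_zmod_morphism n : zmod_morphism (iter n vop).
Proof. by elim: n => [|n IHn] p q //=; rewrite IHn raddfB. Qed.

HB.instance Definition _ n := GRing.isZmodMorphism.Build {poly {poly R}} {poly {poly R}}
  (iter n vop) (iter_vop_is_zmod_morphism n).

Lemma star_is_zmod_morphism p : zmod_morphism (star p).
Proof.
by move=> q r; rewrite /star -sumrB; apply: eq_bigr => j _; rewrite raddfB scalerBr.
Qed.

HB.instance Definition _ p := GRing.isZmodMorphism.Build {poly {poly R}} {poly {poly R}}
  (star p) (star_is_zmod_morphism p).

Lemma starBl p q r : star (p - q) r = star p r - star q r.
Proof.
set n := maxn (size p) (size q).
have lep : (size p <= n)%N by apply: leq_maxl.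
have leq : (size q <= n)%N by apply: leq_maxr.
rewrite (starE _ lep) (starE _ leq) (@starE n); last first.
  by rewrite (leq_trans (size_polyD _ _)) // size_polyN.
by rewrite -sumrB; apply: eq_bigr => j _; rewrite coefB scalerBl.
Qed.

Lemma star0l r : star 0 r = 0.
Proof. by rewrite /star size_poly0 big_ord0. Qed.

Lemma starDl p q r : star (p + q) r = star p r + star q r.
Proof. by rewrite -[q in LHS]opprK starBl -(sub0r q) starBl star0l sub0r opprK. Qed.

Lemma star_sum I (s : seq I) (P : pred I) (F : I -> {poly {poly R}}) r :
  star (\sum_(i <- s | P i) F i) r = \sum_(i <- s | P i) star (F i) r.
Proof. by elim/big_rec2: _ => [|i x y _ <-]; rewrite ?star0l ?starDl. Qed.

Lemma starZl c p r : star (c *: p) r = c *: star p r.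
Proof.
rewrite (@starE (size p)) ?size_scale_leq // scaler_sumr.
by apply: eq_bigr => j _; rewrite coefZ scalerA.
Qed.

Lemma starXn n r : star 'X^n r = iter n vop r.
Proof.
rewrite (@starE n.+1) ?size_polyXn // big_ord_recr /= coefXn eqxx scale1r.
by rewrite big1 ?add0r // => j _; rewrite coefXn ltn_eqF ?scale0r.
Qed.

Lemma star_ZXn c n r : star (c *: 'X^n) r = c *: iter n vop r.
Proof. by rewrite starZl starXn. Qed.

Lemma star_vop q r : star (vop q) r = vop (star q r).
Proof.
rewrite -[q]coefK poly_def raddf_sum !star_sum raddf_sum; apply: eq_bigr => j _ /=.
rewrite star_ZXn !vopZ starDl !star_ZXn -iterS; congr (_ + _).
by rewrite starZl {1}/vop duX_Xn addr0 -exprSr starXn.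
Qed.

Lemma iter_star_vop n q r : star (iter n vop q) r = iter n vop (star q r).
Proof. by elim: n => //= n IHn; rewrite star_vop IHn. Qed.

(** [star] is the action of p, as a differential operator, on the symbol q; so
    associativity says that [star p q] acts as the composite of p and q. *)
Lemma starA : associative star.
Proof.
move=> p q r; rewrite [in RHS](starE q (leqnn (size p))) star_sum.
by apply: eq_bigr => j _; rewrite starZl iter_star_vop.
Qed.

Lemma star1l r : star 1 r = r.
Proof. by rewrite -(expr0 'X) starXn. Qed.

Lemma iter_vop1 n : iter n vop 1 = 'X^n.
Proof. by elim: n => [|n IHn]; rewrite ?expr0 //= IHn /vop duX_Xn addr0 exprSr. Qed.

Lemma star1r p : star p 1 = p.
Proof.
rewrite -{2}[p]coefK poly_def; apply: eq_bigr => j _.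
by rewrite iter_vop1.
Qed.

End StarProduct.

Definition wey (R : comNzRingType) := {poly {poly R}}.

HB.instance Definition _ (R : comNzRingType) := GRing.Zmodule.on (wey R).

(** The identity, but it prevents a product in [wey R] from being read in the
    commutative ring of symbols. *)
Definition wsym (R : comNzRingType) (x : wey R) : {poly {poly R}} := x.

Section WeylRing.
Variable R : comNzRingType.
Implicit Types (p q : wey R) (c : {poly R}) (a : R).

Lemma wey1_neq0 : (1 : {poly {poly R}}) != 0 :> wey R. Proof. exact: oner_neq0. Qed.

(* Unification would otherwise unfold products into sums. *)
Fact wmul_key : unit. Proof. exact: tt. Qed.
Definition wmul : wey R -> wey R -> wey R := locked_with wmul_key (@star R).

Lemma wmul_star : wmul = @star R. Proof. exact: unlock. Qed.

Lemma wmulA : associative wmul.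
Proof. by rewrite wmul_star; apply: starA. Qed.
Lemma wmul1l : left_id (1 : {poly {poly R}}) wmul.
Proof. by rewrite wmul_star; apply: star1l. Qed.
Lemma wmul1r : right_id (1 : {poly {poly R}}) wmul.
Proof. by rewrite wmul_star; apply: star1r. Qed.
Lemma wmulDl : left_distributive wmul +%R.
Proof. by rewrite wmul_star => p q r; apply: starDl. Qed.
Lemma wmulDr : right_distributive wmul +%R.
Proof. by rewrite wmul_star => p q r; apply: raddfD. Qed.

HB.instance Definition _ := GRing.Zmodule_isNzRing.Build (wey R)
  wmulA wmul1l wmul1r wmulDl wmulDr wey1_neq0.

Lemma weyM p q : p * q = star p q.
Proof. by rewrite -wmul_star. Qed.

Definition wscale a p : wey R := (a%:P : {poly R}) *: (p : {poly {poly R}}).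

Lemma wscaleA a b p : wscale a (wscale b p) = wscale (a * b) p.
Proof. by rewrite /wscale scalerA polyCM. Qed.
Lemma wscale1 : left_id 1 wscale.
Proof. by move=> p; rewrite /wscale scale1r. Qed.
Lemma wscaleDr : right_distributive wscale +%R.
Proof. by move=> a p q; rewrite /wscale scalerDr. Qed.
Lemma wscaleDl p : {morph wscale^~ p : a b / a + b}.
Proof. by move=> a b; rewrite /wscale polyCD scalerDl. Qed.

HB.instance Definition _ := GRing.Zmodule_isLmodule.Build R (wey R)
  wscaleA wscale1 wscaleDr wscaleDl.

Lemma wscaleAl a p q : a *: (p * q) = (a *: p) * q.
Proof. by rewrite !weyM; symmetry; apply: starZl. Qed.
HB.instance Definition _ := GRing.Lmodule_isLalgebra.Build R (wey R) wscaleAl.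

Lemma wscaleAr a p q : a *: (p * q) = p * (a *: q).
Proof.
have itZ n (r : {poly {poly R}}) : iter n (@vop R) (a%:P *: r) = a%:P *: iter n (@vop R) r.
  by elim: n => //= n ->; rewrite vopZ derivC scale0r add0r.
rewrite !weyM /GRing.scale /= /wscale /star scaler_sumr.
by apply: eq_bigr => j _; rewrite itZ !scalerA mulrC.
Qed.
HB.instance Definition _ := GRing.Lalgebra_isAlgebra.Build R (wey R) wscaleAr.

Definition wC c : wey R := c%:P.
Definition wU : wey R := wC 'X.
Definition wV : wey R := ('X : {poly {poly R}}).

Definition wcoef p i j : R := ((wsym p)`_j)`_i.

End WeylRing.
Arguments wU {R}.
Arguments wV {R}.

(** * Universal property, base change and the adjoint *)

Section WeylBasics.
Variable R : comNzRingType.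
Implicit Types (p q : wey R) (c d : {poly R}) (a : R).

Lemma wC_mul c p : wC c * p = (c *: (p : {poly {poly R}}) : wey R).
Proof.
rewrite weyM (@starE _ 1) ?size_polyC ?leq_b1 //.
by rewrite big_ord1 coefC.
Qed.

Lemma wV_mul p : wV * p = vop p.
Proof.
rewrite weyM.
by rewrite /wV -['X]expr1 starXn.
Qed.

Lemma wVXn n : (wV : wey R) ^+ n = ('X^n : {poly {poly R}}).
Proof. by elim: n => [|n IHn] //; rewrite exprS IHn wV_mul /vop duX_Xn addr0 -exprSr. Qed.

Lemma wC_is_zmod_morphism : zmod_morphism (@wC R).
Proof. by move=> c d; rewrite /wC polyCB. Qed.
Lemma wC_is_monoid_morphism : monoid_morphism (@wC R).
Proof. by split=> // c d; rewrite wC_mul /wC polyCM mul_polyC. Qed.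
HB.instance Definition _ := GRing.isZmodMorphism.Build {poly R} (wey R) (@wC R)
  wC_is_zmod_morphism.
HB.instance Definition _ := GRing.isMonoidMorphism.Build {poly R} (wey R) (@wC R)
  wC_is_monoid_morphism.

Lemma wVC c : wV * wC c = wC c * wV + wC c^`().
Proof.
rewrite wV_mul wC_mul /vop /wC; congr (_ + _); first by rewrite mul_polyC.
by apply/polyP=> j; rewrite coef_duX !coefC; case: eqP => // _; rewrite deriv0.
Qed.

Lemma wVU : wV * wU - wU * wV = 1 :> wey R.
Proof. by rewrite wVC derivX rmorph1 addrAC subrr add0r. Qed.

Lemma weyE p : p = \sum_(j < size (wsym p)) wC (wsym p)`_j * wV ^+ j.
Proof.
rewrite -{1}[p]/(wsym p) -{1}[wsym p]coefK poly_def; apply: eq_bigr => j _.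
by rewrite wC_mul wVXn.
Qed.

Lemma wey_ind (P : wey R -> Prop) :
  (forall p q, P p -> P q -> P (p + q)) -> (forall c n, P (wC c * wV ^+ n)) ->
  forall p, P p.
Proof.
move=> PD PM p; rewrite [p]weyE; apply: (big_ind P) => //.
by have := PM 0 0%N; rewrite raddf0 mul0r.
Qed.

Lemma wscaleE a p : a *: p = wC a%:P * p.
Proof. by rewrite wC_mul. Qed.

End WeylBasics.

Section Evaluation.
Variables (R : comNzRingType) (B : nzRingType) (h : {rmorphism {poly R} -> B}) (V : B).
Hypothesis Vh : forall c, V * h c = h c * V + h c^`().

(** The target is given by a morphism h on polynomials in u and an image V of v,
    and not by an R-algebra, so that the same construction serves for evaluation
    in an algebra, for change of base ring and, with the converse ring as target,
    for the adjoint. *)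
Definition wev (p : wey R) : B := \sum_(j < size (p : {poly {poly R}})) h p`_j * V ^+ j.

Lemma wevE n (p : wey R) : (size (p : {poly {poly R}}) <= n)%N ->
  wev p = \sum_(j < n) h p`_j * V ^+ j.
Proof.
move=> le_pn; rewrite /wev (big_ord_widen n (fun j => h p`_j * V ^+ j) le_pn).
rewrite big_mkcond; apply: eq_bigr => j _.
by case: ltnP => // le_pj; rewrite nth_default // raddf0 mul0r.
Qed.

Lemma wev_is_zmod_morphism : zmod_morphism wev.
Proof.
move=> p q; set n := maxn (size (p : {poly {poly R}})) (size (q : {poly {poly R}})).
have lep : (size (p : {poly {poly R}}) <= n)%N by apply: leq_maxl.
have leq : (size (q : {poly {poly R}}) <= n)%N by apply: leq_maxr.
rewrite (wevE lep) (wevE leq) (@wevE n); last first.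
  by rewrite (leq_trans (size_polyD _ _)) // size_polyN.
rewrite -sumrB; apply: eq_bigr => j _.
by rewrite [X in h X](@coefB {poly R}) raddfB /= mulrBl.
Qed.
HB.instance Definition _ := GRing.isZmodMorphism.Build (wey R) B wev wev_is_zmod_morphism.

Lemma wevC c : wev (wC c) = h c.
Proof.
rewrite (@wevE 1) ?size_polyC ?leq_b1 // big_ord1 expr0 mulr1.
by rewrite [(wC c)`_0]coefC.
Qed.

Lemma wevCXn c n : wev (wC c * wV ^+ n) = h c * V ^+ n.
Proof.
rewrite wVXn wC_mul (@wevE n.+1); last first.
  by rewrite (leq_trans (size_scale_leq _ _)) // size_polyXn.
rewrite big_ord_recr /= coefZ coefXn eqxx mulr1 big1 ?add0r // => j _.
by rewrite coefZ coefXn ltn_eqF // mulr0 raddf0 mul0r.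
Qed.

Lemma wevVn n : wev (wV ^+ n) = V ^+ n.
Proof. by rewrite -[wV ^+ n]mul1r -(rmorph1 (@wC R)) wevCXn rmorph1 mul1r. Qed.

Lemma wevV : wev wV = V.
Proof. exact: (wevVn 1). Qed.

Lemma wevC_mul c p : wev (wC c * p) = h c * wev p.
Proof.
rewrite [p in LHS]weyE mulr_sumr raddf_sum /wev mulr_sumr; apply: eq_bigr => j _ /=.
by rewrite mulrA -rmorphM wevCXn rmorphM mulrA.
Qed.

Lemma wevV_mul p : wev (wV * p) = V * wev p.
Proof.
rewrite [p in LHS]weyE mulr_sumr raddf_sum /wev mulr_sumr; apply: eq_bigr => j _ /=.
rewrite mulrA wVC mulrDl raddfD /= -mulrA -exprS !wevCXn.
by rewrite mulrA Vh mulrDl -mulrA -exprS.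
Qed.

Lemma wev_is_monoid_morphism : monoid_morphism wev.
Proof.
split=> [|p q]; first by rewrite -(rmorph1 (@wC R)) wevC rmorph1.
rewrite [p in LHS]weyE mulr_suml raddf_sum {2}/wev mulr_suml; apply: eq_bigr => j _ /=.
rewrite -mulrA wevC_mul -mulrA; congr (_ * _).
by elim: (j : nat) => [|n IHn]; rewrite ?expr0 ?mul1r // !exprS -!mulrA wevV_mul IHn.
Qed.
HB.instance Definition _ := GRing.isMonoidMorphism.Build (wey R) B wev wev_is_monoid_morphism.

End Evaluation.

Section Map.
Variables (R R' : comNzRingType) (phi : {rmorphism R -> R'}).

Definition wmap (p : wey R) : wey R' := wev (wC (R:=R') \o map_poly phi) wV p.

Lemma wmap_rel c : wV * ((wC (R:=R') \o map_poly phi) c) =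
  (wC (R:=R') \o map_poly phi) c * wV + (wC (R:=R') \o map_poly phi) c^`().
Proof. by rewrite /= wVC deriv_map. Qed.
HB.instance Definition _ := GRing.isZmodMorphism.Build (wey R) (wey R') wmap
  (@wev_is_zmod_morphism _ _ _ _).
HB.instance Definition _ := GRing.isMonoidMorphism.Build (wey R) (wey R') wmap
  (wev_is_monoid_morphism wmap_rel).

Lemma wmapC c : wmap (wC c) = wC (map_poly phi c).
Proof. exact: wevC. Qed.
Lemma wmapV : wmap wV = wV.
Proof. exact: wevV. Qed.
Lemma wmapU : wmap wU = wU.
Proof. by rewrite wmapC map_polyX. Qed.

Lemma wmapE p : wmap p = map_poly (map_poly phi) (p : {poly {poly R}}).
Proof.
rewrite [p in RHS]weyE raddf_sum; apply: eq_bigr => j _.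
rewrite /= wVXn !wC_mul wVXn; apply/polyP => i.
by rewrite coefZ coef_map /= coefZ !coefXn; case: eqP => _; rewrite ?mulr1 ?mulr0 // raddf0.
Qed.

Lemma wmap_sum I (r : seq I) (P : pred I) (F : I -> wey R) :
  wmap (\sum_(i <- r | P i) F i) = \sum_(i <- r | P i) wmap (F i).
Proof. exact: raddf_sum. Qed.

Lemma coef_wmap p i j : wcoef (wmap p) i j = phi (wcoef p i j).
Proof. by rewrite /wcoef wmapE !coef_map. Qed.

Lemma wmapZ a p : wmap (a *: p) = phi a *: wmap p.
Proof. by rewrite !wscaleE rmorphM /= wmapC map_polyC. Qed.
End Map.

Section Adjoint.
Variable R : comNzRingType.

Lemma wCc_is_zmod_morphism : zmod_morphism (@wC R : {poly R} -> (wey R)^c).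
Proof. exact: wC_is_zmod_morphism. Qed.
Lemma wCc_is_monoid_morphism : monoid_morphism (@wC R : {poly R} -> (wey R)^c).
Proof. by split=> // c d; rewrite mulrC; apply: (rmorphM (@wC R) d c). Qed.

Definition wCc : {poly R} -> (wey R)^c := @wC R.
HB.instance Definition _ := GRing.isZmodMorphism.Build {poly R} (wey R)^c wCc
  wCc_is_zmod_morphism.
HB.instance Definition _ := GRing.isMonoidMorphism.Build {poly R} (wey R)^c wCc
  wCc_is_monoid_morphism.

(** The anti-automorphism that fixes u and negates v. *)
Definition adj (p : wey R) : wey R := wev wCc (- wV : wey R) p.

Lemma adj_rel c : ((- wV : wey R) : (wey R)^c) * wCc c
   = wCc c * ((- wV : wey R) : (wey R)^c) + wCc c^`().
Proof.
rewrite -[_ * wCc c]/(wC c * - wV : wey R) -[wCc c * _]/(- wV * wC c : wey R).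
by rewrite mulNr wVC opprD addrNK mulrN.
Qed.

HB.instance Definition _ := GRing.isZmodMorphism.Build (wey R) (wey R) adj
  (wev_is_zmod_morphism wCc (- wV : wey R)).

Lemma adjM p q : adj (p * q) = adj q * adj p.
Proof. by case: (wev_is_monoid_morphism adj_rel) => _ hM; apply: hM. Qed.
Lemma adj1 : adj 1 = 1.
Proof. by case: (wev_is_monoid_morphism adj_rel). Qed.
Lemma adjC c : adj (wC c) = wC c.
Proof. exact: (wevC wCc (- wV : wey R) c). Qed.
Lemma adjV : adj wV = - wV.
Proof. exact: (wevV wCc (- wV : wey R)). Qed.
Lemma adjX p n : adj (p ^+ n) = adj p ^+ n.
Proof. by elim: n => [|n IHn]; rewrite ?adj1 // exprS adjM IHn exprSr. Qed.
Lemma adjZ a p : adj (a *: p) = a *: adj p.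
Proof.
have aE : a *: 1 = wC a%:P :> wey R by rewrite wscaleE mulr1.
by rewrite wscaleE adjM adjC -aE -scalerAr mulr1.
Qed.
Lemma adj_sum I (r : seq I) (P : pred I) (F : I -> wey R) :
  adj (\sum_(i <- r | P i) F i) = \sum_(i <- r | P i) adj (F i).
Proof. exact: raddf_sum. Qed.
End Adjoint.

Lemma wmap_adj (R R' : comNzRingType) (phi : {rmorphism R -> R'}) (p : wey R) :
  wmap phi (adj p) = adj (wmap phi p).
Proof.
elim/wey_ind: p => [p q IHp IHq|c n]; first by rewrite !raddfD /= IHp IHq.
by rewrite !(adjM, adjC, adjX, adjV) !rmorphM !rmorphXn /= raddfN /=
  !wmapV !wmapC !(adjM, adjC, adjX, adjV).
Qed.

(** * Commutators, coefficients and degrees *)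

Section Lie.
Variable B : nzRingType.
Implicit Types x y z : B.
Definition lie x y := x * y - y * x.

Lemma lieMr x y z : lie x (y * z) = lie x y * z + y * lie x z.
Proof. by rewrite /lie mulrBl mulrBr !mulrA addrA subrK. Qed.
Lemma lieMl x y z : lie (x * y) z = x * lie y z + lie x z * y.
Proof. by rewrite /lie mulrBl mulrBr !mulrA addrA subrK. Qed.
Lemma lieDr x y z : lie x (y + z) = lie x y + lie x z.
Proof. by rewrite /lie mulrDl mulrDr opprD addrACA. Qed.
Lemma lieDl x y z : lie (x + y) z = lie x z + lie y z.
Proof. by rewrite /lie mulrDl mulrDr opprD addrACA. Qed.
Lemma lieN x y : lie y x = - lie x y.
Proof. by rewrite /lie opprB. Qed.
Lemma liexx x : lie x x = 0. Proof. exact: subrr. Qed.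
Lemma lie0r x : lie x 0 = 0. Proof. by rewrite /lie mulr0 mul0r subrr. Qed.
Lemma lie0l x : lie 0 x = 0. Proof. by rewrite /lie mulr0 mul0r subrr. Qed.
Lemma lieNr x y : lie x (- y) = - lie x y.
Proof. by rewrite /lie mulNr mulrN opprK opprB addrC. Qed.
Lemma lieNl x y : lie (- x) y = - lie x y.
Proof. by rewrite /lie mulNr mulrN opprK opprB addrC. Qed.
Lemma lieBr x y z : lie x (y - z) = lie x y - lie x z.
Proof. by rewrite lieDr lieNr. Qed.
Lemma lieBl x y z : lie (x - y) z = lie x z - lie y z.
Proof. by rewrite lieDl lieNl. Qed.
Lemma lie_sumr I (r : seq I) (P : pred I) (F : I -> B) x :
  lie x (\sum_(i <- r | P i) F i) = \sum_(i <- r | P i) lie x (F i).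
Proof. by rewrite /lie mulr_sumr mulr_suml -sumrB. Qed.
Lemma lie_suml I (r : seq I) (P : pred I) (F : I -> B) x :
  lie (\sum_(i <- r | P i) F i) x = \sum_(i <- r | P i) lie (F i) x.
Proof. by rewrite /lie mulr_sumr mulr_suml -sumrB. Qed.
Lemma lie_eq0 x y : lie x y = 0 <-> x * y = y * x.
Proof. by split=> [/subr0_eq //|h]; rewrite /lie h subrr. Qed.
Lemma lieX0 x y n : lie x y = 0 -> lie x (y ^+ n) = 0.
Proof. by move=> /lie_eq0 h; apply/lie_eq0; apply: commrX. Qed.

(** As c commutes with y, the derivation [lie x] acts on powers of y as c times
    the derivative. *)
Lemma lieXr x y c n : lie x y = c -> lie c y = 0 -> lie x (y ^+ n) = c * y ^+ n.-1 *+ n.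
Proof.
move=> hc /lie_eq0 hy; elim: n => [|n IHn]; first by rewrite expr0 /lie mulr1 mul1r subrr.
rewrite exprS lieMr hc IHn mulrS; congr (_ + _).
case: n {IHn} => [|n] /=; first by rewrite !mulr0n mulr0.
by rewrite mulrnAr mulrA -hy -mulrA -exprS.
Qed.
End Lie.

Section LieAlg.
Variables (R : comNzRingType) (B : algType R).
Implicit Types (x y z : B) (a : R).
Lemma lieZr a x y : lie x (a *: y) = a *: lie x y.
Proof. by rewrite /lie -scalerAl -scalerAr scalerBr. Qed.
Lemma lieZl a x y : lie (a *: x) y = a *: lie x y.
Proof. by rewrite /lie -scalerAl -scalerAr scalerBr. Qed.
End LieAlg.

Section Coefficients.
Variable R : comNzRingType.
Implicit Types (p q x y z : wey R) (c d : {poly R}) (a : R).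
Local Notation bip := (@wsym R).

Lemma wcoefP x y : (forall i j, wcoef x i j = wcoef y i j) -> x = y.
Proof. by move=> h; apply/polyP=> j; apply/polyP=> i; apply: h. Qed.
Lemma wcoefD x y i j : wcoef (x + y) i j = wcoef x i j + wcoef y i j.
Proof. by rewrite /wcoef -!coefD. Qed.
Lemma wcoefN x i j : wcoef (- x) i j = - wcoef x i j.
Proof. by rewrite /wcoef -!coefN. Qed.
Lemma wcoef0 i j : wcoef (0 : wey R) i j = 0.
Proof. by rewrite /wcoef !coef0. Qed.
Lemma wcoefB x y i j : wcoef (x - y) i j = wcoef x i j - wcoef y i j.
Proof. by rewrite wcoefD wcoefN. Qed.
Lemma wcoefZ a x i j : wcoef (a *: x) i j = a * wcoef x i j.
Proof. by rewrite /wcoef coefZ coefCM. Qed.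
Lemma wcoef_sum I (r : seq I) (P : pred I) (F : I -> wey R) i j :
  wcoef (\sum_(k <- r | P k) F k) i j = \sum_(k <- r | P k) wcoef (F k) i j.
Proof. by elim/big_rec2: _ => [|k u v _ <-]; rewrite ?wcoef0 ?wcoefD. Qed.
Lemma wcoefMn x n i j : wcoef (x *+ n) i j = wcoef x i j *+ n.
Proof. by elim: n => [|n IHn]; rewrite ?wcoef0 // !mulrS wcoefD IHn. Qed.

Lemma wUXn n : (wU : wey R) ^+ n = wC 'X^n.
Proof. by rewrite rmorphXn. Qed.

Lemma wcoefCVn c n i j : wcoef (wC c * wV ^+ n) i j = c`_i *+ (j == n).
Proof.
rewrite /wcoef wC_mul wVXn coefZ coefXn.
by case: eqP => _; rewrite ?mulr1 // mulr0 coef0.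
Qed.

Lemma wcoefUV m n i j : wcoef (wU ^+ m * wV ^+ n : wey R) i j = ((i == m) && (j == n))%:R.
Proof. by rewrite wUXn wcoefCVn coefXn; case: eqP; case: eqP. Qed.

Lemma wcoef1 i j : wcoef (1 : wey R) i j = ((i == 0) && (j == 0))%:R.
Proof. by rewrite -(wcoefUV 0 0) !expr0 mulr1. Qed.

Lemma wey_gen_ind (P : wey R -> Prop) :
  (forall x y, P x -> P y -> P (x + y)) -> (forall x y, P x -> P y -> P (x * y)) ->
  (forall a, P a%:A) -> P wU -> P wV -> forall x, P x.
Proof.
move=> PD PM PC PU PV.
have PX x n : P x -> P (x ^+ n).
  move=> Px; elim: n => [|n IHn]; last by rewrite exprS; apply: PM.
  by rewrite expr0 -[1]scale1r; apply: PC.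
elim/wey_ind => // c n; apply: (PM); last exact: PX.
elim/poly_ind: c => [|c a IHc]; first by rewrite raddf0 -(scale0r 1); apply: PC.
rewrite rmorphD rmorphM /= -/wU; apply: PD; first exact: PM.
by have := PC a; rewrite wscaleE mulr1.
Qed.

(** Commutators with u and v act on symbols as partial derivatives. *)
Lemma lieV x : lie wV x = duX x.
Proof.
elim/wey_ind: x => [x y hx hy|c n].
  by rewrite lieDr hx hy -[RHS]/(duX (bip x + bip y)) raddfD.
rewrite lieMr [lie wV (_ ^+ _)]lieX0 ?liexx // mulr0 addr0 {1}/lie wVC addrAC subrr add0r.
by rewrite !wC_mul wVXn duXZ duX_Xn scaler0 addr0.
Qed.

Lemma wcoef_lieV x i j : wcoef (lie wV x) i j = wcoef x i.+1 j *+ i.+1.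
Proof. by rewrite lieV /wcoef coef_duX coef_deriv. Qed.

Lemma lieU x : lie x wU = (bip x)^`().
Proof.
elim/wey_ind: x => [x y hx hy|c n].
  by rewrite lieDl hx hy -[RHS]/((bip x + bip y)^`()) derivD.
rewrite lieMl [lie (wC c) wU]/lie -!rmorphM mulrC subrr mul0r addr0.
rewrite -[lie _ wU]opprK -lieN (@lieXr _ _ _ (-1)); last 2 first.
- by rewrite lieN [lie _ _]wVU.
- by rewrite lieNl /lie mulr1 mul1r subrr oppr0.
rewrite mulN1r mulNrn opprK -mulr_natr mulrA mulr_natr !wC_mul !wVXn derivZ derivXn.
by rewrite -scalerMnr.
Qed.

Lemma wcoef_lieU x i j : wcoef (lie x wU) i j = wcoef x i j.+1 *+ j.+1.
Proof. by rewrite lieU /wcoef coef_deriv coefMn. Qed.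

Definition wbound m n x := (forall j, (size ((bip x)`_j)%R <= m.+1)%N) /\ (size (bip x) <= n.+1)%N.

Lemma wboundP m n x :
  wbound m n x <-> forall i j, wcoef x i j != 0 -> (i <= m)%N && (j <= n)%N.
Proof.
split=> [[hm hn] i j|h].
  apply: contraR; rewrite negb_and -!ltnNge => /orP[lt_mi|lt_nj]; rewrite /wcoef.
    by rewrite [X in X == _]nth_default // (leq_trans (hm j)).
  by rewrite [(bip x)`_j]nth_default ?coef0 // (leq_trans hn).
split=> [j|]; first apply/leq_sizeP=> i lt_mi.
  by apply/eqP/negPn/negP=> /(h i j); rewrite leqNgt lt_mi.
apply/leq_sizeP=> j lt_nj; apply/polyP=> i; rewrite coef0.
by apply/eqP/negPn/negP=> /(h i j); rewrite [(j <= n)%N]leqNgt lt_nj andbF.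
Qed.

Lemma wbound_exists x : exists n, wbound n n x.
Proof.
exists (maxn (size (bip x)) (\max_(j < size (bip x)) size ((bip x)`_j)%R)).
split=> [j|]; last by rewrite leqW // leq_maxl.
apply: leqW; have [lt_j|le_j] := ltnP j (size (bip x)).
  by rewrite leq_max (leq_bigmax (Ordinal lt_j)) orbT.
by rewrite nth_default // size_poly0.
Qed.

Lemma wboundS m n m' n' x : (m <= m')%N -> (n <= n')%N -> wbound m n x -> wbound m' n' x.
Proof.
move=> le_m le_n [hm hn]; split=> [j|]; first exact: leq_trans (hm j) _.
exact: leq_trans hn _.
Qed.

Lemma wboundD m n x y : wbound m n x -> wbound m n y -> wbound m n (x + y).
Proof.
move=> [hm hn] [hm' hn']; split=> [j|].
  rewrite [(bip (x + y))`_j]coefD (leq_trans (size_polyD _ _)) // geq_max.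
  by rewrite hm hm'.
by rewrite (leq_trans (size_polyD _ _)) // geq_max hn hn'.
Qed.

Lemma wbound0 m n : wbound m n 0.
Proof. by split=> [j|]; rewrite ?coef0 size_poly0. Qed.

Lemma wbound_sum m n I (r : seq I) (P : pred I) (F : I -> wey R) :
  (forall i, P i -> wbound m n (F i)) -> wbound m n (\sum_(i <- r | P i) F i).
Proof.
by move=> h; apply: (big_ind (wbound m n)) => //; [apply: wbound0|apply: wboundD].
Qed.

Lemma wbound_V m n x : wbound m n x -> wbound m n.+1 (wV * x).
Proof.
move=> [hm hn]; rewrite wV_mul /vop; apply: wboundD; split=> [j|].
- by rewrite [(_ : {poly _})`_j]coefMX; case: eqP; rewrite ?size_poly0.
- by rewrite (leq_trans (size_polyMleq _ _)) // size_polyX addn2.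
- by rewrite [(_ : {poly _})`_j]coef_duX (leq_trans (size_poly _ _)) // (leq_trans (leq_pred _)).
- by rewrite (leq_trans (size_poly _ _)) // ltnW.
Qed.

(** The product of symbols and its correction terms all have degrees at most the
    sums of the degrees, separately in u and in v. *)
Lemma wboundM m n m' n' x y :
  wbound m n x -> wbound m' n' y -> wbound (m + m') (n + n') (x * y).
Proof.
move=> [hm hn] hy; rewrite [x]weyE mulr_suml; apply: wbound_sum => j _.
have hj : (j <= n)%N by rewrite -ltnS (leq_trans _ hn).
rewrite -mulrA; have {hy} hy : wbound m' (n + n') (wV ^+ j * y).
  suff : wbound m' (j + n') (wV ^+ j * y) by apply: wboundS; rewrite ?leq_add2r.
  elim: (j : nat) => [|k IHk]; first by rewrite mul1r.
  by rewrite exprS -mulrA addSn; apply: wbound_V.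
move: hy (hm j); move: (wV ^+ j * y) ((bip x)`_j) => z c [hzm hzn] hc.
rewrite wC_mul; split=> [i|]; last exact: leq_trans (size_scale_leq _ _) hzn.
rewrite [(_ : {poly _})`_i]coefZ (leq_trans (size_polyMleq _ _)) //.
by move: (hzm i) hc; rewrite /wsym; lia.
Qed.

Lemma wboundX m n x k : wbound m n x -> wbound (k * m) (k * n) (x ^+ k).
Proof.
move=> hx; elim: k => [|k IHk]; last by rewrite exprS !mulSn; apply: wboundM.
by apply/wboundP=> i j; rewrite expr0 wcoef1; case: i j => [|i] [|j]; rewrite ?eqxx.
Qed.

(** Commuting v^m past a polynomial in u only creates terms of lower degree in v,
    so leading coefficients in v multiply as in the commutative ring. *)
Lemma coefM_top x y m n : (size (bip x) <= m.+1)%N -> (size (bip y) <= n.+1)%N ->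
  (bip (x * y))`_(m + n) = (bip x)`_m * (bip y)`_n /\ (size (bip (x * y)%R) <= (m + n).+1)%N.
Proof.
move=> hx hy.
have itV k : (bip (wV ^+ k * y))`_(k + n) = (bip y)`_n /\
    (size (bip (wV ^+ k * y)%R) <= (k + n).+1)%N.
  elim: k => [|k [IHc IHs]]; first by rewrite mul1r.
  rewrite exprS -mulrA wV_mul addSn; split.
    rewrite coefD coefMX /= IHc coef_duX [X in _ + X^`()]nth_default ?deriv0 ?addr0 //.
  rewrite (leq_trans (size_polyD _ _)) // geq_max (leq_trans (size_polyMleq _ _)) /=.
    by rewrite (leq_trans (size_poly _ _)) // ltnW.
  by rewrite size_polyX addn2.
have itC j : (j <= m)%N -> (bip (wC (bip x)`_j * wV ^+ j * y))`_(m + n) =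
    ((bip x)`_m * (bip y)`_n) *+ (j == m) /\
    (size (bip (wC (bip x)`_j * wV ^+ j * y)%R) <= (m + n).+1)%N.
  move=> le_jm; have [hc hs] := itV j.
  rewrite -mulrA wC_mul coefZ; split.
    case: eqP => [-> | /eqP ne_jm]; first by rewrite (itV m).1.
    rewrite [X in _ * X]nth_default ?mulr0 //; apply: (leq_trans hs).
    by rewrite ltn_add2r ltn_neqAle ne_jm.
  apply: (leq_trans (size_scale_leq _ _)); apply: (leq_trans hs).
  by rewrite ltnS leq_add2r.
rewrite [x in x * y]weyE mulr_suml; split.
  rewrite coef_sum; have -> : (bip x)`_m * (bip y)`_n =
      \sum_(j < m.+1) ((bip x)`_m * (bip y)`_n) *+ (j == m :> nat).
    by rewrite big_ord_recr /= eqxx big1 ?add0r // => j _; rewrite ltn_eqF.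
  rewrite (big_ord_widen _ (fun j => (bip (wC (bip x)`_j * wV ^+ j * y))`_(m + n)) hx).
  rewrite big_mkcond; apply: eq_bigr => j _.
  have [hc _] := itC j (ltn_ord j); case: ltnP => [//|le_j]; rewrite -hc.
  by rewrite [(bip x)`_j]nth_default // raddf0 !mul0r coef0.
apply/leq_sizeP=> k lt_k; rewrite coef_sum big1 // => j _.
apply: (leq_sizeP _ _ (itC j _).2 k lt_k).
by rewrite -ltnS (leq_trans _ hx).
Qed.

End Coefficients.

Section Domain.
Variable R : idomainType.
Implicit Types (x y z : wey R).
Local Notation bip := (@wsym R).

Lemma wey_mulf_eq0 x y : x * y = 0 -> x = 0 \/ y = 0.
Proof.
move=> xy0; have [->|nx] := eqVneq x 0; first by left.
have [->|ny] := eqVneq y 0; first by right.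
have sx : (0 < size (bip x))%N by rewrite size_poly_gt0.
have sy : (0 < size (bip y))%N by rewrite size_poly_gt0.
have [] := @coefM_top _ x y (size (bip x)).-1 (size (bip y)).-1.
- by rewrite prednK.
- by rewrite prednK.
move/eqP; rewrite xy0 coef0 eq_sym mulf_eq0 -!/(lead_coef _) !lead_coef_eq0.
by rewrite (negPf nx) (negPf ny).
Qed.

Lemma size_weyX x n : x != 0 ->
  size (bip (x ^+ n)) = ((size (bip x)).-1 * n).+1 /\
  lead_coef (bip (x ^+ n)) = lead_coef (bip x) ^+ n.
Proof.
move=> nx; have sx : (0 < size (bip x))%N by rewrite size_poly_gt0.
set m := (size (bip x)).-1.
have [hc hs] : (bip (x ^+ n))`_(m * n) = lead_coef (bip x) ^+ n /\
    (size (bip (x ^+ n)%R) <= (m * n).+1)%N.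
  elim: n => [|n [IHc IHs]]; first by rewrite muln0 expr0 coef1 size_poly1.
  have sxm : (size (bip x) <= m.+1)%N by rewrite prednK.
  have [hc hs] := @coefM_top _ x (x ^+ n) m (m * n) sxm IHs.
  by rewrite !exprS mulnS hc IHc.
have hsz : size (bip (x ^+ n)) = (m * n).+1.
  apply/eqP; rewrite eqn_leq hs ltnNge; apply/negP=> /leq_sizeP/(_ _ (leqnn _)).
  by move/eqP; rewrite hc expf_eq0 lead_coef_eq0 (negPf nx) andbF.
by split=> //; rewrite -hc lead_coefE hsz.
Qed.
End Domain.

(** * Commutators modulo the square of a prime *)

Section Congruence.
Variable B : nzRingType.
Implicit Types (x y z t : B) (q : nat).

(** The modulus is a natural number because only the moduli p and p * p are
    used. *)
Definition eqm q x y := exists z, x = y + z *+ q.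

Lemma eqm_refl q x : eqm q x x. Proof. by exists 0; rewrite mul0rn addr0. Qed.
Lemma eqm_trans q y x z : eqm q x y -> eqm q y z -> eqm q x z.
Proof. by move=> [a ->] [b ->]; exists (b + a); rewrite mulrnDl addrA. Qed.
Lemma eqm_sym q x y : eqm q x y -> eqm q y x.
Proof. by move=> [a ->]; exists (- a); rewrite mulNrn addrK. Qed.
Lemma eqmD q x y z t : eqm q x y -> eqm q z t -> eqm q (x + z) (y + t).
Proof. by move=> [a ->] [b ->]; exists (a + b); rewrite mulrnDl addrACA. Qed.
Lemma eqmN q x y : eqm q x y -> eqm q (- x) (- y).
Proof. by move=> [a ->]; exists (- a); rewrite mulNrn opprD. Qed.
Lemma eqmMl q x y z : eqm q x y -> eqm q (z * x) (z * y).
Proof. by move=> [a ->]; exists (z * a); rewrite mulrDr mulrnAr. Qed.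
Lemma eqmMr q x y z : eqm q x y -> eqm q (x * z) (y * z).
Proof. by move=> [a ->]; exists (a * z); rewrite mulrDl mulrnAl. Qed.
Lemma eqmMn q x y n : eqm q x y -> eqm q (x *+ n) (y *+ n).
Proof. by move=> [a ->]; exists (a *+ n); rewrite mulrnDl -!mulrnA mulnC. Qed.
Lemma eqmMnM q r x y : eqm q x y -> eqm (q * r) (x *+ r) (y *+ r).
Proof. by move=> [a ->]; exists a; rewrite mulrnDl -mulrnA. Qed.
Lemma eqm_dvd q r x y : (r %| q)%N -> eqm q x y -> eqm r x y.
Proof. by move=> /dvdnP[d ->] [a ->]; exists (a *+ d); rewrite -mulrnA. Qed.
Lemma eqm0Mn q x n : (q %| n)%N -> eqm q (x *+ n) 0.
Proof. by move=> /dvdnP[d ->]; exists (x *+ d); rewrite add0r -mulrnA. Qed.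
Lemma eqm0D q x y : eqm q x 0 -> eqm q y 0 -> eqm q (x + y) 0.
Proof. by move=> hx /(eqmD hx); rewrite addr0. Qed.
Lemma eqm0Ml q x z : eqm q x 0 -> eqm q (z * x) 0.
Proof. by move/(eqmMl z); rewrite mulr0. Qed.
Lemma eqm0Mr q x z : eqm q x 0 -> eqm q (x * z) 0.
Proof. by move/(eqmMr z); rewrite mul0r. Qed.
Lemma eqm0N q x : eqm q x 0 -> eqm q (- x) 0.
Proof. by move/eqmN; rewrite oppr0. Qed.
Lemma eqm_sum q I (r : seq I) (P : pred I) (F G : I -> B) :
  (forall i, P i -> eqm q (F i) (G i)) ->
  eqm q (\sum_(i <- r | P i) F i) (\sum_(i <- r | P i) G i).
Proof. by move=> h; apply: (big_ind2 (eqm q)) => //; [apply: eqm_refl|apply: eqmD]. Qed.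
Lemma eqm0_sum q I (r : seq I) (P : pred I) (F : I -> B) :
  (forall i, P i -> eqm q (F i) 0) -> eqm q (\sum_(i <- r | P i) F i) 0.
Proof. by move=> h; apply: (big_ind (eqm q ^~ 0)) => //; [apply: eqm_refl|apply: eqm0D]. Qed.
End Congruence.

Section Lattice.
Variable R : comNzRingType.
Implicit Types (x y z : wey R) (n p : nat).

Lemma wVU_lie : lie wV wU = 1 :> wey R. Proof. exact: wVU. Qed.

Lemma lie1l x : lie 1 x = 0. Proof. by rewrite /lie mulr1 mul1r subrr. Qed.
Lemma lie1r x : lie x 1 = 0. Proof. by rewrite /lie mulr1 mul1r subrr. Qed.

(** The derivation [lie x] sends u^n to n times an element for each generator x,
    and the property is stable under sums and products.  In particular u^p and
    v^p are central modulo p. *)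
Lemma lie_wUXn x n : eqm n (lie x (wU ^+ n)) 0.
Proof.
elim/wey_gen_ind: x => [x y hx hy|x y hx hy|a||].
- by rewrite lieDl; apply: eqm0D.
- by rewrite lieMl; apply: eqm0D; [apply: eqm0Ml|apply: eqm0Mr].
- by rewrite lieZl lie1l scaler0; apply: eqm_refl.
- by rewrite lieX0 ?liexx //; apply: eqm_refl.
- by rewrite (@lieXr _ _ _ 1) ?lie1l ?wVU_lie //; apply: eqm0Mn.
Qed.

Lemma lie_wVXn x n : eqm n (lie x (wV ^+ n)) 0.
Proof.
elim/wey_gen_ind: x => [x y hx hy|x y hx hy|a||].
- by rewrite lieDl; apply: eqm0D.
- by rewrite lieMl; apply: eqm0D; [apply: eqm0Ml|apply: eqm0Mr].
- by rewrite lieZl lie1l scaler0; apply: eqm_refl.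
- by rewrite (@lieXr _ _ _ (-1)) ?lieNl ?lie1l ?oppr0 ?[lie wU _]lieN ?wVU_lie //; apply: eqm0Mn.
- by rewrite lieX0 ?liexx //; apply: eqm_refl.
Qed.

(** The Leibniz rule for powers of v, read as a derivation. *)
Lemma wVXn_wC n (c : {poly R}) :
  wV ^+ n * wC c = \sum_(k < n.+1) wC c^`(k) * wV ^+ (n - k) *+ 'C(n, k).
Proof.
elim: n c => [|n IHn] c; first by rewrite big_ord1 expr0 mulr1 mul1r.
rewrite exprSr -mulrA wVC mulrDr mulrA !IHn mulr_suml.
rewrite big_ord_recl big_ord_recr [RHS]big_ord_recl [in RHS]big_ord_recr /=.
rewrite !subn0 !subnn !bin0 !binn -mulrA -exprSr !mulr1n -!derivSn -!addrA; congr (_ + _).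
rewrite addrA -big_split /=; congr (_ + _); apply: eq_bigr => k _.
rewrite /bump /= !add1n binS mulrnDr -derivSn !subSS; congr (_ + _).
by rewrite mulrnAl -mulrA -exprSr subnSK.
Qed.

(** In the Leibniz expansion of v^p u^p, the k-th term carries the factor
    'C(p, k) p (p - 1) ... (p - k + 1), whose two parts are divisible by p when
    0 < k < p; the last term is p!. *)
Lemma lie_vp_up p : prime p -> eqm (p * p) (lie (wV ^+ p) (wU ^+ p : wey R)) (1 *+ p`!).
Proof.
case: p => // p p_pr; rewrite /lie [X in _ * X]wUXn wVXn_wC.
rewrite big_ord_recl derivn0 -wUXn subn0 bin0 mulr1n addrAC subrr add0r.
rewrite big_ord_recr lift0 binn subnn mulr1n mulr1 derivnXn ffactnn subnn expr0.
rewrite raddfMn /= rmorph1 -[X in eqm _ _ X]add0r; apply: eqmD; last exact: eqm_refl.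
apply: eqm0_sum => k _.
rewrite add0n -derivnS /bump leq0n add1n derivnXn raddfMn /= mulrnAl -mulrnA; apply: eqm0Mn.
by rewrite dvdn_mul ?prime_dvd_bin ?ltnS ?ltn_ord // ffactnS dvdn_mulr.
Qed.

Variable p : nat.
Hypothesis p_pr : prime p.
Local Notation U := (wU ^+ p : wey R).
Local Notation V := (wV ^+ p : wey R).

Lemma p_dvd_fact : (p %| p`!)%N. Proof. by rewrite dvdn_fact // prime_gt0 //=. Qed.

(** Since p divides p!, a congruence modulo p that is multiplied by p! holds
    modulo p * p. *)
Lemma eqm_p2 x y : eqm p x y -> eqm (p * p) (x *+ p`!) (y *+ p`!).
Proof.
have /dvdnP[d ->] := p_dvd_fact; rewrite mulnC !mulrnA => h.
by apply: eqmMn; apply: eqmMnM.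
Qed.

Lemma lie_vp_upX n : eqm (p * p) (lie V (U ^+ n)) (U ^+ n.-1 *+ n *+ p`!).
Proof.
elim: n => [|n IHn]; first by rewrite lie1r mulr0n mul0rn; apply: eqm_refl.
rewrite exprS lieMr mulrS mulrnDl; apply: eqmD.
  by rewrite -[X in eqm _ _ (X *+ _)]mul1r -mulrnAl; apply: eqmMr; apply: lie_vp_up.
have := eqmMl U IHn; case: n {IHn} => [|n] /=; first by rewrite !mul0rn mulr0.
by rewrite !mulrnAr -exprS.
Qed.

Lemma lie_vpX_upX m n :
  eqm (p * p) (lie (V ^+ m) (U ^+ n)) (U ^+ n.-1 * V ^+ m.-1 *+ (m * n) *+ p`!).
Proof.
elim: m => [|m IHm]; first by rewrite lie1l mul0n mulr0n mul0rn; apply: eqm_refl.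
rewrite exprS lieMl mulSn addnC mulrnDr mulrnDl; apply: eqmD; last first.
  by rewrite -!mulrnAl; apply: eqmMr; apply: lie_vp_upX.
apply: (eqm_trans (eqmMl _ IHm)); rewrite !mulrnAr; apply: eqm_p2.
case: m {IHm} => [|m] /=; first by rewrite mul0n !mulr0n ?mul0rn; apply: eqm_refl.
apply: eqmMn; rewrite mulrA exprS mulrA; apply: eqmMr.
rewrite -[V * _](subrK (U ^+ n.-1 * V)) -[X in eqm _ _ X]add0r.
apply: eqmD; last exact: eqm_refl.
by rewrite -/(lie _ _) lieN; apply: eqm0N; apply: lie_wVXn.
Qed.

(** Up to the factor p!, this is the Poisson bracket of the monomials of
    exponents (a, b) and (a', b') in u^p and v^p. *)
Lemma lie_lattice a b a' b' :
  eqm (p * p) (lie (U ^+ a * V ^+ b) (U ^+ a' * V ^+ b'))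
    ((U ^+ (a + a').-1 * V ^+ (b + b').-1 *+ (b * a')
      - U ^+ (a + a').-1 * V ^+ (b + b').-1 *+ (b' * a)) *+ p`!).
Proof.
have cc (x : wey R) m n : lie (x ^+ m) (x ^+ n) = 0.
  by rewrite lieX0 // lieN lieX0 ?liexx // oppr0.
rewrite lieMl !lieMr !cc mulr0 addr0 mul0r add0r mulrnBl; apply: eqmD.
  rewrite mulrA; have := eqmMr (V ^+ b') (eqmMl (U ^+ a) (lie_vpX_upX b a')).
  move/eqm_trans; apply; rewrite !mulrnAr !mulrnAl.
  case: b => [|b]; first by rewrite mul0n !mulr0n ?mul0rn; apply: eqm_refl.
  case: a' => [|a']; first by rewrite muln0 !mulr0n ?mul0rn; apply: eqm_refl.
  by rewrite /= mulrA -exprD -mulrA -exprD addnS; apply: eqm_refl.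
rewrite [lie (U ^+ a) _]lieN mulrN mulNr; apply: eqmN.
have := eqmMr (V ^+ b) (eqmMl (U ^+ a') (lie_vpX_upX b' a)).
move/eqm_trans; apply; rewrite !mulrnAr !mulrnAl.
case: b' => [|b']; first by rewrite mul0n !mulr0n ?mul0rn; apply: eqm_refl.
case: a => [|a]; first by rewrite muln0 !mulr0n ?mul0rn; apply: eqm_refl.
rewrite /= mulrA -exprD -mulrA -exprD addnS.
by rewrite [(a' + a)%N]addnC [(b' + b)%N]addnC; apply: eqm_refl.
Qed.

End Lattice.

(** * Centralizers in characteristic p *)

Lemma linear_dependence (k : fieldType) (I J : finType) (g : I -> J -> k) :
  (#|J| < #|I|)%N ->
  exists2 c : I -> k, (exists i, c i != 0) & forall j, \sum_i c i * g i j = 0.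
Proof.
move=> ltJI; pose M := \matrix_(i < #|I|, j < #|J|) g (enum_val i) (enum_val j).
have /rowV0Pn[v v_ker v_neq0] : kermx M != 0.
  rewrite kermx_eq0 /row_free neq_ltn (leq_ltn_trans _ ltJI) //.
  exact: rank_leq_col.
have vM : v *m M = 0 by apply/sub_kermxP.
exists (fun i => v 0 (enum_rank i)).
  have /rV0Pn[i vi] := v_neq0; exists (enum_val i); by rewrite enum_valK.
move=> j; have /rowP/(_ (enum_rank j)) := vM; rewrite !mxE => h; rewrite -[RHS]h.
rewrite (reindex (@enum_val I xpredT)) /=; last by apply: onW_bij; apply: enum_val_bij.
by apply: eq_bigr => i _; rewrite enum_valK !mxE enum_rankK.
Qed.

Section Centralizer.
Variables (k : fieldType) (p : nat).
Hypothesis pk : p \in [pchar k].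
Implicit Types (x y z : wey k).
Local Notation U := (wU ^+ p : wey k).
Local Notation V := (wV ^+ p : wey k).

Lemma pchar_prime : prime p. Proof. by case/andP: pk. Qed.

Lemma wey_pchar x : x *+ p = 0.
Proof. by rewrite -scaler_nat (pcharf0 pk) scale0r. Qed.

Lemma eqm_pchar x y : eqm p x y -> x = y.
Proof. by move=> [z ->]; rewrite wey_pchar addr0. Qed.

Lemma latticeE a b : U ^+ a * V ^+ b = wU ^+ (p * a) * wV ^+ (p * b).
Proof. by rewrite -!exprM. Qed.

Lemma lattice_central a b x : lie (U ^+ a * V ^+ b) x = 0.
Proof.
apply: eqm_pchar; rewrite lieN latticeE; apply: eqm0N; rewrite lieMr.
by apply: eqm0D; [apply: eqm0Mr; apply: eqm_dvd (lie_wUXn _ _)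
  |apply: eqm0Ml; apply: eqm_dvd (lie_wVXn _ _)]; rewrite dvdn_mulr.
Qed.

(** Applying [lie a] to a relation differentiates it with respect to b, and the
    exponents below p are invertible. *)
Lemma powers_independent (a b : wey k) (c : k) n (Y : nat -> wey k) :
  c != 0 -> lie a b = c%:A -> (n <= p)%N -> (forall i, lie a (Y i) = 0) ->
  \sum_(i < n) b ^+ i * Y i = 0 -> forall i, (i < n)%N -> Y i = 0.
Proof.
move=> c0 ab; elim: n Y => // n IHn Y le_np aY sum0.
have YS i : (i < n)%N -> Y i.+1 = 0.
  move=> lt_in; have ci : c *+ i.+1 != 0.
    rewrite -mulr_natr mulf_neq0 // -(dvdn_pcharf pk).
    by rewrite gtnNdvd // (leq_trans _ le_np).
  apply: (scalerI ci); rewrite scaler0.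
  apply: (IHn (fun i => (c *+ i.+1) *: Y i.+1)) => // [|j|].
  - exact: ltnW.
  - by rewrite lieZr aY scaler0.
  have := congr1 (lie a) sum0; rewrite lie0r lie_sumr big_ord_recl expr0 mul1r aY add0r.
  move=> h; rewrite -[RHS]h; apply: eq_bigr => j _; rewrite lift0 lieMr aY mulr0 addr0.
  rewrite (@lieXr _ _ _ c%:A) //; last by rewrite lieZl lie1l scaler0.
  by rewrite /= -scalerAl mul1r mulrnAl -scalerAl -scalerAr scalerMnl.
move=> [_|i /YS//]; move: sum0; rewrite big_ord_recl expr0 mul1r big1 ?addr0 //.
by move=> j _; rewrite lift0 YS // mulr0.
Qed.

Definition on_lattice x := forall i j, wcoef x i j != 0 -> (p %| i)%N && (p %| j)%N.

Lemma central_on_lattice x : (forall w, lie x w = 0) -> on_lattice x.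
Proof.
move=> xC i j xij; apply/andP; split.
  case: i xij => [|i] xij; first exact: dvdn0.
  have := wcoef_lieV x i j; rewrite lieN xC oppr0 wcoef0 => /esym/eqP.
  by rewrite -mulr_natr mulf_eq0 (negPf xij) -(dvdn_pcharf pk).
case: j xij => [|j] xij; first exact: dvdn0.
have := wcoef_lieU x i j; rewrite xC wcoef0 => /esym/eqP.
by rewrite -mulr_natr mulf_eq0 (negPf xij) -(dvdn_pcharf pk).
Qed.

(** If x were not central, then the products S^i A^j x^e z with i, j < p, e < 2
    and z a monomial in u^p and v^p would be linearly independent.  For z of
    degree less than T in each variable there are 2 p^2 T^2 of them, in a space of
    dimension (p T + c)^2 with c independent of T, which is smaller when T is
    large. *)
Lemma centralizer_on_lattice (S A x : wey k) :
  lie A S = 1 -> lie S x = 0 -> lie A x = 0 -> on_lattice x.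
Proof.
move=> AS Sx Ax; apply: central_on_lattice => w.
have p0 := prime_gt0 pchar_prime.
have [d [bS bA bx]] : exists d, [/\ wbound d d S, wbound d d A & wbound d d x].
  have [d1 b1] := wbound_exists S; have [d2 b2] := wbound_exists A.
  have [d3 b3] := wbound_exists x; exists (d1 + d2 + d3)%N.
  by split; [apply: wboundS b1|apply: wboundS b2|apply: wboundS b3]; lia.
(* (10 p + 1)^2 c^2 < 2 p^2 (10 c)^2 *)
pose c := ((2 * p + 1) * d).+1; pose T := (10 * c)%N; pose M := (p * T + c)%N.
pose I := ('I_p * 'I_p * (('I_T * 'I_T) * bool))%type.
pose J := ('I_M * 'I_M)%type.
pose L (t : 'I_T * 'I_T) := U ^+ t.1 * V ^+ t.2.
pose g (i : I) : wey k := S ^+ i.1.1 * (A ^+ i.1.2 * (L i.2.1 * x ^+ i.2.2)).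
have bg i : wbound M.-1 M.-1 (g i).
  have h := wboundM (wboundX i.1.1 bS) (wboundM (wboundX i.1.2 bA)
    (wboundM (_ : wbound (p * T) (p * T) (L i.2.1)) (wboundX i.2.2 bx))).
  apply: wboundS (h _); last first.
  - rewrite /L latticeE; apply/wboundP => a b; rewrite wcoefUV.
    case: andP => [[/eqP -> /eqP ->] _|_]; last by rewrite eqxx.
    by rewrite !leq_mul2l !(ltnW (ltn_ord _)) !orbT.
  - have := ltn_ord i.1.1; have := ltn_ord i.1.2; have : (i.2.2 <= 1)%N by case: i.2.2.
    by rewrite /M /c; nia.
  - have := ltn_ord i.1.1; have := ltn_ord i.1.2; have : (i.2.2 <= 1)%N by case: i.2.2.
    by rewrite /M /c; nia.
have ltJI : (#|{: J}| < #|{: I}|)%N.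
  by rewrite !card_prod !card_ord card_bool /M /T; nia.
have [v [[[i0 j0] [t0 e0]] v0] sum0] := linear_dependence (fun (i : I) (j : J) => wcoef (g i) j.1 j.2) ltJI.
have {}sum0 : \sum_i v i *: g i = 0.
  apply: wcoefP => a b; rewrite wcoef0 wcoef_sum.
  have [/andP[lta ltb]|] := boolP ((a < M)%N && (b < M)%N).
    rewrite -[RHS](sum0 (Ordinal lta, Ordinal ltb)); apply: eq_bigr => i _.
    by rewrite wcoefZ.
  rewrite negb_and -!leqNgt => h; apply: big1 => i _; rewrite wcoefZ.
  apply/eqP; rewrite mulf_eq0; apply/orP; right; apply/negPn/negP => /((wboundP _ _ _).1 (bg i)).
  by move: h; rewrite /M /c; lia.
pose z (i j : 'I_p) e := \sum_t v ((i, j), (t, e)) *: L t.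
have zC i j e y : lie (z i j e) y = 0.
  by rewrite lie_suml big1 // => t _; rewrite lieZl lattice_central scaler0.
pose Z (i j : 'I_p) := z i j false + z i j true * x.
have ZC y i j : lie y x = 0 -> lie y (Z i j) = 0.
  by move=> yx; rewrite lieDr lieMr yx mulr0 addr0 ![lie y (z _ _ _)]lieN !zC oppr0 mul0r addr0.
have sumZ : \sum_(i < p) S ^+ i * (\sum_(j < p) A ^+ j * Z i j) = 0.
  have E : \sum_i \sum_j \sum_t \sum_e v ((i, j), (t, e)) *: g ((i, j), (t, e)) = 0.
    rewrite -[RHS]sum0.
    under eq_bigr => i _ do under eq_bigr => j _ do rewrite pair_bigA.
    by rewrite pair_bigA pair_bigA; apply: eq_bigr => [[[i j] [t e]]].
  rewrite -[RHS]E; apply: eq_bigr => i _; rewrite mulr_sumr; apply: eq_bigr => j _.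
  rewrite /Z /z mulr_suml -big_split /= !mulr_sumr; apply: eq_bigr => t _.
  rewrite big_bool /= [RHS]addrC /g /= expr0 expr1 mulr1 !mulrDr.
  by rewrite -!scalerAl -!scalerAr.
pose ext (f : 'I_p -> wey k) n := oapp f 0 (insub n).
have extE f (i : 'I_p) : ext f i = f i by rewrite /ext valK.
have lie_ext y f : (forall i, lie y (f i) = 0) -> forall n, lie y (ext f n) = 0.
  by move=> h n; rewrite /ext; case: insub => [i|] /=; rewrite ?h ?lie0r.
have Y0 i : \sum_(j < p) A ^+ j * Z i j = 0.
  pose Y i := \sum_(j < p) A ^+ j * Z i j.
  rewrite -[LHS]/(Y i) -extE; apply: (@powers_independent A S 1 p (ext Y)) => //.
  - exact: oner_neq0.
  - by rewrite AS scale1r.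
  - apply: lie_ext => {}i; rewrite lie_sumr big1 // => j _.
    by rewrite lieMr ZC // mulr0 addr0 lieX0 ?liexx // mul0r.
  - by rewrite -[RHS]sumZ; apply: eq_bigr => j _; rewrite extE.
have Z0 : Z i0 j0 = 0.
  rewrite -(extE (Z i0)); apply: (@powers_independent S A (-1) p (ext (Z i0))) => //.
  - by rewrite oppr_eq0 oner_eq0.
  - by rewrite lieN AS scaleNr scale1r.
  - by apply: lie_ext => j; rewrite ZC.
  - by rewrite -[RHS](Y0 i0); apply: eq_bigr => j _; rewrite extE.
have coefz i j e t : wcoef (z i j e) (p * (t : 'I_T * 'I_T).1) (p * t.2) = v (i, j, (t, e)).
  rewrite wcoef_sum (bigD1 t) //= big1 ?addr0 => [|[a b] ne_t].
    by rewrite wcoefZ /L latticeE wcoefUV !eqxx mulr1.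
  rewrite wcoefZ /L latticeE wcoefUV /= !eqn_mul2l !eqn0Ngt p0 /=.
  case: eqP => [ea|_]; rewrite ?mulr0 //; case: eqP => [eb|_]; rewrite ?mulr0 //.
  by case/eqP: ne_t; rewrite [t]surjective_pairing; congr (_, _); apply: val_inj.
have nz1 : z i0 j0 true <> 0.
  move=> z1; have z00 : z i0 j0 false = 0 by move: Z0; rewrite /Z z1 mul0r addr0.
  case/eqP: v0; rewrite -coefz.
  by case: e0; rewrite ?z1 ?z00 wcoef0.
have : lie (Z i0 j0) w = 0 by rewrite Z0 lie0l.
rewrite lieDl lieMl !zC mul0r addr0 add0r => h.
by have [/nz1|] := wey_mulf_eq0 h.
Qed.
End Centralizer.

(** * Polynomials in u^p and v^p over a valuation ring *)

Section LatticePart.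
Variables (R : comNzRingType) (p : nat).
Hypothesis p_pr : prime p.
Implicit Types (x y : wey R).
Local Notation U := (wU ^+ p : wey R).
Local Notation V := (wV ^+ p : wey R).

(** The polynomial in u^p and v^p with coefficients f, truncated at degree n in
    each variable. *)
Definition lattice_sum n (f : nat -> nat -> R) : wey R :=
  \sum_(a < n) \sum_(b < n) f a b *: (U ^+ a * V ^+ b).

Lemma wcoef_lattice_sum n f i j : wcoef (lattice_sum n f) i j =
  if [&& (p %| i)%N, (p %| j)%N, (i %/ p < n)%N & (j %/ p < n)%N]
  then f (i %/ p)%N (j %/ p)%N else 0.
Proof.
have p0 := prime_gt0 p_pr.
have E (a b : nat) : wcoef (f a b *: (U ^+ a * V ^+ b)) i j =
    if (i == p * a)%N && (j == p * b)%N then f a b else 0.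
  by rewrite wcoefZ -!exprM wcoefUV; case: ifP; rewrite ?mulr1 ?mulr0.
rewrite wcoef_sum; under eq_bigr => a _ do rewrite wcoef_sum.
case: ifP => [/and4P[/dvdnP[a ia] /dvdnP[b jb]]|h].
  subst i j; rewrite !mulnK // => lta ltb.
  rewrite (bigD1 (Ordinal lta)) //= (bigD1 (Ordinal ltb)) //= E.
  rewrite ![(p * _)%N]mulnC !eqxx /= big1 ?addr0; last first.
    move=> b' ne; rewrite E ![(p * _)%N]mulnC eqxx eqn_mul2r eqn0Ngt p0 /=.
    by case: eqP => // eb; case/eqP: ne; apply: val_inj.
  rewrite big1 ?addr0 // => a' ne; rewrite big1 // => b' _.
  rewrite E ![(p * _)%N]mulnC eqn_mul2r eqn0Ngt p0 /=.
  by case: eqP => // ea; case/eqP: ne; apply: val_inj.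
rewrite big1 // => a _; rewrite big1 // => b _; rewrite E.
by case: andP => // -[/eqP ei /eqP ej]; move: h; rewrite ei ej !dvdn_mulr // !mulKn // !ltn_ord.
Qed.

Lemma lattice_sum_central n f x : eqm p (lie x (lattice_sum n f)) 0.
Proof.
rewrite lie_sumr; apply: eqm0_sum => a _; rewrite lie_sumr; apply: eqm0_sum => b _.
rewrite lieZr -!exprM lieMr; have [z1 ->] := lie_wUXn x (p * a).
have [z2 ->] := lie_wVXn x (p * b); rewrite !add0r mulnC [(p * b)%N]mulnC !mulrnA.
rewrite mulrnAl mulrnAr -mulrnDl -scalerMnr; exact/eqm0Mn.
Qed.
End LatticePart.

Section Map.
Variables (R R' : comNzRingType) (phi : {rmorphism R -> R'}).
Lemma wmap_lie x y : wmap phi (lie x y) = lie (wmap phi x) (wmap phi y).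
Proof. by rewrite /lie rmorphB !rmorphM. Qed.
End Map.

Section EvalAt.
Variables (R : comNzRingType) (B : algType R) (S A : B).
Hypothesis AS : lie A S = 1.

Lemma horner_alg_rel c : A * horner_alg S c = horner_alg S c * A + horner_alg S c^`().
Proof.
elim/poly_ind: c => [|c a IHc]; first by rewrite deriv0 !raddf0 mulr0 mul0r addr0.
have AS' : A * S = S * A + 1 by rewrite -AS /lie addrC subrK.
rewrite derivD derivC addr0 derivM derivX mulr1 !rmorphD !rmorphM /=.
rewrite !horner_algX !horner_algC mulrDr mulrDl mulrA IHc mulrDl -!mulrA AS'.
rewrite mulrDr mulr1 -scalerAr -scalerAl mulr1 mul1r.
by rewrite -!addrA; congr (_ + _); rewrite addrCA [RHS]addrC -addrA.
Qed.

(** The morphism from the Weyl algebra that sends u to S and v to A. *)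
Definition weval (x : wey R) : B := wev (horner_alg S) A x.
HB.instance Definition _ := GRing.isZmodMorphism.Build (wey R) B weval
  (@wev_is_zmod_morphism _ _ _ _).
Lemma weval_is_monoid_morphism : monoid_morphism weval.
Proof. exact: (wev_is_monoid_morphism horner_alg_rel). Qed.
Lemma weval1 : weval 1 = 1. Proof. by case: weval_is_monoid_morphism. Qed.
Lemma wevalM x y : weval (x * y) = weval x * weval y.
Proof. by case: weval_is_monoid_morphism => _; apply. Qed.
Lemma wevalX x n : weval (x ^+ n) = weval x ^+ n.
Proof. by elim: n => [|n IHn]; rewrite ?weval1 // !exprS wevalM IHn. Qed.
Lemma wevalU : weval wU = S.
Proof. exact: (etrans (wevC _ _ _) (horner_algX _)). Qed.
Lemma wevalV : weval wV = A. Proof. exact: wevV. Qed.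
Lemma weval_lie x y : weval (lie x y) = lie (weval x) (weval y).
Proof. by rewrite /lie raddfB /= !wevalM. Qed.
Lemma wevalZ a x : weval (a *: x) = a *: weval x.
Proof.
have aE : weval (wC a%:P) = a%:A by exact: (etrans (wevC _ _ _) (horner_algC _ _)).
by rewrite wscaleE wevalM aE -scalerAl mul1r.
Qed.

(** The image of [lie_vp_up] under the morphism that sends u to S and v to A. *)
Lemma lie_pth_powers p : prime p -> eqm (p * p) (lie (A ^+ p) (S ^+ p)) (1 *+ p`!).
Proof.
move=> p_pr; have [z] := lie_vp_up R p_pr; move/(congr1 weval).
rewrite weval_lie !wevalX wevalU wevalV => ->; exists (weval z).
by rewrite raddfD /= !raddfMn /= weval1.
Qed.
End EvalAt.

Section Valuation.
Variables (O : comNzRingType) (k : fieldType) (phi : {rmorphism O -> k}) (p : nat).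
Hypothesis pk : p \in [pchar k].
Hypothesis O_val : forall x y : O, (exists z, y = x * z) \/ (exists z, x = y * z).
Hypothesis O_tf : forall x : O, x *+ p = 0 -> x = 0.
Hypothesis O_loc : forall x : O, phi x = 0 \/ exists y, x * y = 1.

Lemma common_divisor (s : seq O) : s != [::] ->
  exists2 c, c \in s & forall x, x \in s -> exists z, x = c * z.
Proof.
elim: s => // x [|y s] IHs _.
  by exists x; rewrite ?mem_head // => y; rewrite inE => /eqP->; exists 1; rewrite mulr1.
have [//|c cs hc] := IHs; have [[z hz]|[z hz]] := O_val x c.
  exists x; first exact: mem_head.
  move=> t; rewrite inE => /orP[/eqP->|/hc[w ->]]; first by exists 1; rewrite mulr1.
  by exists (z * w); rewrite hz mulrA.
exists c; first by rewrite inE cs orbT.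
by move=> t; rewrite inE => /orP[/eqP->|/hc //]; exists z.
Qed.

(** Divide the off-lattice part w of T by a coefficient c that divides all the
    others.  If p does not divide c, then c properly divides p, so w / c still
    commutes with S and A modulo the maximal ideal.  By [centralizer_on_lattice]
    its reduction is supported on the lattice, although by construction one of its
    off-lattice coefficients is 1. *)
Lemma off_lattice_dvd (S A T : wey O) : lie A S = 1 ->
  eqm p (lie S T) 0 -> eqm p (lie A T) 0 ->
  forall i j, ~~ ((p %| i)%N && (p %| j)%N) -> exists z, wcoef T i j = z *+ p.
Proof.
move=> AS ST AT i j hij; have p_pr := pchar_prime pk; have p0 := prime_gt0 p_pr.
have [d bT] := wbound_exists T.
pose s := lattice_sum p d.+1 (fun a b => wcoef T (p * a) (p * b)); pose w := T - s.
have wE a b : wcoef w a b = if (p %| a)%N && (p %| b)%N then 0 else wcoef T a b.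
  rewrite wcoefB wcoef_lattice_sum //; case: ifP => [/and4P[pa pb _ _]|].
    by rewrite pa pb ![(p * _)%N]mulnC !divnK // subrr.
  rewrite subr0; case: ifP => // /andP[pa pb] /negbT; rewrite pa pb /= => h.
  apply/eqP/negPn/negP => /((wboundP _ _ _).1 bT)/andP[la lb]; move: h.
  by rewrite !ltnS !(leq_trans (leq_div _ _)).
have bw a b : ~~ ((a < d.+1) && (b < d.+1))%N -> wcoef w a b = 0.
  rewrite wE; case: ifP => // _; apply: contraNeq => /((wboundP _ _ _).1 bT).
  by rewrite !ltnS.
have Sw y : eqm p (lie y T) 0 -> eqm p (lie y w) 0.
  by move=> yT; rewrite lieBr; apply: eqm0D => //; apply: eqm0N; apply: lattice_sum_central.
pose cs := [seq wcoef w ab.1 ab.2 | ab : 'I_d.+1 * 'I_d.+1].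
have csP a b : (a < d.+1)%N -> (b < d.+1)%N -> wcoef w a b \in cs.
  by move=> la lb; apply/fintype.imageP; exists (Ordinal la, Ordinal lb).
have [|_ /fintype.imageP[[i0 j0] _ /= ->] hc] := @common_divisor cs.
  by apply/eqP => cs0; have := csP 0%N 0%N isT isT; rewrite cs0.
pose c := wcoef w i0 j0.
suff [z hz] : exists z, c = z *+ p.
  have [/andP[li lj]|] := boolP ((i < d.+1) && (j < d.+1))%N.
    have [t] := hc _ (csP i j li lj); rewrite wE (negPf hij) => ->.
    by exists (z * t); rewrite -/c hz mulrnAl.
  by move/bw; rewrite wE (negPf hij) => ->; exists 0; rewrite mul0rn.
have [[z hz]|[c' hc']] := O_val p%:R c; first by exists z; rewrite hz mulr_natl.
have [phic'|[y hy]] := O_loc c'; last first.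
  by exists y; rewrite -mulr_natl hc' -mulrA hy mulr1.
have /choice[f fE] : forall ab : nat * nat, exists z, wcoef w ab.1 ab.2 = c * z.
  move=> [a b]; have [/andP[la lb]|/bw->] := boolP ((a < d.+1) && (b < d.+1))%N.
    exact: hc (csP _ _ la lb).
  by exists 0; rewrite mulr0.
(* f is only determined up to the annihilator of c, so 1 is imposed at (i0, j0) *)
pose f1 ab := if ab == (i0 : nat, j0 : nat) then 1 else f ab.
pose w1 : wey O := \sum_(a < d.+1) \sum_(b < d.+1) f1 (a : nat, b : nat) *: (wU ^+ a * wV ^+ b).
have w1E (a b : 'I_d.+1) : wcoef w1 a b = f1 (a : nat, b : nat).
  rewrite wcoef_sum (bigD1 a) //= wcoef_sum (bigD1 b) //= wcoefZ wcoefUV !eqxx mulr1.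
  rewrite big1 ?addr0 => [|b' ne]; last first.
    by rewrite wcoefZ wcoefUV eqxx /= eq_sym -val_eqE /= in ne *; rewrite (negPf ne) mulr0.
  rewrite big1 ?addr0 // => a' ne; rewrite wcoef_sum big1 // => b' _.
  by rewrite wcoefZ wcoefUV eq_sym -val_eqE /= in ne *; rewrite (negPf ne) mulr0.
have ww1 : w = c *: w1.
  apply: wcoefP => a b; rewrite wcoefZ.
  have [/andP[la lb]|h] := boolP ((a < d.+1) && (b < d.+1))%N.
    rewrite (w1E (Ordinal la) (Ordinal lb)) /f1 /=.
    by case: eqP => [[-> ->]|_]; rewrite ?mulr1 // -fE.
  rewrite bw // wcoef_sum big1 ?mulr0 // => a' _; rewrite wcoef_sum big1 // => b' _.
  rewrite wcoefZ wcoefUV; case: andP => [[/eqP ea /eqP eb]|_]; last by rewrite mulr0.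
  by rewrite ea eb !ltn_ord in h.
have cI (x : wey O) : c *: x = 0 -> x = 0.
  move=> cx; apply: wcoefP => a b; rewrite wcoef0; apply: O_tf.
  have := congr1 (fun x => c' * wcoef x a b) cx; rewrite wcoefZ wcoef0 mulr0 mulrA.
  by rewrite [c' * c]mulrC -hc' mulr_natl.
have comm y : eqm p (lie y T) 0 -> lie (wmap phi y) (wmap phi w1) = 0.
  move=> /Sw[z]; rewrite add0r ww1 lieZr -scaler_nat hc' -scalerA => /eqP.
  rewrite -subr_eq0 -scalerBr => /eqP/cI/subr0_eq => h.
  by rewrite -wmap_lie h wmapZ phic' scale0r.
have AS' : lie (wmap phi A) (wmap phi S) = 1 by rewrite -wmap_lie AS rmorph1.
have := centralizer_on_lattice pk AS' (comm _ ST) (comm _ AT).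
move=> /(_ i0 j0); rewrite coef_wmap w1E /f1 eqxx rmorph1 oner_eq0 => /(_ isT) h.
by exists 0; rewrite /c wE h mul0rn.
Qed.
End Valuation.

(** * The Poisson pair of p-th powers *)

Section CongruenceCoef.
Variables (R : comNzRingType) (q : nat).
Implicit Types x y : wey R.

Lemma eqm_coef x y i j : eqm q x y -> exists z, wcoef x i j = wcoef y i j + z *+ q.
Proof. by move=> [z ->]; exists (wcoef z i j); rewrite wcoefD wcoefMn. Qed.

Lemma coef_eqm0 x : (forall i j, exists z, wcoef x i j = z *+ q) -> eqm q x 0.
Proof.
move=> h; have /choice[f fE] : forall ij : nat * nat, exists z, wcoef x ij.1 ij.2 = z *+ q.
  by move=> [i j]; apply: h.
have [d bx] := wbound_exists x.
exists (\sum_(i < d.+1) \sum_(j < d.+1) f (i : nat, j : nat) *: (wU ^+ i * wV ^+ j)).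
apply: wcoefP => a b; rewrite add0r wcoefMn wcoef_sum.
have [/andP[la lb]|h'] := boolP ((a < d.+1) && (b < d.+1))%N.
  rewrite (bigD1 (Ordinal la)) //= wcoef_sum (bigD1 (Ordinal lb)) //= wcoefZ wcoefUV.
  rewrite !eqxx mulr1 big1 ?addr0 => [|b' ne]; last first.
    by rewrite wcoefZ wcoefUV eqxx /= eq_sym -val_eqE /= in ne *; rewrite (negPf ne) mulr0.
  rewrite big1 ?addr0 -?fE // => a' ne; rewrite wcoef_sum big1 // => b' _.
  by rewrite wcoefZ wcoefUV eq_sym -val_eqE /= in ne *; rewrite (negPf ne) mulr0.
rewrite big1 => [|a' _].
  apply/eqP; rewrite mul0rn; apply/negPn/negP => /((wboundP _ _ _).1 bx).
  by move=> /andP[la lb]; rewrite !ltnS la lb in h'.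
rewrite wcoef_sum big1 // => b' _; rewrite wcoefZ wcoefUV.
case: andP => [[/eqP ea /eqP eb]|_]; last by rewrite mulr0.
by rewrite ea eb !ltn_ord in h'.
Qed.

(** An error divisible by q has commutators divisible by q * q with elements that
    are central modulo q. *)
Lemma eqm_lie_square (x y s t : wey R) : eqm q x s -> eqm q y t ->
  (forall w, eqm q (lie w s) 0) -> (forall w, eqm q (lie w t) 0) ->
  eqm (q * q) (lie x y) (lie s t).
Proof.
move=> [a ->] [b ->] sC tC; rewrite lieDl !lieDr -addrA -[X in eqm _ _ X]addr0.
apply: eqmD; first exact: eqm_refl.
have lieMnr (u v : wey R) n : lie u (v *+ n) = lie u v *+ n.
  by rewrite /lie mulrnAl mulrnAr mulrnBl.
have lieMnl (u v : wey R) n : lie (v *+ n) u = lie v u *+ n.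
  by rewrite /lie mulrnAl mulrnAr mulrnBl.
rewrite !lieMnr !lieMnl; apply: eqm0D; last apply: eqm0D.
- by rewrite lieN -[X in eqm _ _ X](mul0rn _ q); apply: eqmMnM; apply: eqm0N.
- by rewrite -[X in eqm _ _ X](mul0rn _ q); apply: eqmMnM.
- by rewrite -mulrnA; apply: eqm0Mn.
Qed.
End CongruenceCoef.

Section LatSumMap.
Variables (R R' : comNzRingType) (phi : {rmorphism R -> R'}) (p n : nat).
Lemma wmap_lattice_sum f :
  wmap phi (lattice_sum p n f) = lattice_sum p n (fun a b => phi (f a b)).
Proof.
rewrite wmap_sum; apply: eq_bigr => a _; rewrite wmap_sum; apply: eq_bigr => b _.
by rewrite wmapZ rmorphM !rmorphXn /= wmapU wmapV.
Qed.
End LatSumMap.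

Section Parity.
Variables (k : fieldType) (p : nat).
Hypothesis pk : p \in [pchar k].
Hypothesis p_odd : odd p.

Lemma two_neq0 : 2%:R != 0 :> k.
Proof.
rewrite -(dvdn_pcharf pk); apply/negP => p2.
have := dvdn_leq (isT : (0 < 2)%N) p2; move: p_odd (prime_gt1 (pchar_prime pk)).
by case: p => [|[|[|]]].
Qed.

Lemma adj_lattice_sum n f :
  adj (lattice_sum p n f) = lattice_sum p n (fun a b => (-1) ^+ b * f a b) :> wey k.
Proof.
rewrite adj_sum; apply: eq_bigr => a _; rewrite adj_sum; apply: eq_bigr => b _.
rewrite adjZ adjM !adjX adjV [adj wU]adjC -/wU.
have VUC : wU ^+ p ^+ a * wV ^+ p ^+ b = wV ^+ p ^+ b * wU ^+ p ^+ a :> wey k.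
  apply/lie_eq0; have := lattice_central pk a 0 (wV ^+ p ^+ b).
  by rewrite expr0 mulr1.
have -> : (- wV) ^+ p = - wV ^+ p :> wey k.
  by rewrite exprNn -signr_odd p_odd expr1 mulN1r.
rewrite [(- _ ^+ p) ^+ b]exprNn -mulrA -VUC -signr_odd -[(-1) ^+ b in RHS]signr_odd.
by case: (odd b); rewrite ?expr1 ?expr0 ?mulN1r ?mul1r // scalerN scaleNr.
Qed.

(** The adjoint negates v^p because p is odd, so a symmetric or skew polynomial in
    u^p and v^p is even or odd in v^p. *)
Lemma lattice_sum_parity n (f : nat -> nat -> k) (e : bool) (x : wey k) :
  (forall a b, f a b != 0 -> (a < n)%N && (b < n)%N) ->
  x = lattice_sum p n f -> adj x = (-1) ^+ e * x -> forall a b, f a b != 0 -> odd b = e.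
Proof.
move=> fn -> hx a b fab; have p_pr := pchar_prime pk.
have := congr1 (fun x => wcoef x (p * a) (p * b)) hx.
have -> : (-1) ^+ e * lattice_sum p n f = (-1) ^+ e *: lattice_sum p n f :> wey k.
  by case: e {hx}; rewrite ?expr1 ?expr0 ?mulN1r ?mul1r ?scaleN1r ?scale1r.
rewrite adj_lattice_sum wcoefZ !wcoef_lattice_sum // !dvdn_mulr // !mulKn ?prime_gt0 //.
rewrite fn //= => /(mulIf fab); rewrite -signr_odd; case: (odd b); case: e {hx} => //.
  by move=> /eqP; rewrite expr1 expr0 -subr_eq0 -opprD oppr_eq0 (negPf two_neq0).
by move=> /eqP; rewrite expr1 expr0 eq_sym -subr_eq0 -opprD oppr_eq0 (negPf two_neq0).
Qed.
End Parity.

Lemma prime_ndvd_fact p n : prime p -> (n < p)%N -> (p %| n`!)%N = false.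
Proof.
move=> p_pr; elim: n => [|n IHn] lt_np; first by rewrite dvdn1 gtn_eqF ?prime_gt1.
by rewrite factS Euclid_dvdM // gtnNdvd //= IHn // ltnW.
Qed.

Section PoissonPair.
Variables (O : comNzRingType) (k : fieldType) (phi : {rmorphism O -> k}) (p : nat).
Hypothesis pk : p \in [pchar k].
Hypothesis p_odd : odd p.
Hypothesis O_val : forall x y : O, (exists z, y = x * z) \/ (exists z, x = y * z).
Hypothesis O_tf : forall x : O, x *+ p = 0 -> x = 0.
Hypothesis O_loc : forall x : O, phi x = 0 \/ exists y, x * y = 1.

(** The bracket of al and sg is 1.  The sum is the coefficient of U^l V^m in the
    bracket.  The predecessors are truncated, which is harmless: the determinant
    vanishes whenever one of the two sums is zero. *)
Definition is_poisson_pair (n : nat) (al sg : nat -> nat -> k) :=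
  forall l m, \sum_(a < n) \sum_(b < n) \sum_(a' < n) \sum_(b' < n)
    al a b * sg a' b' * ((b * a')%:R - (b' * a)%:R)
      *+ (((a + a').-1 == l) && ((b + b').-1 == m)) = ((l == 0%N) && (m == 0%N))%:R.

(** Beyond the bound d of the sum the coefficients of T^p vanish for reasons of
    degree, and off the lattice they are divisible by p. *)
Lemma pth_power_lattice (S A T : wey O) d :
  lie A S = 1 -> eqm p (lie S (T ^+ p)) 0 -> eqm p (lie A (T ^+ p)) 0 -> wbound d d T ->
  eqm p (T ^+ p) (lattice_sum p d.+1 (fun a b => wcoef (T ^+ p) (p * a) (p * b))).
Proof.
move=> AS ST AT bT; set s := lattice_sum _ _ _; have p_pr := pchar_prime pk.
rewrite -[T ^+ p](subrK s) -[X in eqm _ _ X]add0r; apply: eqmD; last exact: eqm_refl.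
apply: coef_eqm0 => i j; rewrite wcoefB wcoef_lattice_sum //.
have [/andP[pi pj]|h] := boolP ((p %| i) && (p %| j))%N; last first.
  rewrite [X in if X then _ else _](_ : _ = false) ?subr0; last first.
    by apply/negP => /and4P[pi pj _ _]; rewrite pi pj in h.
  exact: (off_lattice_dvd pk O_val O_tf O_loc AS ST AT).
exists 0; rewrite mul0rn pi pj /= ![(p * _)%N]mulnC !divnK //.
case: ifP => [_|h]; first by rewrite subrr.
rewrite subr0; apply/eqP/negPn/negP => /((wboundP _ _ _).1 (wboundX p bT)).
case/dvdnP: pi h => a ->; case/dvdnP: pj => b ->; have p0 := prime_gt0 p_pr.
by rewrite !mulnK // ![(_ * p)%N]mulnC !leq_pmul2l // !ltnS => ->.
Qed.

(** [A^p, S^p] is computed modulo p * p in two ways: as p!, from [A, S] = 1, and as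
    p! times the bracket, from the expressions of A^p and S^p as polynomials in
    u^p and v^p.  Cancelling p leaves the factor (p - 1)!, which is a unit modulo
    p. *)
Lemma poisson_pair (S A : wey O) d :
  wbound d d S -> wbound d d A -> lie A S = 1 -> adj S = S -> adj A = - A ->
  exists sg al : nat -> nat -> k,
  [/\ wmap phi A ^+ p = lattice_sum p d.+1 al,
    forall a b, sg a b != 0 -> [/\ (a <= d)%N, (b <= d)%N & ~~ odd b],
    forall a b, al a b != 0 -> [/\ (a <= d)%N, (b <= d)%N & odd b]
    & is_poisson_pair d.+1 al sg].
Proof.
move=> bS bA AS adjS adjA; have p_pr := pchar_prime pk; have p0 := prime_gt0 p_pr.
pose sg a b := wcoef (S ^+ p) (p * a) (p * b).
pose al a b := wcoef (A ^+ p) (p * a) (p * b).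
have hS : eqm p (S ^+ p) (lattice_sum p d.+1 sg).
  apply: (@pth_power_lattice S A) => //.
    by rewrite lieX0 ?liexx //; apply: eqm_refl.
  by rewrite (@lieXr _ _ _ 1) ?lie1l //; apply: eqm0Mn.
have hA : eqm p (A ^+ p) (lattice_sum p d.+1 al).
  apply: (@pth_power_lattice S A) => //.
    by rewrite (@lieXr _ _ _ (-1)) ?lieNl ?lie1l ?oppr0 // -?AS -?lieN //; apply: eqm0Mn.
  by rewrite lieX0 ?liexx //; apply: eqm_refl.
have wphi x y : eqm p x y -> wmap phi x = wmap phi y.
  by move=> [z ->]; rewrite rmorphD rmorphMn /= (wey_pchar pk) addr0.
have bd (T : wey O) a b : wbound d d T -> phi (wcoef (T ^+ p) (p * a) (p * b)) != 0 ->
    (a < d.+1)%N && (b < d.+1)%N.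
  move=> bT h; have : wcoef (T ^+ p) (p * a) (p * b) != 0.
    by apply: contraNneq h => ->; rewrite raddf0.
  by move=> /((wboundP _ _ _).1 (wboundX p bT)); rewrite !leq_pmul2l.
have ephiA : wmap phi A ^+ p = lattice_sum p d.+1 (fun a b => phi (al a b)).
  by rewrite -rmorphXn /= (wphi _ _ hA) wmap_lattice_sum.
have ephiS : wmap phi S ^+ p = lattice_sum p d.+1 (fun a b => phi (sg a b)).
  by rewrite -rmorphXn /= (wphi _ _ hS) wmap_lattice_sum.
exists (fun a b => phi (sg a b)), (fun a b => phi (al a b)); split=> //.
- move=> a b h; have /andP[la lb] := bd _ _ _ bS h; split=> //.
  suff -> : odd b = false by [].
  apply: (lattice_sum_parity pk p_odd (fun a b => bd _ a b bS) ephiS _ h).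
  by rewrite adjX -wmap_adj adjS expr0 mul1r.
- move=> a b h; have /andP[la lb] := bd _ _ _ bA h; split=> //.
  suff -> : odd b = true by [].
  apply: (lattice_sum_parity pk p_odd (fun a b => bd _ a b bA) ephiA _ h).
  by rewrite adjX -wmap_adj adjA raddfN /= [(- wmap _ _) ^+ p]exprNn -[(-1) ^+ p]signr_odd p_odd.
move=> l m.
pose P : O := \sum_(a < d.+1) \sum_(b < d.+1) \sum_(a' < d.+1) \sum_(b' < d.+1)
    al a b * sg a' b' * ((b * a')%:R - (b' * a)%:R)
      *+ (((a + a').-1 == l) && ((b + b').-1 == m)).
suff : phi P = ((l == 0%N) && (m == 0%N))%:R.
  move=> <-; rewrite /P raddf_sum; apply: eq_bigr => a _.
  rewrite raddf_sum; apply: eq_bigr => b _; rewrite raddf_sum; apply: eq_bigr => a' _.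
  rewrite raddf_sum; apply: eq_bigr => b' _.
  by rewrite [RHS]raddfMn /= [phi (_ * _)]rmorphM [phi (_ * _)]rmorphM rmorphB !rmorph_nat.
pose Q : wey O := \sum_(a < d.+1) \sum_(b < d.+1) \sum_(a' < d.+1) \sum_(b' < d.+1)
   (al a b * sg a' b' * ((b * a')%:R - (b' * a)%:R)) *:
     ((wU ^+ p) ^+ (a + a').-1 * (wV ^+ p) ^+ (b + b').-1).
have QE : wcoef Q (p * l) (p * m) = P.
  rewrite wcoef_sum; apply: eq_bigr => a _; rewrite wcoef_sum; apply: eq_bigr => b _.
  rewrite wcoef_sum; apply: eq_bigr => a' _; rewrite wcoef_sum; apply: eq_bigr => b' _.
  rewrite wcoefZ -!exprM wcoefUV !eqn_pmul2l // mulr_natr.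
  by rewrite [l == _]eq_sym [m == _]eq_sym.
have : eqm (p * p) (Q *+ p`!) (1 *+ p`!).
  apply: eqm_trans (lie_pth_powers AS p_pr); apply: eqm_sym.
  have sC f w : eqm p (lie w (lattice_sum p d.+1 f : wey O)) 0 by apply: lattice_sum_central.
  apply: (eqm_trans (eqm_lie_square hA hS (sC _) (sC _))).
  rewrite lie_suml -sumrMnl; apply: eqm_sum => a _.
  rewrite lie_suml -sumrMnl; apply: eqm_sum => b _.
  rewrite lie_sumr -sumrMnl; apply: eqm_sum => a' _.
  rewrite lie_sumr -sumrMnl; apply: eqm_sum => b' _.
  rewrite lieZl lieZr scalerA.
  have [z ->] := lie_lattice O p_pr a b a' b'; rewrite scalerDr.
  exists ((al a b * sg a' b') *: z); congr (_ + _); last by rewrite -scalerMnr.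
  by rewrite -scalerMnr -[in RHS]scalerA scalerBl !scaler_nat.
move=> /(eqm_coef (p * l) (p * m)) [z]; rewrite !wcoefMn QE wcoef1 => hP.
have fE : (p`! = (p.-1)`! * p)%N by rewrite -{1}(prednK p0) factS prednK // mulnC.
have {}hP : (P - ((l == 0%N) && (m == 0%N))%:R) *+ (p.-1)`! = z *+ p.
  apply/eqP; rewrite -subr_eq0; apply/eqP/O_tf.
  rewrite mulrnBl -!mulrnA -fE mulrnBl hP !muln_eq0 !eqn0Ngt p0 /=.
  by rewrite addrAC addrK subrr.
have : phi (P - ((l == 0%N) && (m == 0%N))%:R) * (p.-1)`!%:R = 0.
  by rewrite mulr_natr -raddfMn hP /= raddfMn /= -mulr_natr (pcharf0 pk) mulr0.
move=> /eqP; rewrite mulf_eq0 -(dvdn_pcharf pk) orbC.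
rewrite prime_ndvd_fact ?prednK //=.
by rewrite raddfB /= rmorph_nat subr_eq0 => /eqP.
Qed.
End PoissonPair.

(** * Newton polygons of Poisson pairs *)

Section Newton.
Variables (k : fieldType) (p : nat).
Hypothesis pk : p \in [pchar k].
Variables (d : nat) (al sg : nat -> nat -> k).
Hypothesis d_lt_p : (d * d < p)%N.
Hypothesis sgP : forall a b, sg a b != 0 -> [/\ (a <= d)%N, (b <= d)%N & ~~ odd b].
Hypothesis alP : forall a b, al a b != 0 -> [/\ (a <= d)%N, (b <= d)%N & odd b].
Hypothesis pp : is_poisson_pair d.+1 al sg.

Lemma natr_inj m n : (m < p)%N -> (n < p)%N -> m%:R = n%:R :> k -> m = n.
Proof.
wlog le_mn : m n / (m <= n)%N => [hw|] lt_m lt_n e.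
  have [le_mn|/ltnW le_nm] := leqP m n; first exact: hw.
  by apply/esym/hw.
have : (p %| n - m)%N by rewrite (dvdn_pcharf pk) natrB // e subrr.
by move=> /dvdn_leq h; apply/eqP; rewrite eqn_leq le_mn leqNgt -subn_gt0; apply/negP => /h; lia.
Qed.

Lemma sum4_single n (F : nat -> nat -> nat -> nat -> k) a b a' b' :
  (a < n)%N -> (b < n)%N -> (a' < n)%N -> (b' < n)%N ->
  (forall x y x' y', F x y x' y' != 0 -> [/\ x = a, y = b, x' = a' & y' = b']) ->
  \sum_(x < n) \sum_(y < n) \sum_(x' < n) \sum_(y' < n) F x y x' y' = F a b a' b'.
Proof.
move=> la lb la' lb' h.
have h0 x y x' y' : ~ [/\ x = a, y = b, x' = a' & y' = b'] -> F x y x' y' = 0.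
  by move=> ne; apply/eqP/negPn/negP => /h.
have one (G : nat -> k) c : (c < n)%N -> (forall x, x <> c -> G x = 0) ->
    \sum_(x < n) G x = G c.
  move=> lc hG; rewrite (bigD1 (Ordinal lc)) //= big1 ?addr0 // => x ne.
  by apply: hG => e; case/eqP: ne; apply: val_inj.
rewrite (one (fun x => \sum_(y < n) \sum_(x' < n) \sum_(y' < n) F x y x' y') a) //; last first.
  by move=> x ne; rewrite big1 // => y _; rewrite big1 // => x' _; rewrite big1 // => y' _;
    apply: h0; case.
rewrite (one (fun y => \sum_(x' < n) \sum_(y' < n) F a y x' y') b) //; last first.
  by move=> y ne; rewrite big1 // => x' _; rewrite big1 // => y' _; apply: h0; case.
rewrite (one (fun x' => \sum_(y' < n) F a b x' y') a') //; last first.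
  by move=> x' ne; rewrite big1 // => y' _; apply: h0; case.
by rewrite (one (fun y' => F a b a' y') b') // => y' ne; apply: h0; case.
Qed.

(** In the constant term of the bracket only al(0, 1) sg(1, 0) survives, because al
    is odd in V. *)
Lemma linear_parts : (0 < d)%N -> al 0 1 != 0 /\ sg 1 0 != 0.
Proof.
move=> d0; have := pp 0 0; rewrite (@sum4_single _ (fun a b a' b' => al a b * sg a' b' *
  ((b * a')%:R - (b' * a)%:R) *+ (((a + a').-1 == 0%N) && ((b + b').-1 == 0%N))) 0 1 1 0) //.
  rewrite /= mul1n mul0n subr0 mulr1 mulr1n => h; apply/andP.
  by rewrite -negb_or -mulf_eq0 h oner_eq0.
move=> x y x' y' nz.
have alx : al x y != 0 by apply: contraNneq nz => ->; rewrite !mul0r mul0rn.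
have sgx : sg x' y' != 0 by apply: contraNneq nz => ->; rewrite mulr0 !mul0r mul0rn.
have ne' : (y * x')%N <> (y' * x)%N.
  by move=> e; case/eqP: nz; rewrite e subrr mulr0 mul0rn.
have [/eqP h1 /eqP h2] : ((x + x').-1 == 0%N) /\ ((y + y').-1 == 0%N).
  by apply/andP; apply: contraNT nz => /negPf ->; rewrite mulr0n.
have [_ _ oy] := alP alx.
move: h1 h2 ne' oy {nz alx sgx}.
by case: x => [|[|x]]; case: x' => [|[|x']]; case: y => [|[|y]]; case: y' => [|[|y']].
Qed.

Definition weight (t : rat) (i j : nat) : rat := i%:R + t * j%:R.

(** Ties for the largest weight are broken in favour of the smallest exponent of V:
    this is the monomial that still leads when t decreases slightly. *)
Definition lead (f : nat -> nat -> k) (t : rat) i j :=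
  f i j != 0 /\ forall x y, f x y != 0 ->
    weight t x y <= weight t i j /\ (weight t x y = weight t i j -> (j <= y)%N).

(** The product of the leading monomials arises only once in the bracket, with the
    determinant of the exponents as factor.  That determinant is smaller than p in
    absolute value, so it vanishes in k only if the exponents are parallel.  Otherwise the product
    contributes the constant term of the bracket. *)
Lemma lead_pair t a b a' b' : lead al t a b -> lead sg t a' b' ->
  (b * a' = b' * a)%N \/ (a + a' = 1 /\ b + b' = 1)%N.
Proof.
move=> [al0 hal] [sg0 hsg]; have [->|/eqP ne] := eqVneq (b * a')%N (b' * a)%N; first by left.
right; have := pp (a + a').-1 (b + b').-1.
have [la lb _] := alP al0; have [la' lb' _] := sgP sg0.
rewrite (@sum4_single _ (fun x y x' y' => al x y * sg x' y' *
  ((y * x')%:R - (y' * x)%:R) *+ (((x + x').-1 == (a + a').-1) && ((y + y').-1 == (b + b').-1))) a b a' b') //.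
  rewrite !eqxx mulr1n; case: andP => [[/eqP h1 /eqP h2] _|_ /eqP].
    by nia.
  rewrite !mulf_eq0 (negPf al0) (negPf sg0) /= subr_eq0 => /eqP /natr_inj e.
  by case: ne; apply: e; nia.
move=> x y x' y' nz.
have alx : al x y != 0 by apply: contraNneq nz => ->; rewrite !mul0r mul0rn.
have sgx : sg x' y' != 0 by apply: contraNneq nz => ->; rewrite mulr0 !mul0r mul0rn.
have ne' : (y * x')%N <> (y' * x)%N.
  by move=> e; case/eqP: nz; rewrite e subrr mulr0 mul0rn.
have [/eqP h1 /eqP h2] : ((x + x').-1 == (a + a').-1) /\ ((y + y').-1 == (b + b').-1).
  by apply/andP; apply: contraNT nz => /negPf ->; rewrite mulr0n.
have ex : (x + x' = a + a')%N by move: h1 ne ne'; clear; nia.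
have ey : (y + y' = b + b')%N by move: h2 ne ne'; clear; nia.
have exR : x%:R + x'%:R = a%:R + a'%:R :> rat by rewrite -!natrD ex.
have eyR : y%:R + y'%:R = b%:R + b'%:R :> rat by rewrite -!natrD ey.
have [w1 m1] := hal _ _ alx; have [w2 m2] := hsg _ _ sgx.
have ws : weight t x y + weight t x' y' = weight t a b + weight t a' b'.
  rewrite /weight addrACA -mulrDr exR eyR; lra.
have e1 : weight t x y = weight t a b by lra.
have e2 : weight t x' y' = weight t a' b' by lra.
have {}m1 := m1 e1; have {}m2 := m2 e2.
have [yb yb'] : y = b /\ y' = b' by move: ey m1 m2; clear; lia.
subst y y'; split => //.
  by apply/eqP; rewrite -(eqr_nat rat); move: e1; rewrite /weight => /addIr ->.
by apply/eqP; rewrite -(eqr_nat rat); move: e2; rewrite /weight => /addIr ->.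
Qed.

Lemma exists_lead (f : nat -> nat -> k) t i j :
  (forall a b, f a b != 0 -> (a <= d)%N && (b <= d)%N) ->
  f i j != 0 -> exists a b, lead f t a b.
Proof.
move=> fd fij; have /andP[li lj] := fd _ _ fij.
pose P (z : 'I_d.+1 * 'I_d.+1) := f z.1 z.2 != 0.
pose z0 : 'I_d.+1 * 'I_d.+1 := (Ordinal (li : (i < d.+1)%N), Ordinal (lj : (j < d.+1)%N)).
have Pz0 : P z0 by [].
case: (arg_maxP (fun z : 'I_d.+1 * 'I_d.+1 => weight t z.1 z.2) Pz0) => z1 Pz1 max1.
pose Q z := P z && (weight t z.1 z.2 == weight t z1.1 z1.2).
have Qz1 : Q z1 by rewrite /Q Pz1 eqxx.
case: (arg_minnP (fun z : 'I_d.+1 * 'I_d.+1 => (z.2 : nat)) Qz1).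
move=> z2 /andP[Pz2 /eqP w2] min2; exists z2.1, z2.2; split=> // x y fxy.
have /andP[lx ly] := fd _ _ fxy.
pose z : 'I_d.+1 * 'I_d.+1 := (Ordinal (lx : (x < d.+1)%N), Ordinal (ly : (y < d.+1)%N)).
have Pz : P z by [].
rewrite w2; split; first exact: (max1 z).
by move=> e; apply: (min2 z); rewrite /Q Pz /= e eqxx.
Qed.

(** The new direction t' is chosen so that the old leading monomial is still of
    maximal weight there. *)
Lemma lead_step (f : nat -> nat -> k) t t' i j :
  (forall a b, f a b != 0 -> (a <= d)%N && (b <= d)%N) ->
  lead f t i j -> t' <= t ->
  (forall x y, f x y != 0 -> (y < j)%N -> weight t' x y <= weight t' i j) ->
  exists x y, [/\ lead f t' x y, weight t' x y = weight t' i j, (y <= j)%N &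
    forall x' y', f x' y' != 0 -> (y' < j)%N -> weight t' x' y' = weight t' i j -> (y < j)%N].
Proof.
move=> fd [fij hij] le_t slopes.
have [x [y [fxy hxy]]] := exists_lead t' fd fij.
have top x' y' : f x' y' != 0 -> weight t' x' y' <= weight t' i j.
  move=> f'; have [/slopes->//|le_jy] := ltnP y' j.
  have [h _] := hij _ _ f'; move: h; rewrite /weight.
  by have : (j%:R : rat) <= y'%:R by [rewrite ler_nat]; nra.
have e : weight t' x y = weight t' i j.
  by apply/eqP; rewrite eq_le top // (hxy _ _ fij).1.
exists x, y; split=> //; first by apply: (hxy _ _ fij).2; rewrite e.
move=> x' y' f' lt' e'; apply: leq_ltn_trans lt'.
by apply: (hxy _ _ f').2; rewrite e' e.
Qed.

(** The parameter t for which (i, j) and (x, y) have equal weight. *)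
Definition slope i j x y : rat := (x%:R - i%:R) / (j%:R - y%:R).

Lemma slopeP i j x y t : (y < j)%N -> (slope i j x y <= t) = (weight t x y <= weight t i j).
Proof.
move=> lt_yj; have h : (0 : rat) < j%:R - y%:R by rewrite subr_gt0 ltr_nat.
rewrite /slope ler_pdivrMr // /weight; apply/idP/idP; lra.
Qed.

Lemma slope_weight i j x y : (y < j)%N ->
  weight (slope i j x y) x y = weight (slope i j x y) i j.
Proof.
move=> lt_yj; have h : j%:R - y%:R != 0 :> rat by rewrite gt_eqF // subr_gt0 ltr_nat.
by rewrite /weight /slope; field.
Qed.

Lemma lead_slope f t i j x y : lead f t i j -> f x y != 0 -> (y < j)%N -> slope i j x y < t.
Proof.
move=> [_ h] fxy lt_yj; have [h1 h2] := h _ _ fxy.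
rewrite lt_neqAle slopeP // h1 andbT; apply/eqP => e.
suff : (j <= y)%N by rewrite leqNgt lt_yj.
by apply: h2; rewrite -e slope_weight.
Qed.

(** Every monomial of al has exponent at least 1 in V. *)
Lemma skew_support_end t : 0 < t -> lead al t 0 1 -> forall x y, al x y != 0 -> x = 0%N /\ y = 1%N.
Proof.
move=> t0 [_ h] x y alx; have [_ _ oy] := alP alx; have [hw _] := h _ _ alx.
have y1 : (1 <= y)%N by case: y oy {alx hw}.
have y1R : (1 : rat) <= y%:R by rewrite ler1n.
have x0R : (0 : rat) <= x%:R by rewrite ler0n.
move: hw; rewrite /weight mulr1 add0r => hw.
have x0 : x%:R = 0 :> rat by nra.
have y0 : y%:R = 1 :> rat by nra.
by split; apply/eqP; rewrite -(eqr_nat rat) ?x0 ?y0.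
Qed.

(** U occurs in sg and has weight 1. *)
Lemma sg_lead_neq0 t a b : sg 1 0 != 0 -> lead sg t a b -> ~ (a = 0 /\ b = 0)%N.
Proof.
by move=> s10 [_ h] [a0 b0]; subst a b; have [] := h _ _ s10; rewrite /weight !mulr0 !addr0 ler10.
Qed.

Lemma sg_dd a b : sg a b != 0 -> (a <= d)%N && (b <= d)%N.
Proof. by move/sgP => [-> ->]. Qed.
Lemma al_dd a b : al a b != 0 -> (a <= d)%N && (b <= d)%N.
Proof. by move/alP => [-> ->]. Qed.

(** The walk along the Newton polygons, by induction on the sum of the exponents of
    V.  It cannot end with b' = 0 and parallel exponents, since b is odd and the
    leading exponent of sg is not (0, 0).  It therefore ends with (0, 1) and
    (1, 0), and since the monomials just before had the same weights and were
    parallel, the weight t' of (0, 1) is positive. *)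
Lemma newton_walk n t a b a' b' : sg 1 0 != 0 -> (b + b' <= n)%N ->
  lead al t a b -> lead sg t a' b' -> (b * a' = b' * a)%N -> (0 < b')%N ->
  forall x y, al x y != 0 -> x = 0%N /\ y = 1%N.
Proof.
move=> s10; elim: n t a b a' b' => [|n IHn] t a b a' b' le_n lal lsg par b'0; first by lia.
have [_ _ ob] := alP lal.1.
(* the next direction in which a new monomial of sg or al appears *)
pose I := 'I_d.+1.
pose P (z : bool * (I * I)) := if z.1 then (sg z.2.1 z.2.2 != 0) && (z.2.2 < b')%N
  else (al z.2.1 z.2.2 != 0) && (z.2.2 < b)%N.
pose F (z : bool * (I * I)) := if z.1 then slope a' b' z.2.1 z.2.2 else slope a b z.2.1 z.2.2.
have d1 : (1 < d.+1)%N by have [] := sgP s10.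
have Pz0 : P (true, (Ordinal d1, ord0)) by rewrite /P /= s10.
case: (arg_maxP F Pz0) => z1 Pz1 max1; set t' := F z1 in max1.
have lt_t : t' < t.
  by move: Pz1; rewrite /t' /P /F; case: z1.1 => /andP[]; apply: lead_slope.
have sl_sg x y : sg x y != 0 -> (y < b')%N -> weight t' x y <= weight t' a' b'.
  move=> sgx lt_y; rewrite -slopeP //; have [lx ly _] := sgP sgx.
  apply: (max1 (true, (Ordinal (lx : (x < d.+1)%N), Ordinal (ly : (y < d.+1)%N)))).
  by rewrite /P /= sgx.
have sl_al x y : al x y != 0 -> (y < b)%N -> weight t' x y <= weight t' a b.
  move=> alx lt_y; rewrite -slopeP //; have [lx ly _] := alP alx.
  apply: (max1 (false, (Ordinal (lx : (x < d.+1)%N), Ordinal (ly : (y < d.+1)%N)))).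
  by rewrite /P /= alx.
have [a1 [b1 [l1 w1 le1 lt1]]] := lead_step al_dd lal (ltW lt_t) sl_al.
have [a1' [b1' [l1' w1' le1' lt1']]] := lead_step sg_dd lsg (ltW lt_t) sl_sg.
have lt_n : (b1 + b1' < b + b')%N.
  move: Pz1; rewrite /P; case E: z1.1 => /andP[h1 h2].
    have : (b1' < b')%N by apply: (lt1' _ _ h1 h2); rewrite /t' /F E slope_weight.
    by lia.
  have : (b1 < b)%N by apply: (lt1 _ _ h1 h2); rewrite /t' /F E slope_weight.
  by lia.
have [_ _ ob1] := alP l1.1.
have nz1 := sg_lead_neq0 s10 l1'.
have [par1|[ea eb]] := lead_pair l1 l1'.
  have [b1'0|b1'0] := posnP b1'.
    case: nz1; split=> //; move: par1 ob1; rewrite b1'0 mul0n.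
    by case: b1 {l1 w1 le1 lt1 lt_n} => // b1 /eqP; rewrite muln_eq0 /= => /eqP.
  by apply: (IHn t' a1 b1 a1' b1') => //; lia.
have [eb1 eb1'] : b1 = 1%N /\ b1' = 0%N by move: ob1 eb; case: b1 {l1 w1 le1 lt1 lt_n} => // -[|b1] //; lia.
have [ea1 ea1'] : a1 = 0%N /\ a1' = 1%N.
  by move: ea; case: a1' nz1 {l1' w1' lt1'} => [[]|a1']; lia.
subst a1 b1 a1' b1'; apply: skew_support_end l1.
have b0 : (0 < b)%N by apply: odd_gt0.
have b0R : (0 : rat) < b%:R by rewrite ltr0n.
have parR : b%:R * a'%:R = b'%:R * a%:R :> rat by rewrite -!natrM par.
move: w1 w1'; rewrite /weight mulr1 mulr0 addr0 add0r => w1 w1'.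
have : b'%:R * t' = b%:R by rewrite w1; nra.
have : (0 : rat) <= b'%:R by rewrite ler0n.
nra.
Qed.

Lemma skew_support : forall x y, al x y != 0 -> x = 0%N /\ y = 1%N.
Proof.
have [d0|d0] := posnP d.
  move=> x y alx; have [_ ly oy] := alP alx; move: ly; rewrite d0 leqn0 => /eqP y0.
  by rewrite y0 in oy.
have [a01 s10] := linear_parts d0.
have [a [b lal]] := exists_lead 1 al_dd a01.
have [a' [b' lsg]] := exists_lead 1 sg_dd s10.
have [_ _ ob] := alP lal.1.
have nz := sg_lead_neq0 s10 lsg.
have [par|[ea eb]] := lead_pair lal lsg.
  have [b'0|b'0] := posnP b'; last by apply: newton_walk s10 (leqnn _) lal lsg par b'0.
  case: nz; split=> //; move: par ob; rewrite b'0 mul0n.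
  by case: b {lal} => // b /eqP; rewrite muln_eq0 /= => /eqP.
have [eb1 eb1'] : b = 1%N /\ b' = 0%N by move: ob eb; case: b {lal} => // -[|b] //; lia.
have [ea1 ea1'] : a = 0%N /\ a' = 1%N by move: ea; case: a' nz {lsg} => [[]|a']; lia.
by subst a b; apply: skew_support_end lal.
Qed.
End Newton.

(** * Primes inverted by finitely generated subrings *)

Section Subrings.
Variable K : fieldType.
Implicit Types (B O : set K) (x y c g : K) (q r : {poly K}).

Definition is_subring B := [/\ B 1, forall x y, B x -> B y -> B (x - y)
  & forall x y, B x -> B y -> B (x * y)].

Definition subring_pred B (hB : is_subring B) : {pred K} := fun x => `[< B x >].

Lemma subring_predP B (hB : is_subring B) x : (x \in subring_pred hB) <-> B x.
Proof. by split=> [/asboolP|] // ?; apply/asboolP. Qed.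

Lemma subring_pred_closed B (hB : is_subring B) : subring_closed (subring_pred hB).
Proof.
case: (hB) => h1 hs hm; split=> [|x y|x y]; rewrite -?topredE /=.
- exact/asboolP.
- by move=> /asboolP bx /asboolP by_; apply/asboolP; apply: hs.
- by move=> /asboolP bx /asboolP by_; apply/asboolP; apply: hm.
Qed.

HB.instance Definition _ B (hB : is_subring B) :=
  GRing.isSubringClosed.Build K (subring_pred hB) (subring_pred_closed hB).

Definition subring_type B (hB : is_subring B) := {x : K | x \in subring_pred hB}.

HB.instance Definition _ B (hB : is_subring B) := Choice.on (subring_type hB).
HB.instance Definition _ B (hB : is_subring B) := SubType.on (subring_type hB).
HB.instance Definition _ B (hB : is_subring B) :=
  [SubChoice_isSubComNzRing of (subring_type hB) by <:].

Definition subring_val B (hB : is_subring B) : subring_type hB -> K := val.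
HB.instance Definition _ B (hB : is_subring B) :=
  GRing.RMorphism.on (@subring_val B hB).

Definition to_subring B (hB : is_subring B) x (Bx : B x) : subring_type hB :=
  exist _ x ((subring_predP hB x).2 Bx).

Lemma subring_valP B (hB : is_subring B) (x : subring_type hB) : B (subring_val x).
Proof. by apply/(subring_predP hB)/valP. Qed.

Definition pover B q := forall i, B q`_i.

Lemma poverP B (hB : is_subring B) q : pover B q <-> q \is a polyOver (subring_pred hB).
Proof.
split=> [h|/polyOverP h i]; last by apply/(subring_predP hB).
by apply/polyOverP => i; apply/(subring_predP hB).
Qed.

Lemma subring0 B : is_subring B -> B 0.
Proof. by case=> h1 hs _; rewrite -(subrr 1); apply: hs. Qed.
Lemma subringN B x : is_subring B -> B x -> B (- x).
Proof. by move=> hB Bx; rewrite -sub0r; case: (hB) => _ hs _; apply: hs => //; apply: subring0. Qed.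
Lemma subringD B x y : is_subring B -> B x -> B y -> B (x + y).
Proof. by move=> hB Bx By; rewrite -[y]opprK; case: (hB) => _ hs _; apply: hs => //; apply: subringN. Qed.
Lemma subringM B x y : is_subring B -> B x -> B y -> B (x * y).
Proof. by case=> _ _ h; apply: h. Qed.
Lemma subringX B x n : is_subring B -> B x -> B (x ^+ n).
Proof. by move=> hB Bx; elim: n => [|n IHn]; [case: hB|rewrite exprS; apply: subringM]. Qed.
Lemma subring_nat B n : is_subring B -> B n%:R.
Proof.
move=> hB; elim: n => [|n IHn]; first exact: subring0.
by rewrite -addn1 natrD; apply: subringD => //; case: hB.
Qed.
Lemma subring_sum B I (s : seq I) (P : pred I) (F : I -> K) :
  is_subring B -> (forall i, P i -> B (F i)) -> B (\sum_(i <- s | P i) F i).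
Proof.
by move=> hB h; apply: (big_ind B) => //; [apply: subring0|move=> x y; apply: subringD].
Qed.

Definition adjoin B c : set K := fun x => exists2 q, pover B q & x = q.[c].

Lemma pover_sub B q r : is_subring B -> pover B q -> pover B r -> pover B (q - r).
Proof. by case=> _ h _ hq hr i; rewrite coefB; apply: h. Qed.
Lemma poverM B q r : is_subring B -> pover B q -> pover B r -> pover B (q * r).
Proof. by move=> hB /(poverP hB) hq /(poverP hB) hr; apply/(poverP hB)/rpredM. Qed.
Lemma poverX B q n : is_subring B -> pover B q -> pover B (q ^+ n).
Proof. by move=> hB /(poverP hB) hq; apply/(poverP hB)/rpredX. Qed.
Lemma poverC B x : is_subring B -> B x -> pover B x%:P.
Proof. by move=> hB Bx i; rewrite coefC; case: eqP => // _; apply: subring0. Qed.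
Lemma poverXn B n : is_subring B -> pover B 'X^n.
Proof. by move=> hB i; rewrite coefXn; apply: subring_nat. Qed.

Lemma adjoin_subring B c : is_subring B -> is_subring (adjoin B c).
Proof.
move=> hB; split.
- by exists 1; rewrite ?hornerC //; apply: poverC => //; case: hB.
- by move=> _ _ [q hq ->] [r hr ->]; exists (q - r); rewrite ?hornerE //; apply: pover_sub.
- by move=> _ _ [q hq ->] [r hr ->]; exists (q * r); rewrite ?hornerE //; apply: poverM.
Qed.

Lemma adjoin_sub B c x : is_subring B -> B x -> adjoin B c x.
Proof. by move=> hB Bx; exists x%:P; rewrite ?hornerC //; apply: poverC. Qed.

Lemma adjoin_gen B c : is_subring B -> adjoin B c c.
Proof. by move=> hB; exists 'X; rewrite ?hornerX // -['X]expr1; apply: poverXn. Qed.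

Definition localize B b : set K := fun x => exists n, B (x * b ^+ n).

Lemma localize_raise B b x n m : is_subring B -> B b -> (n <= m)%N ->
  B (x * b ^+ n) -> B (x * b ^+ m).
Proof.
by move=> hB Bb le_nm h; rewrite -(subnKC le_nm) exprD mulrA; apply: subringM => //; apply: subringX.
Qed.

Lemma localize_subring B b : is_subring B -> B b -> is_subring (localize B b).
Proof.
move=> hB Bb; split.
- by exists 0%N; rewrite mul1r expr0; case: hB.
- move=> x y [n hn] [m hm]; exists (maxn n m); rewrite mulrBl.
  by case: (hB) => _ h _; apply: h; [apply: localize_raise hn|apply: localize_raise hm];
    rewrite ?leq_maxl ?leq_maxr.
- move=> x y [n hn] [m hm]; exists (n + m)%N; rewrite exprD mulrACA.
  exact: subringM.
Qed.

Lemma localize_sub B b x : B x -> localize B b x.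
Proof. by exists 0%N; rewrite expr0 mulr1. Qed.

Lemma localize_mul B b c x : is_subring B -> B b -> B c ->
  localize B b x -> localize B (b * c) x.
Proof.
by move=> hB Bb Bc [n hn]; exists n; rewrite exprMn mulrA; apply: subringM => //; apply: subringX.
Qed.

Definition integral B (hB : is_subring B) x := integralOver (@subring_val B hB) x.

Lemma integral_sub B (hB : is_subring B) x : B x -> integral hB x.
Proof. by move=> Bx; apply: (integral_id (@subring_val B hB) (to_subring hB Bx)). Qed.

Lemma integral_root_over B (hB : is_subring B) q x :
  q \is monic -> root q x -> pover B q -> integral hB x.
Proof.
move=> mq qx hq; apply: (integral_root_monic mq qx).
by apply/integral_poly => i; apply: integral_sub.
Qed.

Lemma integral_poly_over B (hB : is_subring B) q x :
  pover B q -> integral hB x -> integral hB q.[x].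
Proof.
by move=> hq; apply: integral_horner; apply/integral_poly => i; apply: integral_sub.
Qed.

Lemma integral_monic B (hB : is_subring B) x : integral hB x ->
  exists q, [/\ q \is monic, root q x & pover B q].
Proof.
case=> q mq qx; exists (map_poly (@subring_val B hB) q); split=> //.
  exact: monic_map.
by move=> i; rewrite coef_map; apply: subring_valP.
Qed.

Lemma integral_le B B' (hB : is_subring B) (hB' : is_subring B') x :
  (forall y, B y -> B' y) -> integral hB x -> integral hB' x.
Proof.
move=> le /integral_monic[q [mq qx hq]]; apply: integral_root_over mq qx _.
by move=> i; apply: le.
Qed.

(** Multiply a monic equation of degree n + 1 for 1 / x by x^n. *)
Lemma integral_inv_mem B (hB : is_subring B) x :
  x != 0 -> B x -> integral hB x^-1 -> B x^-1.
Proof.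
move=> x0 Bx /integral_monic[q [mq qx hq]].
case E : (size q) => [|n]; first by move: mq; rewrite monicE lead_coefE E (nth_default) ?E // eq_sym oner_eq0.
have qn : q`_n = 1 by move/monicP: mq; rewrite lead_coefE E.
case: n E qn => [|n] E qn.
  move: qx; rewrite /root horner_coef E big_ord1 qn expr0 mulr1 oner_eq0 //.
move: qx; rewrite /root horner_coef E big_ord_recr /= qn mul1r addrC addr_eq0 => /eqP e.
have -> : x^-1 = x^-1 ^+ n.+1 * x ^+ n.
  by rewrite exprSr mulrAC -exprMn mulVf // expr1n mul1r.
rewrite e mulNr mulr_suml; apply: subringN => //; apply: subring_sum => // i _.
rewrite -mulrA; apply: subringM => //.
have aux m : (m <= n)%N -> x^-1 ^+ m * x ^+ n = x ^+ (n - m).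
  by move=> le_mn; rewrite -{1}(subnKC le_mn) exprD mulrA -exprMn mulVf // expr1n mul1r.
by rewrite aux; [apply: subringX | rewrite -ltnS].
Qed.

(** Only finitely many primes become invertible in each localization B[1 / g]: p is
    inverted there exactly when it divides a power of g in B. *)
Definition few_units B := is_subring B /\ forall g, B g -> g != 0 ->
  exists N, forall p j h, prime p -> (N < p)%N -> B h -> g ^+ j <> p%:R * h.

Hypothesis K0 : [pchar K] =i pred0.

Lemma natr_neq0 n : (0 < n)%N -> n%:R != 0 :> K.
Proof. by rewrite lt0n; have [/(_ K0) h _] := pcharf0P K; rewrite h. Qed.

Lemma few_units_int : few_units (fun x => exists n : int, x = n%:~R).
Proof.
split.
  split; first by exists 1.
  - by move=> _ _ [m ->] [n ->]; exists (m - n); rewrite rmorphB.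
  - by move=> _ _ [m ->] [n ->]; exists (m * n); rewrite rmorphM.
move=> _ [n ->] n0; exists `|n|%N => p j _ p_pr lt_p [m ->] eq.
have inj : injective (fun z : int => z%:~R : K).
  move=> a b /eqP; rewrite -subr_eq0 -rmorphB /= => h; apply/eqP; rewrite -subr_eq0.
  move: h; case: (a - b) => c; first by rewrite -pmulrn; case: c => // c; rewrite (negPf (natr_neq0 _)).
  by rewrite NegzE mulrNz oppr_eq0 -pmulrn (negPf (natr_neq0 _)).
have {}n0 : n != 0 by apply: contraNneq n0 => ->.
have e : n ^+ j = p%:Z * m by apply: inj; rewrite rmorphXn /= eq rmorphM /= -pmulrn.
have : (p %| `|n| ^ j)%N by rewrite -abszX e abszM /= dvdn_mulr.
rewrite Euclid_dvdX // => /andP[/dvdn_leq h _].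
by move: h; rewrite absz_gt0 n0 leqNgt lt_p => /(_ isT).
Qed.

(** If c is transcendental over B, the claim for g = q(c) follows from the claim for
    the leading coefficient of q.  Otherwise choose b0 and b1 in B such that c and
    1 / g are integral over B[1 / (b0 b1)].  If p divides a power of g, then 1 / p
    is integral over this ring, so it lies in it, and p divides a power of
    b0 b1. *)
Lemma few_units_adjoin B c : few_units B -> few_units (adjoin B c).
Proof.
move=> [hB fu]; split; first exact: adjoin_subring.
have [[q0 [hq0 q0n0 q0c]]|tr] := pselect (exists q, [/\ pover B q, q != 0 & q.[c] = 0]); last first.
(* transcendental generator: compare leading coefficients *)
  move=> _ [q hq ->] qc; have q0 : q != 0 by apply: contraNneq qc => ->; rewrite horner0.
  have l0 : lead_coef q != 0 by rewrite lead_coef_eq0.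
  have [N hN] := fu _ (hq _) l0; exists N => p j _ p_pr lt_p [r hr ->] e.
  have {}e : q ^+ j = p%:R *: r.
    apply/eqP; rewrite -subr_eq0; apply/negPn/negP => ne; apply: tr.
    exists (q ^+ j - p%:R *: r); split=> //; last by rewrite !hornerE e subrr.
    apply: pover_sub => //; first exact: poverX.
    by rewrite -mul_polyC; apply: poverM => //; apply: poverC => //; apply: subring_nat.
  apply: (hN p j (r`_(size (q ^+ j)).-1) p_pr lt_p (hr _)).
  by rewrite -lead_coef_exp lead_coefE; move: (size _).-1 => n; rewrite e coefZ.
(* algebraic generator: B[c] becomes integral after inverting b0 * b1 *)
move=> g Bg g0; set b0 := lead_coef q0; have Bb0 : B b0 by apply: hq0.
have b0n0 : b0 != 0 by rewrite lead_coef_eq0.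
have hB' := localize_subring hB Bb0.
have c_int : integral hB' c.
  apply: (@integral_root_over _ _ (b0^-1 *: q0)).
  - by rewrite monicE lead_coefZ mulVf.
  - by rewrite /root hornerZ q0c mulr0.
  - by move=> i; exists 1%N; rewrite coefZ expr1 mulrAC mulVf // mul1r.
have [q hq gE] := Bg.
have g_int : integral hB' g.
  by rewrite gE; apply: integral_poly_over => // i; apply: localize_sub.
have [P [mP Pg hP]] := integral_monic g_int.
have [m [Q [PE Q0]]] : exists m Q, P = Q * 'X^m /\ Q`_0 != 0.
  have P0 : P != 0 by apply: monic_neq0.
  have [m [Q Q0 PE]] := multiplicity_XsubC P 0.
  by exists m, Q; rewrite PE subr0; split=> //; move: Q0; rewrite P0 /= /root horner_coef0.
have hQ : pover (localize B b0) Q.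
  by move=> i; have := hP (i + m)%N; rewrite PE coefMXn ltnNge leq_addl /= addnK.
have Qg : Q.[g] = 0.
  move: Pg; rewrite PE /root hornerM hornerXn mulf_eq0 expf_eq0 (negPf g0) andbF orbF.
  by move/eqP.
have [n hn] := hQ 0%N; set b1 := Q`_0 * b0 ^+ n in hn.
have b1n0 : b1 != 0 by rewrite mulf_neq0 // expf_neq0.
have Bb : B (b0 * b1) by apply: subringM.
have hB'' := localize_subring hB Bb.
have le' y : localize B b0 y -> localize B (b0 * b1) y by apply: localize_mul.
have b1V : localize B (b0 * b1) b1^-1.
  by exists 1%N; rewrite expr1 [b0 * b1]mulrC mulrA mulVf // mul1r.
have Q0V : localize B (b0 * b1) (Q`_0)^-1.
  have -> : (Q`_0)^-1 = b1^-1 * b0 ^+ n.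
    by rewrite /b1 invfM -mulrA mulVf ?mulr1 // expf_neq0.
  by apply: subringM => //; apply: localize_sub; apply: subringX.
have gV_int : integral hB'' g^-1.
  have -> : g^-1 = (- (Q`_0)^-1 *: (drop_poly 1 Q)).[g].
    have := poly_take_drop 1 Q => /(congr1 (horner^~ g)); rewrite Qg hornerD hornerM hornerXn expr1.
    have -> : (take_poly 1 Q).[g] = Q`_0.
      by rewrite (@horner_coef_wide _ 1) ?size_take_poly // big_ord1 coef_take_poly expr0 mulr1.
    move/eqP; rewrite addr_eq0 => /eqP e; rewrite hornerZ; apply: (mulIf g0).
    by rewrite mulVf // -mulrA; move: e => /(canLR (@opprK _)) <-; rewrite mulrNN mulVf.
  apply: integral_poly_over; last exact: integral_le g_int.
  move=> i; rewrite coefZ coef_drop_poly; apply: subringM => //; last exact/le'.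
  exact: subringN.
have [N hN] := fu _ Bb (mulf_neq0 b0n0 b1n0); exists N => p j h p_pr lt_p Bh e.
have p0 : p%:R != 0 :> K by apply: natr_neq0; apply: prime_gt0.
have h_int : integral hB'' h.
  have [r hr ->] := Bh; apply: integral_poly_over; last by apply: integral_le c_int.
  by move=> i; apply: localize_sub.
have pV_int : integral hB'' p%:R^-1.
  have -> : p%:R^-1 = h * g^-1 ^+ j.
    by apply: (mulfI p0); rewrite mulfV // mulrA -e -exprMn mulfV // expr1n.
  apply: integral_mul => //; elim: j {e} => [|j IHj]; first exact: integral1.
  by rewrite exprS; apply: integral_mul.
have [l hl] : localize B (b0 * b1) p%:R^-1.
  by apply: integral_inv_mem pV_int => //; apply: subring_nat.
by apply: (hN p l _ p_pr lt_p hl); rewrite mulrA mulfV // mul1r.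
Qed.

Lemma few_units_generated (cs : seq K) :
  exists2 B, few_units B & forall c, c \in cs -> B c.
Proof.
elim: cs => [|c cs [B [hB fB] hc]]; first by eexists; first exact: few_units_int.
exists (adjoin B c); first exact: few_units_adjoin.
move=> x; rewrite inE => /orP[/eqP->|/hc]; first exact: adjoin_gen.
exact: adjoin_sub.
Qed.
End Subrings.

(** * Valuation rings over a prime and their residue fields *)

Section ValuationRing.
Variable K : fieldType.
Implicit Types (B O : set K) (x y z : K).

(** Zorn's lemma is applied to the sets whose union with B is a subring that avoids
    z, so that the empty chain has an upper bound. *)
Lemma maximal_without B z : is_subring B -> ~ B z ->
  exists O, [/\ is_subring O, forall x, B x -> O x, ~ O z
    & forall C, is_subring C -> ~ C z -> (forall x, O x -> C x) -> forall x, C x -> O x].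
Proof.
move=> hB Bz; pose Q O := is_subring O /\ ~ O z.
pose P (A : set K) := Q (A `|` B)%classic.
have chain F : (F `<=` P)%classic -> total_on F subset -> P (\bigcup_(X in F) X)%classic.
  move=> FP Ftot; pose W := ((\bigcup_(X in F) X) `|` B)%classic.
  have two (op : K -> K -> K) : (forall O, is_subring O -> forall x y, O x -> O y -> O (op x y)) ->
      forall x y, W x -> W y -> W (op x y).
    move=> opP x y hx hy.
    have big X : F X -> (X `|` B)%classic x -> (X `|` B)%classic y -> W (op x y).
      move=> FX Xx Xy; have [sX _] := FP _ FX.
      by case: (opP _ sX _ _ Xx Xy) => h; [left; exists X|right].
    case: hx hy => [[X FX Xx]|Bx] [[Y FY Yy]|By].
    - have [XY|YX] := Ftot _ _ FX FY.
        by apply: (big Y) => //; left => //; apply: XY.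
      by apply: (big X) => //; left => //; apply: YX.
    - by apply: (big X) => //; [left|right].
    - by apply: (big Y) => //; [right|left].
    - by right; apply: opP.
  split; last by case=> [[X FX Xz]|//]; have [_] := FP _ FX; apply; left.
  by split; [right; case: hB|apply: two => O []|apply: two => O []].
have [A [QA maxA]] := Zorn_bigcup chain.
exists (A `|` B)%classic; case: QA => sA nz; split=> //; first by right.
move=> C sC Cz le x Cx; apply: contrapT => nx; apply: (maxA C).
  split=> [y Ay|h]; first by apply: le; left.
  by apply: nx; left; apply: h.
have -> : P C = Q C by rewrite /P; congr Q; apply/seteqP; split=> y; [case=> // By; apply: le; right|left].
by split.
Qed.

Section Maximal.
Variables (O : set K) (pi : K).
Hypothesis hO : is_subring O.
Hypothesis Opi : O pi.
Hypothesis pi0 : pi != 0.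
Hypothesis nOpi : ~ O pi^-1.
Hypothesis maxO : forall C, is_subring C -> ~ C pi^-1 -> (forall x, O x -> C x) ->
  forall x, C x -> O x.

Lemma maximal_adjoin x : ~ O x -> adjoin O x pi^-1.
Proof.
move=> nx; apply: contrapT => nC; apply: nx.
apply: (maxO (adjoin_subring x hO) nC); last exact: adjoin_gen.
by move=> y; apply: adjoin_sub.
Qed.

(** If u = 1 - pi b were not a unit, 1 / pi would be a polynomial in 1 / u over O, so
    that pi would divide a power of u, which is congruent to 1 modulo pi. *)
Lemma one_sub_unit b : O b -> 1 - pi * b != 0 /\ O (1 - pi * b)^-1.
Proof.
move=> Ob; set u := 1 - pi * b.
have one (c : K) : O c -> 1 <> pi * c.
  by move=> Oc e; apply: nOpi; suff -> : pi^-1 = c by []; apply: (mulfI pi0); rewrite mulfV.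
have u0 : u != 0 by rewrite subr_eq0; apply/eqP/one.
split=> //; apply: contrapT => nu.
have [q hq qE] := maximal_adjoin nu.
pose r := size q; pose s := \sum_(i < r) q`_i * u ^+ (r - i).
have Ou : O u by case: (hO) => O1 h _; apply: h => //; apply: subringM.
have Os : O s by apply: subring_sum => // i _; apply: subringM => //; apply: subringX.
have us : u ^+ r = pi * s.
  apply: (mulfI (invr_neq0 pi0)); rewrite mulKf // qE horner_coef mulr_suml.
  apply: eq_bigr => i _; rewrite -mulrA; congr (_ * _).
  have le_ir : (i <= r)%N by apply: ltnW.
  have aux m : (m <= r)%N -> u^-1 ^+ m * u ^+ r = u ^+ (r - m).
    by move=> le_mr; rewrite -{1}(subnKC le_mr) exprD mulrA -exprMn mulVf // expr1n mul1r.
  exact: aux.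
have [b' Ob' e] : exists2 b', O b' & u ^+ r = 1 - pi * b'.
  elim: (r) => [|n [b' Ob' IH]]; first by exists 0; rewrite ?mulr0 ?subr0 //; apply: subring0.
  exists (b + u * b').
    by apply: subringD => //; apply: subringM.
  rewrite exprS IH /u; ring.
apply: (one (s + b')); first exact: subringD.
by rewrite mulrDr -us e subrK.
Qed.

Definition inverse_in_degree x n := exists q : {poly K}, [/\ (size q <= n.+1)%N, pover O q & q.[x] = pi^-1].

(** The relation for 1 / x can be solved for x^m, because 1 - pi r(0) is a unit; it
    expresses x^m by lower powers of x and removes the term of degree n. *)
Lemma inverse_in_degree_pred x m n : x != 0 -> (0 < m)%N -> (m <= n)%N -> inverse_in_degree x^-1 m -> inverse_in_degree x n -> inverse_in_degree x n.-1.
Proof.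
move=> x0 m0 le_mn [r [sr hr rE]] [q [sq hq qE]].
have [u0 Ou] := one_sub_unit (hr 0%N); set u := 1 - pi * r`_0 in u0 Ou.
(* x ^+ m = pi * t.[x] with t of degree less than m *)
pose t := u^-1 *: \poly_(i < m) r`_(m - i).
have ht : pover O t.
  by move=> i; rewrite coefZ coef_poly; apply: subringM => //; case: ifP => // _; apply: subring0.
have st : (size t <= m)%N by rewrite (leq_trans (size_scale_leq _ _)) // size_poly.
have tE : x ^+ m = pi * t.[x].
  have e1 : x ^+ m = pi * \sum_(i < m.+1) r`_i * x ^+ (m - i).
    apply: (mulfI (invr_neq0 pi0)); rewrite mulKf // -rE (horner_coef_wide _ sr) mulr_suml.
    apply: eq_bigr => i _; rewrite -mulrA; congr (_ * _).
    have aux j : (j <= m)%N -> x^-1 ^+ j * x ^+ m = x ^+ (m - j).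
      by move=> le_j; rewrite -{1}(subnKC le_j) exprD mulrA -exprMn mulVf // expr1n mul1r.
    by apply: aux; rewrite -ltnS.
  have e2 : u * x ^+ m = pi * \sum_(i < m) r`_(m - i) * x ^+ i.
    rewrite /u mulrBl mul1r {1}e1 big_ord_recl subn0 mulrDr mulrA addrAC subrr add0r.
    congr (_ * _); rewrite (reindex_inj rev_ord_inj) /=; apply: eq_bigr => i _.
    rewrite /bump leq0n add1n subnSK //.
    by rewrite subKn // ltnW.
  apply: (mulfI u0); rewrite e2 /t hornerZ horner_poly; field.
  exact: u0.
exists (take_poly n q + (pi * q`_n) *: ('X^(n - m) * t)); split.
- have n0 : (0 < n)%N by apply: leq_trans le_mn.
  rewrite prednK // (leq_trans (size_polyD _ _)) // geq_max size_take_poly /=.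
  rewrite (leq_trans (size_scale_leq _ _)) // (leq_trans (size_polyMleq _ _)) //.
  by rewrite size_polyXn /= -[X in (_ <= X)%N](subnK le_mn) leq_add2l.
- move=> i; rewrite coefD coefZ coef_take_poly; apply: subringD => //.
    by case: ifP => // _; apply: subring0.
  by apply: subringM => //; [apply: subringM|apply: poverM => //; apply: poverXn].
- rewrite hornerD hornerZ hornerM hornerXn -qE [RHS](horner_coef_wide _ sq) big_ord_recr /=.
  rewrite (@horner_coef_wide _ n) ?size_take_poly //; congr (_ + _).
    by apply: eq_bigr => i _; rewrite coef_take_poly ltn_ord.
  have -> : x ^+ n = x ^+ (n - m) * (pi * t.[x]) by rewrite -tE -exprD subnK.
  by ring.
Qed.

(** If neither x nor 1 / x were in O, both would yield 1 / pi.  Take polynomials of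
    minimal degrees for x and 1 / x; the larger of the two degrees could still be
    lowered. *)
Lemma maximal_valuation x : x != 0 -> O x \/ O x^-1.
Proof.
move=> x0; have [Ox|nx] := pselect (O x); first by left.
have [Ox|nxV] := pselect (O x^-1); first by right.
exfalso.
have ex y : ~ O y -> exists n, `[< inverse_in_degree y n >].
  by move=> /maximal_adjoin[q hq qE]; exists (size q); apply/asboolP; exists q.
have pos y n : inverse_in_degree y n -> (0 < n)%N.
  case: n => // -[q [sq hq qE]]; case: nOpi; rewrite -qE (horner_coef_wide _ sq) big_ord1.
  by rewrite expr0 mulr1.
case: (ex_minnP (ex _ nx)) => n /asboolP hn minn.
case: (ex_minnP (ex _ nxV)) => m /asboolP hm minm.
have [le_mn|/ltnW le_nm] := leqP m n.
  have := minn n.-1 (introT (asboolP _) (inverse_in_degree_pred x0 (pos _ _ hm) le_mn hm hn)).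
  by rewrite -ltnS prednK ?ltnn // (pos _ _ hn).
have hn' : inverse_in_degree x^-1^-1 n by rewrite invrK.
have := minm m.-1 (introT (asboolP _) (inverse_in_degree_pred (invr_neq0 x0) (pos _ _ hn) le_nm hn' hm)).
by rewrite -ltnS prednK ?ltnn // (pos _ _ hm).
Qed.
End Maximal.

Section Residue.
Variable O : set K.
Hypothesis hO : is_subring O.
Hypothesis valO : forall x, x != 0 -> O x \/ O x^-1.

Definition nonunit : {pred subring_type hO} :=
  fun x : subring_type hO => `[< subring_val x = 0 \/ ~ O (subring_val x)^-1 >].

Lemma nonunitP (x : subring_type hO) : (x \in nonunit) <-> subring_val x = 0 \/ ~ O (subring_val x)^-1.
Proof. by split=> [/asboolP|?] //; apply/asboolP. Qed.

Lemma nonunit_mul x y : O x -> O y -> (y = 0 \/ ~ O y^-1) -> x * y = 0 \/ ~ O (x * y)^-1.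
Proof.
move=> Ox Oy [->|ny]; first by left; rewrite mulr0.
have [->|y0] := eqVneq y 0; first by left; rewrite mulr0.
have [->|x0] := eqVneq x 0; first by left; rewrite mul0r.
right=> h; apply: ny; have -> : y^-1 = x * (x * y)^-1 by rewrite invfM mulrA mulfV // mul1r.
exact: subringM.
Qed.

(** One of x / y and y / x is in O, so one of x and y divides the sum. *)
Lemma nonunit_add x y : O x -> O y -> (x = 0 \/ ~ O x^-1) -> (y = 0 \/ ~ O y^-1) ->
  x + y = 0 \/ ~ O (x + y)^-1.
Proof.
move=> Ox Oy nx ny; have [->|x0] := eqVneq x 0; first by rewrite add0r.
have [->|y0] := eqVneq y 0; first by rewrite addr0.
have [h|h] := valO (mulf_neq0 x0 (invr_neq0 y0)).
  have -> : x + y = (x / y + 1) * y by rewrite mulrDl divfK // mul1r.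
  by apply: nonunit_mul => //; apply: subringD => //; case: (hO).
have -> : x + y = (1 + y / x) * x by rewrite mulrDl divfK // mul1r.
apply: nonunit_mul => //; apply: subringD => //; first by case: (hO).
by move: h; rewrite invf_div.
Qed.

Lemma nonunit_idealr : idealr_closed nonunit.
Proof.
split.
- by apply/nonunitP; left; rewrite raddf0.
- apply/negP => /nonunitP; rewrite rmorph1 invr1; case=> [/eqP|]; first by rewrite oner_eq0.
  by case; case: (hO).
move=> a u v /nonunitP hu /nonunitP hv; apply/nonunitP; rewrite rmorphD rmorphM.
have Oa := subring_valP a; have Ou := subring_valP u; have Ov := subring_valP v.
by apply: nonunit_add => //; [apply: subringM|apply: nonunit_mul].
Qed.

HB.instance Definition _ := isIdealr.Build (subring_type hO) nonunit nonunit_idealr.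

Definition residue := {ideal_quot nonunit}.
HB.instance Definition _ := GRing.ComNzRing.on residue.

Definition residue_pi : subring_type hO -> residue := \pi_residue.
HB.instance Definition _ := GRing.RMorphism.on residue_pi.

Lemma residue_pi_eq0 (x : subring_type hO) : residue_pi x = 0 <-> x \in nonunit.
Proof.
rewrite -{2}[x]subr0 Quotient.idealrBE -(raddf0 residue_pi).
by split=> [e|/eqP//]; apply/eqP.
Qed.

Lemma residue_unit (a : residue) : a != 0 -> exists b, b * a = 1.
Proof.
move=> a0; pose x := repr a; have ax : a = residue_pi x by rewrite /residue_pi reprK.
have : x \notin nonunit by apply: contraNN a0 => /residue_pi_eq0 h; rewrite ax h.
move=> h; have [nx0 Ox] : subring_val x <> 0 /\ O (subring_val x)^-1.
  by split; [move=> e|apply: contrapT => e]; case/negP: h; apply/nonunitP; [left|right].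
exists (residue_pi (to_subring hO Ox)); rewrite ax -rmorphM -(rmorph1 residue_pi).
congr residue_pi; apply: val_inj; rewrite /= mulVf //; exact/eqP.
Qed.

Definition residue_inv (a : residue) : residue :=
  if pselect (a != 0) is left h then projT1 (cid (residue_unit h)) else 0.

Lemma residue_mulV (a : residue) : a != 0 -> residue_inv a * a = 1.
Proof. by rewrite /residue_inv; case: pselect => // h _; case: cid. Qed.

Lemma residue_inv0 : residue_inv 0 = 0.
Proof. by rewrite /residue_inv; case: pselect => // h; case/eqP: (h). Qed.

HB.instance Definition _ := GRing.ComNzRing_isField.Build residue residue_mulV residue_inv0.
End Residue.

(** The last two clauses say that the kernel of phi consists of the nonunits of O,
    and that O contains the elements of cs. *)
Lemma exists_reduction (cs : seq K) N : [pchar K] =i pred0 ->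
  exists (p : nat) (O : comNzRingType) (k : fieldType) (iota : {rmorphism O -> K})
    (phi : {rmorphism O -> k}),
  [/\ (N < p)%N, p \in [pchar k], injective iota,
    forall x y : O, (exists z : O, y = x * z) \/ (exists z : O, x = y * z)
    & (forall x : O, phi x = 0 \/ exists y : O, x * y = 1) /\
      forall c, c \in cs -> exists o, iota o = c].
Proof.
move=> K0; have [B [hB fB] hcs] := few_units_generated K0 cs.
have [M hM] := fB 1 (let: And3 h _ _ := hB in h) (oner_neq0 _).
have [p lt_p p_pr] := prime_above (maxn M N).
have {lt_p} [ltMp ltNp] : (M < p)%N /\ (N < p)%N by move: lt_p; rewrite gtn_max => /andP.
have p0 : p%:R != 0 :> K by apply: natr_neq0 => //; apply: prime_gt0.
have nBp : ~ B p%:R^-1.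
  by move=> h; apply: (hM p 1%N _ p_pr ltMp h); rewrite expr1 mulfV.
have [O [hO le_BO nOp maxO]] := maximal_without hB nBp.
have Op : O p%:R by apply: subring_nat.
have valO := maximal_valuation hO Op p0 nOp maxO.
exists p, (subring_type hO), (residue hO valO), (@subring_val _ _ hO), (@residue_pi O hO valO).
have phip : (@residue_pi O hO valO) p%:R = 0.
  by apply/residue_pi_eq0/nonunitP; right; rewrite rmorph_nat.
split=> //.
- by rewrite inE p_pr /= -(rmorph_nat (@residue_pi O hO valO)) /= phip.
- exact: val_inj.
- move=> x y; have [e|y0] := eqVneq (subring_val y) 0.
    by left; exists 0; rewrite mulr0; apply: val_inj; rewrite /= -[RHS](raddf0 (@subring_val _ _ hO)).
  have [e|x0] := eqVneq (subring_val x) 0.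
    by right; exists 0; rewrite mulr0; apply: val_inj; rewrite /= -[RHS](raddf0 (@subring_val _ _ hO)).
  have [h|h] := valO _ (mulf_neq0 x0 (invr_neq0 y0)).
    right; exists (to_subring hO h); apply: val_inj => /=.
    by rewrite -/(subring_val y) mulrC divfK.
  left; exists (to_subring hO h); apply: val_inj => /=.
  by rewrite -/(subring_val x) invf_div mulrC divfK.
split=> [x|c /hcs Bc]; last by exists (to_subring hO (le_BO _ Bc)).
have [/eqP h|h] := eqVneq (@residue_pi O hO valO x) 0; first by left; apply/eqP.
right; have [nx0 Ox] : subring_val x <> 0 /\ O (subring_val x)^-1.
  by split; [move=> e|apply: contrapT => e]; case/eqP: h; apply/residue_pi_eq0/nonunitP; [left|right].
exists (to_subring hO Ox); apply: val_inj; rewrite /= mulfV //; exact/eqP.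
Qed.
End ValuationRing.

(** * Skew partners of symmetric elements in characteristic zero *)

Section Lift.
Variables (R R' : comNzRingType) (iota : {rmorphism R -> R'}).
Hypothesis iota_inj : injective iota.

Lemma wmap_inj : injective (wmap iota).
Proof.
move=> x y e; apply: wcoefP => i j; apply: iota_inj.
by rewrite -(coef_wmap iota x) -(coef_wmap iota y) e.
Qed.

Lemma wmap_lift (x : wey R') : (forall i j, exists o, iota o = wcoef x i j) ->
  exists x0, wmap iota x0 = x.
Proof.
move=> h; have /choice[f fE] : forall ij : nat * nat, exists o, iota o = wcoef x ij.1 ij.2.
  by move=> [i j]; apply: h.
have liftp (q : {poly R'}) : (forall i, exists o, iota o = q`_i) ->
    exists q0, map_poly iota q0 = q.
  move=> /choice[g gE]; exists (\poly_(i < size q) g i); apply/polyP => i.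
  rewrite coef_map coef_poly; case: ltnP => h'; first by rewrite /= gE.
  by rewrite nth_default // raddf0.
have /choice[g gE] : forall j, exists c, map_poly iota c = (wsym x)`_j.
  by move=> j; apply: liftp => i; apply: h.
exists (\sum_(j < size (wsym x)) wC (g j) * wV ^+ j).
rewrite wmap_sum [RHS]weyE; apply: eq_bigr => j _.
by rewrite rmorphM rmorphXn /= wmapV wmapC gE.
Qed.

Lemma wbound_wmap m n x : wbound m n (wmap iota x) -> wbound m n x.
Proof.
move=> /wboundP h; apply/wboundP => i j xij; apply: h.
by rewrite coef_wmap -(raddf0 iota) (inj_eq iota_inj).
Qed.
End Lift.

(** Degrees and leading coefficients in v show that A = b(u) + c1 v with c1 constant;
    then b(u) is both symmetric and skew. *)
Lemma skew_pth_root (k : fieldType) (p : nat) (A : wey k) (c : k) : (0 < p)%N ->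
  2%:R != 0 :> k -> A != 0 -> adj A = - A -> A ^+ p = c *: wV ^+ p ->
  forall i j, wcoef A i j != 0 -> i = 0%N /\ j = 1%N.
Proof.
move=> p0 two A0 adjA Ap.
have [sz ld] := size_weyX p A0.
have c0 : c != 0.
  apply/eqP => c0; have : A ^+ p = 0 by rewrite Ap c0 scale0r.
  by move: sz => /[swap] ->; rewrite size_poly0.
have cVE : wsym (c *: wV ^+ p) = c%:P *: 'X^p by rewrite wVXn.
have cP0 : c%:P != 0 :> {poly k} by rewrite polyC_eq0.
move: sz ld; rewrite Ap cVE size_scale // size_polyXn lead_coefZ lead_coefXn mulr1.
move=> [/esym sz] ld.
have {}sz : size (wsym A) = 2%N.
  move/eqP: sz; rewrite -{2}[p]mul1n eqn_mul2r eqn0Ngt p0 /= => /eqP.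
  by case: (size _) => [|n] //= ->.
have slc : size (lead_coef (wsym A)) = 1%N.
  have := congr1 (fun q : {poly k} => (size q).-1) ld; rewrite size_polyC c0 /= size_exp.
  move/esym/eqP; rewrite muln_eq0 [p == 0%N]eqn0Ngt p0 orbF.
  have : lead_coef (wsym A) != 0 by rewrite lead_coef_eq0.
  by rewrite -size_poly_gt0; case: (size _) => [|[|]].
have /eqP/size_poly1P[c1 c1n lE] := slc.
pose b := (wsym A)`_0.
have AE : A = wC b + c1 *: wV.
  rewrite [LHS]weyE sz !big_ord_recr big_ord0 /= add0r expr0 mulr1 expr1.
  by congr (_ + _); rewrite wscaleE -lE lead_coefE sz.
have b0 : b = 0.
  have : wC b *+ 2 = 0.
    have := adjA; rewrite {1}AE raddfD /= adjC adjZ adjV scalerN AE opprD => /addIr /eqP.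
    by rewrite -addr_eq0 mulr2n => /eqP.
  move=> h; apply/polyP => i; rewrite coef0.
  have := congr1 (fun x => wcoef x i 0) h; rewrite wcoefMn wcoef0.
  have -> : wcoef (wC b) i 0 = b`_i by rewrite -[wC b]mulr1 -(expr0 wV) wcoefCVn.
  by rewrite -mulr_natr => /eqP; rewrite mulf_eq0 (negPf two) orbF => /eqP.
move=> i j; rewrite AE b0 raddf0 add0r wcoefZ -[wV]mul1r -(expr0 wU) -[wV]expr1 wcoefUV.
by case: andP => [[/eqP -> /eqP ->]|] //; rewrite mulr0 eqxx.
Qed.

Section Core.
Variable K : fieldType.
Hypothesis K0 : [pchar K] =i pred0.

(** The prime exceeds d * d, so that determinants of exponents are detected modulo
    p, and it exceeds 2, so that the adjoint negates v^p. *)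
Theorem skew_partner_linear (S A : wey K) : lie A S = 1 -> adj S = S -> adj A = - A ->
  exists c : K, A = c *: wV.
Proof.
move=> AS adjS adjA.
have [d1 bS] := wbound_exists S; have [d2 bA] := wbound_exists A.
pose d := maxn d1 d2.
have {}bS : wbound d d S by apply: wboundS bS; rewrite leq_maxl.
have {}bA : wbound d d A by apply: wboundS bA; rewrite leq_maxr.
pose coefs (x : wey K) := [seq wcoef x ij.1 ij.2 | ij : 'I_d.+1 * 'I_d.+1].
have in_coefs x i j : wbound d d x -> wcoef x i j != 0 -> wcoef x i j \in coefs x.
  move=> /wboundP h /h /andP[li lj].
  by apply/fintype.imageP; exists (Ordinal (li : (i < d.+1)%N), Ordinal (lj : (j < d.+1)%N)).
pose cs := coefs S ++ coefs A ++ [seq a^-1 | a <- coefs A].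
have [p [O [k [iota [phi [lt_p pk iinj Oval [Oloc lift]]]]]]] := exists_reduction cs (d * d + 2) K0.
have p_pr := pchar_prime pk; have p_gt0 := prime_gt0 p_pr.
have p_odd : odd p.
  by have [p2|//] := even_prime p_pr; move: lt_p; rewrite p2 ltnNge leq_addl.
have Otf (x : O) : x *+ p = 0 -> x = 0.
  move=> h; apply: iinj; rewrite raddf0; have := congr1 iota h; rewrite raddfMn raddf0 /=.
  rewrite -mulr_natr => /eqP; rewrite mulf_eq0 (negPf (natr_neq0 K0 p_gt0)) orbF.
  by move/eqP.
have lift0 x : wbound d d x -> {subset coefs x <= cs} -> exists x0, wmap iota x0 = x.
  move=> bx sx; apply: wmap_lift => i j.
  have [->|nz] := eqVneq (wcoef x i j) 0; first by exists 0; rewrite raddf0.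
  by apply: lift; apply: sx; apply: in_coefs.
have [S0 S0E] : exists S0, wmap iota S0 = S.
  by apply: lift0 => // x; rewrite mem_cat => ->.
have [A0 A0E] : exists A0, wmap iota A0 = A.
  by apply: lift0 => // x; rewrite !mem_cat => ->; rewrite orbT.
have inj := wmap_inj iinj.
have AS0 : lie A0 S0 = 1 by apply: inj; rewrite wmap_lie S0E A0E AS rmorph1.
have adjS0 : adj S0 = S0 by apply: inj; rewrite wmap_adj S0E.
have adjA0 : adj A0 = - A0 by apply: inj; rewrite wmap_adj A0E raddfN /= A0E.
have bS0 : wbound d d S0 by apply: (wbound_wmap iinj); rewrite S0E.
have bA0 : wbound d d A0 by apply: (wbound_wmap iinj); rewrite A0E.
have [sg [al [powA sgP alP pp]]] :=
  poisson_pair pk p_odd Oval Otf Oloc bS0 bA0 AS0 adjS0 adjA0.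
have lt_dp : (d * d < p)%N by apply: leq_ltn_trans lt_p; rewrite leq_addr.
have alE := skew_support pk lt_dp sgP alP pp.
pose A1 := wmap phi A0.
have A1_pow : A1 ^+ p = al 0%N 1%N *: wV ^+ p.
  rewrite /A1 powA; apply: wcoefP => i j; rewrite wcoef_lattice_sum // wcoefZ.
  rewrite -[wV ^+ p]mul1r -(expr0 wU) wcoefUV.
  have [/andP[/eqP -> /eqP ->]|ne] := boolP ((i == 0%N) && (j == p)).
    rewrite dvdn0 dvdnn div0n divnn p_gt0 /= mulr1.
    case: ifP => // h; apply/esym/eqP/negPn/negP => /alP[_ h1 _].
    by rewrite ltnS h1 in h.
  rewrite mulr0; case: ifP => // /and4P[pi pj _ _].
  apply/eqP/negPn/negP => /alE [hi hj]; case/negP: ne.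
  by rewrite -(divnK pi) -(divnK pj) hi hj mul0n mul1n !eqxx.
have A1_adj : adj A1 = - A1 by rewrite -wmap_adj adjA0 raddfN.
have A1_neq0 : A1 != 0.
  apply/eqP => h; have := congr1 (wmap phi) AS0; rewrite wmap_lie -/A1 h lie0l rmorph1.
  by move/eqP; rewrite eq_sym oner_eq0.
have A1_supp := skew_pth_root p_gt0 (two_neq0 pk p_odd) A1_neq0 A1_adj A1_pow.
have A_supp i j : wcoef A i j != 0 -> i = 0%N /\ j = 1%N.
  move=> nz; apply: A1_supp; rewrite coef_wmap.
  have [o oE] : exists o, iota o = (wcoef A i j)^-1.
    by apply: lift; rewrite !mem_cat map_f ?orbT //; apply: in_coefs.
  have : wcoef A0 i j * o = 1.
    by apply: iinj; rewrite rmorphM /= oE -coef_wmap A0E mulfV // rmorph1.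
  by move/(congr1 phi)/eqP; apply: contraTneq => h; rewrite rmorphM /= h mul0r rmorph1 eq_sym oner_eq0.
exists (wcoef A 0 1); apply: wcoefP => i j; rewrite wcoefZ.
rewrite -[wV]mul1r -(expr0 wU) -[wV]expr1 wcoefUV.
have [/andP[/eqP -> /eqP ->]|ne] := boolP ((i == 0%N) && (j == 1%N)); first by rewrite mulr1.
rewrite mulr0; apply/eqP; apply: contraNT ne => /A_supp[-> ->]; by rewrite !eqxx.
Qed.
End Core.

(** * Morphisms, and simplicity in characteristic zero *)

Section PlusMinusMorphisms.
Variables (K : fieldType) (A : algType K).
Implicit Types (f g : A -> A) (e : bool).

(** Endomorphisms for e = false and anti-endomorphisms for e = true, so that both
    kinds of conjugation are treated at once. *)
Definition is_morph e f :=
  [/\ linear f, f 1 = 1 & forall a b, f (a * b) = if e then f b * f a else f a * f b].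

Lemma is_morph_comp e1 e2 f g :
  is_morph e1 f -> is_morph e2 g -> is_morph (e1 (+) e2) (f \o g).
Proof.
move=> [lf f1 fM] [lg g1 gM]; split=> [c x y||a b] /=; first by rewrite lg lf.
- by rewrite g1 f1.
- by rewrite gM; case: e2 {gM}; rewrite fM; case: e1 {fM}.
Qed.

Lemma is_morph_inv e f g : is_morph e f -> cancel f g -> cancel g f -> is_morph e g.
Proof.
move=> [lf f1 fM] fK gK; split=> [c x y||a b].
- by apply: (can_inj fK); rewrite lf !gK.
- by apply: (can_inj fK); rewrite gK f1.
- by apply: (can_inj fK); rewrite gK; case: e fM => fM; rewrite fM !gK.
Qed.

Lemma is_morph_conj g : automorphism g \/ anti_automorphism g -> exists e, is_morph e g.
Proof.
case=> [[[lg [g1 gM]] _]|[[lg g1 gM] _]]; first by exists false.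
by exists true.
Qed.

Lemma is_morph_endo f : is_morph false f <-> endomorphism f.
Proof. by split=> [[lf f1 fM]|[lf [f1 fM]]]; split. Qed.
End PlusMinusMorphisms.

Section WevalInjective.
Variables (K : fieldType) (B : algType K) (S A : B).
Hypothesis K0 : [pchar K] =i pred0.
Hypothesis AS : lie A S = 1.

Lemma wcoef_iter_lieU (x : wey K) n i j :
  wcoef (iter n (fun y => lie y wU) x) i j = wcoef x i (j + n) *+ (j + n) ^_ n.
Proof.
elim: n j => [|n IHn] j; first by rewrite addn0 ffactn0 mulr1n.
rewrite iterS wcoef_lieU IHn addSnnS -mulrnA; congr (_ *+ _).
by rewrite ffactnSr -addSnnS addnK.
Qed.

Lemma wcoef_iter_lieV (x : wey K) n i j :
  wcoef (iter n (lie wV) x) i j = wcoef x (i + n) j *+ (i + n) ^_ n.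
Proof.
elim: n i => [|n IHn] i; first by rewrite addn0 ffactn0 mulr1n.
rewrite iterS wcoef_lieV IHn addSnnS -mulrnA; congr (_ *+ _).
by rewrite ffactnSr -addSnnS addnK.
Qed.

(** The Weyl algebra is simple in characteristic zero: commutators with u and v
    differentiate the symbol, and lower a nonzero element of the kernel to a
    nonzero constant. *)
Lemma weval_eq0 (x : wey K) : weval S A x = 0 -> x = 0.
Proof.
move=> ex; apply/eqP/negPn/negP => x0.
pose n := (size (wsym x)).-1; pose m := (size (lead_coef (wsym x))).-1.
pose y := iter n (fun y => lie y wU) x; pose z := iter m (lie wV) y.
have ey : weval S A y = 0.
  rewrite /y; elim: (n) => //= n' IH.
  by rewrite weval_lie // IH lie0l.
have ez : weval S A z = 0.
  rewrite /z; elim: (m) => //= m' IH.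
  by rewrite weval_lie // IH lie0r.
pose c := lead_coef (lead_coef (wsym x)) *+ n`! *+ m`!.
have zE : z = c%:A.
  apply: wcoefP => i j; rewrite wcoefZ wcoef1 wcoef_iter_lieV wcoef_iter_lieU.
  case: j => [|j]; last first.
    rewrite andbF mulr0 [wcoef x _ _](_ : _ = 0) ?mul0rn //.
    rewrite /wcoef [(wsym x)`__]nth_default ?coef0 // /n.
    by move: (size _) => s; rewrite addSn -addnS (leq_trans (leqSpred _)) // leq_addl.
  rewrite add0n andbT; case: i => [|i]; last first.
    rewrite mulr0 [wcoef x _ _](_ : _ = 0) ?mul0rn //.
    rewrite /wcoef -lead_coefE nth_default // /m.
    by move: (size _) => s; rewrite addSn -addnS (leq_trans (leqSpred _)) // leq_addl.
  by rewrite add0n !ffactnn mulr1.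
have c0 : c != 0.
  rewrite /c -mulr_natr -[_ *+ n`!]mulr_natr !mulf_neq0 ?lead_coef_eq0 //.
    by apply: natr_neq0 => //; apply: fact_gt0.
  by apply: natr_neq0 => //; apply: fact_gt0.
move: ez; rewrite zE wevalZ // weval1 // => /eqP; rewrite scaler_eq0 (negPf c0).
by rewrite oner_eq0.
Qed.

Lemma weval_inj : injective (weval S A).
Proof.
move=> x y e; apply/eqP; rewrite -subr_eq0; apply/eqP/weval_eq0.
by rewrite raddfB /= e subrr.
Qed.
End WevalInjective.

(** * Endomorphisms commuting with an involution *)

Section IsMorphLinear.
Variables (K : fieldType) (B : algType K) (e : bool) (f : B -> B).
Hypothesis mf : is_morph e f.

Lemma is_morphD a b : f (a + b) = f a + f b.
Proof. by have [lin _ _] := mf; have := lin 1 a b; rewrite !scale1r. Qed.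

Lemma is_morphZ c a : f (c *: a) = c *: f a.
Proof.
have f0 : f 0 = 0 by apply: (@addrI _ (f 0)); rewrite -is_morphD !addr0.
by have [lin _ _] := mf; have := lin c a 0; rewrite !addr0 f0 addr0.
Qed.
End IsMorphLinear.

Section AbstractWeyl.
Variables (K : fieldType) (B : algType K) (X Y : B) (alpha : B -> B).
Hypothesis K0 : [pchar K] =i pred0.
Hypothesis YX : Y * X - X * Y = 1.
Hypothesis gen_ind : forall P : B -> Prop,
  (forall a b, P a -> P b -> P (a + b)) -> (forall a b, P a -> P b -> P (a * b)) ->
  (forall c : K, P c%:A) -> P X -> P Y -> forall a, P a.
Hypothesis alpha_morph : is_morph true alpha.
Hypothesis alphaX : alpha X = Y.
Hypothesis alphaY : alpha Y = X.
Implicit Types (a b : B) (x y : wey K).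

Let u : B := X + Y.
Let v : B := 2%:R^-1 *: (Y - X).
Local Notation ev := (weval u v).

Let two : 2%:R != 0 :> K. Proof. exact: natr_neq0. Qed.

Let vu : lie v u = 1.
Proof.
rewrite /v lieZl /u lieDr !lieBl !liexx subr0 sub0r -lieN -mulr2n.
by rewrite /lie YX -scaler_nat scalerA mulVf // scale1r.
Qed.

Let X_uv : X = 2%:R^-1 *: u - v.
Proof.
rewrite /v /u -scalerBr opprB addrACA subrr addr0 -mulr2n -scaler_nat scalerA.
by rewrite mulVf // scale1r.
Qed.

Let Y_uv : Y = 2%:R^-1 *: u + v.
Proof.
rewrite /v /u -scalerDr [X + Y]addrC addrACA subrr addr0 -mulr2n -scaler_nat scalerA.
by rewrite mulVf // scale1r.
Qed.

Let alpha_u : alpha u = u.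
Proof. by rewrite (is_morphD alpha_morph) alphaX alphaY addrC. Qed.

Let alpha_v : alpha v = - v.
Proof.
rewrite (is_morphZ alpha_morph) (is_morphD alpha_morph) -[- X]scaleN1r.
by rewrite (is_morphZ alpha_morph) alphaX alphaY scaleN1r -scalerN opprB.
Qed.

Let ev_surj a : exists x, ev x = a.
Proof.
have eU := wevalU u v; have eV := wevalV u v.
have eZ := wevalZ vu; have eM := wevalM vu; have e1 := weval1 vu.
elim/gen_ind: a => [a b [x <-] [y <-]|a b [x <-] [y <-]|c||].
- by exists (x + y); rewrite raddfD.
- by exists (x * y); rewrite eM.
- by exists c%:A; rewrite eZ e1.
- by exists (2%:R^-1 *: wU - wV); rewrite raddfB /= eZ eU eV -X_uv.
- by exists (2%:R^-1 *: wU + wV); rewrite raddfD /= eZ eU eV -Y_uv.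
Qed.

Let alpha_ev x : alpha (ev x) = ev (adj x).
Proof.
have [_ e1 eM] := alpha_morph; have eD := is_morphD alpha_morph.
have eZ := is_morphZ alpha_morph.
have evZ := wevalZ vu; have evM := wevalM vu.
elim/wey_gen_ind: x => [x y hx hy|x y hx hy|c||].
- by rewrite !raddfD /= eD hx hy.
- by rewrite evM eM hx hy adjM evM.
- by rewrite adjZ adj1 evZ weval1 // eZ e1.
- by rewrite adjC wevalU alpha_u.
- by rewrite adjV raddfN /= wevalV alpha_v.
Qed.

(** By [skew_partner_linear], f(v) = c v, and f(u) = u / c + q(v).  So u and v are in
    the image, and f is injective because the Weyl algebra is simple. *)
Theorem symmetric_endo_bijective (f : B -> B) :
  is_morph false f -> (forall a, f (alpha a) = alpha (f a)) -> bijective f.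
Proof.
move=> mf fE; have [_ f1 fM] := mf; have fD := is_morphD mf; have fZ := is_morphZ mf.
have fN a : f (- a) = - f a by rewrite -scaleN1r fZ scaleN1r.
have f_lie a b : f (lie a b) = lie (f a) (f b) by rewrite /lie fD fN !fM.
have evM := wevalM vu; have evZ := wevalZ vu; have ev_lie := weval_lie vu.
have ev_inj := weval_inj K0 vu.
have [S SE] := ev_surj (f u); have [A AE] := ev_surj (f v).
have ffvu : lie (f v) (f u) = 1 by rewrite -f_lie vu f1.
have AS : lie A S = 1 by apply: ev_inj; rewrite ev_lie SE AE ffvu weval1.
have adjS : adj S = S.
  apply: ev_inj; rewrite -alpha_ev SE -fE; congr f.
  by rewrite -(wevalU u v) alpha_ev adjC.
have adjA : adj A = - A.
  apply: ev_inj; rewrite -alpha_ev raddfN /= AE -fE -fN; congr f.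
  by rewrite -(wevalV u v) alpha_ev adjV raddfN.
have [c cE] := skew_partner_linear K0 AS adjS adjA.
have c0 : c != 0.
  apply/eqP => c0; move: AS; rewrite cE c0 scale0r lie0l => /esym/eqP.
  by rewrite oner_eq0.
have fv : f v = c *: v by rewrite -AE cE evZ wevalV.
(* [v, S] is a constant, so S is linear in u up to a polynomial in v *)
have [q SE'] : exists q : {poly K}, S = c^-1 *: wU + \sum_(j < size q) q`_j *: wV ^+ j.
  have vS : lie wV S = c^-1%:A.
    by apply: (scalerI c0); rewrite -lieZl -cE AS scalerA mulfV // scale1r.
  pose q := \poly_(j < size (wsym S)) wcoef S 0 j.
  exists q; apply: wcoefP => i j; rewrite wcoefD wcoefZ wcoef_sum.
  have uE : wcoef (wU : wey K) i j = ((i == 1%N) && (j == 0%N))%:R.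
    by rewrite -[wU]expr1 -[wU ^+ 1]mulr1 -(expr0 wV) wcoefUV.
  have vE (l : nat) : wcoef (wV ^+ l : wey K) i j = ((i == 0%N) && (j == l))%:R.
    by rewrite -[wV ^+ l]mul1r -(expr0 wU) wcoefUV.
  rewrite uE; under eq_bigr => l _ do rewrite wcoefZ vE.
  case: i {uE vE} => [|i] /=; last first.
    rewrite big1 ?addr0 => [|l _]; last by rewrite mulr0.
    have := wcoef_lieV S i j; rewrite vS wcoefZ wcoef1 => e.
    apply: (mulIf (natr_neq0 K0 (ltn0Sn i))); rewrite [LHS]mulr_natr -e eqSS.
    by case: i {e} => [|i]; rewrite ?mulr1 //= !mulr0 mul0r.
  have qE : q`_j = wcoef S 0 j.
    rewrite coef_poly; case: ltnP => // h.
    by rewrite /wcoef [(wsym S)`_j]nth_default // coef0.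
  rewrite mulr0 add0r -qE; have [lt_j|le_j] := ltnP j (size q).
    rewrite (bigD1 (Ordinal lt_j)) //= eqxx mulr1 big1 ?addr0 // => l ne.
    by rewrite eq_sym -val_eqE /= in ne *; rewrite (negPf ne) mulr0.
  rewrite nth_default // big1 // => l _.
  by rewrite gtn_eqF ?mulr0 // (leq_trans (ltn_ord l)).
pose im a := exists b, f b = a.
have imD a b : im a -> im b -> im (a + b) by move=> [x <-] [y <-]; exists (x + y).
have imM a b : im a -> im b -> im (a * b) by move=> [x <-] [y <-]; exists (x * y).
have imZ (d : K) a : im a -> im (d *: a) by move=> [x <-]; exists (d *: x).
have im1 : im 1 by exists 1.
have imv : im v by exists (c^-1 *: v); rewrite fZ fv scalerA mulVf // scale1r.
have imu : im u.
  have -> : u = c *: (f u + (-1) *: \sum_(j < size q) q`_j *: v ^+ j).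
    rewrite -SE SE' [ev (_ + _)]raddfD /= evZ wevalU [ev (\sum_(_ < _) _)]raddf_sum /=.
    have -> : \sum_(j < size q) ev (q`_j *: wV ^+ j) = \sum_(j < size q) q`_j *: v ^+ j.
      by apply: eq_bigr => j _; rewrite evZ wevalX // wevalV.
    by rewrite scaleN1r addrK scalerA mulfV // scale1r.
  apply: (imZ); apply: (imD); first by exists u.
  apply: (imZ); elim/big_rec: _ => [|j a _ ima]; first by rewrite -(scale0r 1); apply: (imZ).
  apply: (imD) => //; apply: (imZ); elim: (j : nat) => // n IHn.
  by rewrite exprS; apply: (imM).
have surj a : im a.
  have [x <-] := ev_surj a; elim/wey_gen_ind: x => [x y|x y|d||].
  - by rewrite raddfD; apply: (imD).
  - by rewrite evM; apply: (imM).
  - by rewrite evZ weval1 //; apply: (imZ).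
  - by rewrite wevalU.
  - by rewrite wevalV.
have inj : injective f.
  move=> a b; have [x <-] := ev_surj a; have [y <-] := ev_surj b => e.
  congr (weval _ _ _); apply: (weval_inj K0 ffvu).
  have E z : f (ev z) = weval (f u) (f v) z.
    elim/wey_gen_ind: z => [z t hz ht|z t hz ht|d||].
    - by rewrite !raddfD /= fD hz ht.
    - by rewrite evM fM hz ht wevalM.
    - by rewrite evZ weval1 // fZ f1 wevalZ // weval1.
    - by rewrite !wevalU.
    - by rewrite !wevalV.
  by rewrite -!E e.
have /choice[g gK] := surj.
by exists g => // a; apply: inj; rewrite gK.
Qed.
End AbstractWeyl.

Section Presentation.
Variable K : fieldType.

(** Words in X and Y span the free algebra, hence its quotient. *)
Lemma weyl_gen_ind (P : weyl K -> Prop) :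
  (forall a b, P a -> P b -> P (a + b)) -> (forall a b, P a -> P b -> P (a * b)) ->
  (forall c : K, P c%:A) -> P weylX -> P weylY -> forall a, P a.
Proof.
move=> PD PM PC PX PY; elim/weyl_ind => u.
rewrite [u]monalgE raddf_sum /=; apply: big_ind => [|a b|k _]; first by rewrite -(scale0r 1).
  exact: PD.
rewrite -free_scaleU linearZ /= -[weyl_pi _]mul1r scalerAl; apply: (PM) => //.
case: k => w; elim: w => [|b w IHw].
  suff -> : << FMonom [::] >> = 1 :> freeXY K by rewrite rmorph1 -[1]scale1r; apply: PC.
  by congr << _ >>; apply/val_inj; rewrite /= fm1.
have -> : << FMonom (b :: w) >> = << fmu b >> * << FMonom w >> :> freeXY K.
  by rewrite malgM_def fgmulUU mulr1; congr << _ >>; apply/val_inj; rewrite /= fmM fmU.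
rewrite rmorphM; apply: PM => //.
by case: b; rewrite -/(@freeX K) -/(@freeY K) -/(weylX) -/(weylY).
Qed.

Lemma exchange_morph : is_morph true (exchange : weyl K -> weyl K).
Proof. by have [[[lin e1 eM] _] _ _] := exchange_involution K. Qed.

Lemma exchangeK : involutive (exchange : weyl K -> weyl K).
Proof. by have [_ h _] := exchange_involution K. Qed.
End Presentation.

(** With gamma = g^-1 alpha g and delta = h^-1 alpha h, where alpha is the exchange
    involution, F = h f g^-1 commutes with alpha.  It is an anti-endomorphism when
    just one of g and h is an anti-automorphism; then alpha F is an endomorphism
    that commutes with alpha. *)
Theorem theorem3p3 (K : fieldType) (hK : [pchar K] =i pred0)
  (hconj : forall gamma : weyl K -> weyl K,
     involution gamma -> conjugate_involution gamma exchange)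
  (gamma delta f : weyl K -> weyl K)
  (hgamma : involution gamma) (hdelta : involution delta)
  (hf : endomorphism f) (hfgd : f \o gamma =1 delta \o f) :
  automorphism f.
Proof.
have [g [g' [/is_morph_conj[e1 mg] gK g'K gE]]] := hconj _ hgamma.
have [h [h' [/is_morph_conj[e2 mh] hK1 h'K hE]]] := hconj _ hdelta.
split=> //; pose F := h \o f \o g'.
have mF : is_morph (e2 (+) e1) F.
  have := is_morph_comp (is_morph_comp mh ((is_morph_endo f).2 hf)) (is_morph_inv mg gK g'K).
  by rewrite addbF.
have FE a : F (exchange a) = exchange (F a).
  have -> : exchange a = g (gamma (g' a)) by rewrite gE /= !g'K.
  by rewrite /F /= gK [f (gamma _)]hfgd /= hE /= h'K.
have [F' F'K FK] : bijective F.
  case: (e2 (+) e1) mF => mF; last exact: (symmetric_endo_bijective hK (weyl_YX K) (@weyl_gen_ind K) (exchange_morph K)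
    (@exchangeX K) (@exchangeY K) mF FE).
  have [F' F'K FK] : bijective (exchange \o F).
    apply: (symmetric_endo_bijective hK (weyl_YX K) (@weyl_gen_ind K) (exchange_morph K)
      (@exchangeX K) (@exchangeY K)) => [|a] /=; last by rewrite FE.
    exact: (is_morph_comp (exchange_morph K) mF).
  exists (F' \o exchange) => a /=; first exact: F'K.
  by apply: (can_inj (@exchangeK K)); apply: FK.
exists (g' \o F' \o h) => a /=.
  by rewrite -{1}[a]gK -[h (f (g' _))]/(F (g a)) F'K gK.
by apply: (can_inj hK1); rewrite -[h (f _)]/(F (F' (h a))) FK.
Qed.
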